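(* Let $d\ge3$, $G=\mathrm{SO}_{2d+1}(\mathbb{Q}_p)$, and let $\phi$, $C^{(\bullet)}$, $\tau$ be as in the context, i.e. $\phi=\dot s_1\dot s_2\cdots\dot s_{d-1}\dot s_d\dot s_{d-1}\cdots\dot s_2\dot s_0=\dot s_{\beta(1)}\cdots\dot s_{\beta(2d-1)}$, $C^{(a(2d-1)+b)}=\phi^as_{\beta(1)}\cdots s_{\beta(b)}C$ for $a\ge0$, $0\le b<2d-1$, and $\tau(x)=\mathrm{diag}(x,E_{d-1},x^{-1},E_{d-1},1)$. (a) We have $\phi^2\in T$ and $\phi^2N_0\phi^{-2}\subset N_0$. The sequence $C=C^{(0)},C^{(1)},C^{(2)},\dots$ satisfies, with $N_0^{(i)}=I_{C^{(i)}}\cap N$: $N_0=N_0^{(0)}\supset N_0^{(1)}\supset N_0^{(2)}\supset\cdots$ with $[N_0^{(i)}:N_0^{(i+1)}]=p$ for all $i\ge0$. In particular one may define $\alpha^{(j)}\in\Phi^+$ for all $j\ge0$ (see context). (b) For any $j\ge0$ we have $\alpha^{(j)}\circ\tau=\mathrm{id}_{\mathbb{Z}_p^\times}$. (c) We have $\tau(a)\phi=\phi\tau(a)$ for all $a\in\mathbb{Z}_p^\times$.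
   Context: $p$ is a prime; $E_m$ is the identity matrix; $S_m=\begin{pmatrix}0&E_m\\ E_m&0\end{pmatrix}$, $\widetilde S_d=\mathrm{diag}(S_d,1)\in\mathrm{GL}_{2d+1}$. $G=\{A\in\mathrm{SL}_{2d+1}(\mathbb{Q}_p): {}^tA\widetilde S_dA=\widetilde S_d\}$, $T$ its diagonal torus, $T_0$ the maximal bounded subgroup of $T$; $e_i:T\to\mathbb{Q}_p^\times$, $\mathrm{diag}(x_1,\dots,x_d,x_1^{-1},\dots,x_d^{-1},1)\mapsto x_i$. In additive notation $\Phi=\{\pm e_i\pm e_j: i\ne j\}\cup\{\pm e_i\}$, $\Phi^+=\{e_i\pm e_j: i<j\}\cup\{e_i\}$. $N_\alpha$ are the root subgroups, $N_\alpha^0=N_\alpha\cap\mathrm{SL}_{2d+1}(\mathbb{Z}_p)$, $N=\prod_{\alpha\in\Phi^+}N_\alpha$, $N_0$ is generated by the $N_\alpha^0$, $\alpha\in\Phi^+$. $I_0$ is the pro-$p$-Iwahori subgroup generated by $N_\alpha^0$ ($\alpha\in\Phi^+$), $(N_\alpha^0)^p$ ($\alpha\in-\Phi^+$) and the maximal pro-$p$ subgroup of $T_0$; $I$ is the Iwahori subgroup containing $I_0$; $C$ is the chamber fixed by $I$ in the apartment $A$ of $T$ in the Bruhat–Tits building; $I_D$ is the Iwahori subgroup fixing a chamber $D$. $\dot s_i=\mathrm{diag}(E_{i-1},S_1,E_{d-i-1},E_{i-1},S_1,E_{d-i-1},1)$ for $1\le i\le d-1$; $\dot s_d$ exchanges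 the $d$-th and $2d$-th standard basis vectors, sends the $(2d+1)$-st to its negative and fixes the others; $\dot u$ sends the first basis vector to $p$ times the $(d+1)$-st, the $(d+1)$-st to $p^{-1}$ times the first, the $(2d+1)$-st to its negative and fixes the others; $\dot s_0=\dot u\dot s_1\dot u$. $s_i$ is the image of $\dot s_i$ in $N(T)/T_0$. $\beta(i)=i$ for $1\le i\le d$, $\beta(i)=2d-i$ for $d\le i\le 2d-2$, $\beta(2d-1)=0$. $\tau:\mathbb{Z}_p^\times\to T_0$. Definition of $\alpha^{(j)}$: for adjacent distinct chambers $D_1,D_2$ of $A$ there is a unique $\delta\in\Phi$ with $I_{D_1}\cap N_{\delta'}=I_{D_2}\cap N_{\delta'}$ for $\delta'\ne\pm\delta$, and with $I_{D_1}\cap N_{-\delta}\subset I_{D_2}\cap N_{-\delta}$ and $I_{D_2}\cap N_\delta\subset I_{D_1}\cap N_\delta$ both of index $p$. For $D_1=C^{(j)}$, $D_2=C^{(j+1)}$ one puts $\alpha^{(j)}=\delta$; the index-$p$ chain condition means precisely that all $\alpha^{(j)}$ lie in $\Phi^+$.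
   Formalization: For p = 2 the claim fails for the true Iwahori subgroups (s_d fixes C, giving index 1); there the chambers and I_D are instead those defined by integral walls a+k and the filtration (N_a^0)^(p^k). For odd p the statement is unchanged. *)

(* Defs.v *)
From HB Require Import structures.
From mathcomp Require Import all_boot all_order all_algebra.
From mathcomp Require Import all_classical all_reals topology.

Set Implicit Arguments.
Unset Strict Implicit.
Unset Printing Implicit Defensive.

Import Order.TTheory GRing.Theory Num.Theory.
Import numFieldTopology.Exports.

Local Open Scope classical_set_scope.
Local Open Scope ring_scope.

(** * The ring Z_p and the field Q_p

    Z_p is the inverse limit of the rings Z/p^n: an element is the sequence of
    its least non-negative residues modulo p^n (so the term of index 0 is 0).
    The primality proof is a parameter of the type so that Z_p can carry its
    integral domain structure. *)
Record padic_int (p : nat) (pp : prime p) := PadicInt {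
  residue : nat -> nat;
  residueP : forall n, residue n = (residue n.+1 %% p ^ n)%N }.

Section PadicIntegers.
Variables (p : nat) (pp : prime p).
Local Notation padic_int := (padic_int pp).
Local Notation PadicInt := (PadicInt pp).

HB.instance Definition _ := gen_eqMixin padic_int.
HB.instance Definition _ := gen_choiceMixin padic_int.

Local Open Scope nat_scope.

Lemma residue_inj (x y : padic_int) : residue x =1 residue y -> x = y.
Proof.
case: x y => [f fP] [g gP] /= /funext fg; subst g.
by congr PadicInt; apply: Prop_irrelevance.
Qed.

Lemma residue_mod (x : padic_int) n : residue x n %% p ^ n = residue x n.
Proof. by rewrite residueP modn_mod. Qed.

Lemma residue_le (x : padic_int) m n :
  m <= n -> residue x n = residue x m %[mod p ^ m].
Proof.
elim: n => [|n IHn]; first by rewrite leqn0 => /eqP ->.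
rewrite leq_eqVlt => /predU1P[-> //|]; rewrite ltnS => lemn.
by rewrite -(IHn lemn) (residueP x n) modn_dvdm // dvdn_exp2l.
Qed.

Fact zero_residueP n : 0 = 0 %% p ^ n. Proof. by rewrite mod0n. Qed.
Definition padic_zero := PadicInt zero_residueP.

Fact one_residueP n : 1 %% p ^ n = 1 %% p ^ n.+1 %% p ^ n.
Proof. by rewrite modn_dvdm // dvdn_exp2l. Qed.
Definition padic_one := PadicInt one_residueP.

Fact add_residueP (x y : padic_int) n :
  (residue x n + residue y n) %% p ^ n =
  (residue x n.+1 + residue y n.+1) %% p ^ n.+1 %% p ^ n.
Proof.
rewrite modn_dvdm ?dvdn_exp2l // (residueP x n) (residueP y n).
by rewrite modnDm.
Qed.
Definition padic_add x y := PadicInt (add_residueP x y).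

Fact opp_residueP (x : padic_int) n :
  (p ^ n - residue x n) %% p ^ n =
  (p ^ n.+1 - residue x n.+1) %% p ^ n.+1 %% p ^ n.
Proof.
have lt_res k : residue x k < p ^ k.
  by rewrite residueP ltn_mod expn_gt0 prime_gt0.
rewrite modn_dvdm ?dvdn_exp2l //; apply/eqP.
rewrite -(eqn_modDr (residue x n)) subnK ?(ltnW (lt_res n)) //.
have -> : p ^ n.+1 - residue x n.+1 + residue x n
          = p ^ n.+1 - residue x n.+1 + residue x n.+1 %[mod p ^ n].
  by rewrite (residueP x n) modnDmr.
by rewrite subnK ?(ltnW (lt_res _)) // modnn eq_sym -/(dvdn _ _) dvdn_exp2l.
Qed.
Definition padic_opp x := PadicInt (opp_residueP x).

Fact mul_residueP (x y : padic_int) n :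
  (residue x n * residue y n) %% p ^ n =
  (residue x n.+1 * residue y n.+1) %% p ^ n.+1 %% p ^ n.
Proof.
rewrite modn_dvdm ?dvdn_exp2l // (residueP x n) (residueP y n).
by rewrite modnMm.
Qed.
Definition padic_mul x y := PadicInt (mul_residueP x y).

Fact padic_addA : associative padic_add.
Proof. by move=> x y z; apply: residue_inj => n /=; rewrite modnDmr modnDml addnA. Qed.
Fact padic_addC : commutative padic_add.
Proof. by move=> x y; apply: residue_inj => n /=; rewrite addnC. Qed.
Fact padic_add0 : left_id padic_zero padic_add.
Proof. by move=> x; apply: residue_inj => n /=; rewrite add0n residue_mod. Qed.
Fact padic_addN : left_inverse padic_zero padic_opp padic_add.
Proof.
move=> x; apply: residue_inj => n /=; rewrite modnDml subnK ?modnn //.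
by rewrite residueP ltnW // ltn_mod expn_gt0 prime_gt0.
Qed.

HB.instance Definition _ :=
  GRing.isZmodule.Build padic_int padic_addA padic_addC padic_add0 padic_addN.

Fact padic_mulA : associative padic_mul.
Proof. by move=> x y z; apply: residue_inj => n /=; rewrite modnMmr modnMml mulnA. Qed.
Fact padic_mulC : commutative padic_mul.
Proof. by move=> x y; apply: residue_inj => n /=; rewrite mulnC. Qed.
Fact padic_mul1 : left_id padic_one padic_mul.
Proof. by move=> x; apply: residue_inj => n /=; rewrite modnMml mul1n residue_mod. Qed.
Fact padic_mulD : left_distributive padic_mul padic_add.
Proof.
by move=> x y z; apply: residue_inj => n /=; rewrite modnMml mulnDl modnDm.
Qed.
Fact padic_one_neq0 : padic_one != padic_zero.
Proof.
apply/eqP => /(congr1 (fun x => residue x 1)) /=.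
by rewrite expn1 modn_small // prime_gt1.
Qed.

HB.instance Definition _ := GRing.Zmodule_isComNzRing.Build padic_int
  padic_mulA padic_mulC padic_mul1 padic_mulD padic_one_neq0.

Definition padic_unit : {pred padic_int} :=
  fun x => `[< exists y : padic_int, (y * x = 1)%R >].
Definition padic_inv (x : padic_int) : padic_int :=
  if x \in padic_unit then xget x [set y | (y * x = 1)%R] else x.

Fact padic_mulV : {in padic_unit, left_inverse 1%R padic_inv *%R}.
Proof.
move=> x ux; rewrite /padic_inv ux.
have /asboolP[y yx1] := ux.
exact: (@xgetPex _ x [set y | (y * x = 1)%R] (ex_intro _ y yx1)).
Qed.
Fact padic_unitP (x y : padic_int) : (y * x = 1)%R -> padic_unit x.
Proof. by move=> yx1; apply/asboolP; exists y. Qed.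
Fact padic_inv_out : {in [predC padic_unit], padic_inv =1 id}.
Proof. by move=> x; rewrite inE /= /padic_inv => /negbTE ->. Qed.

HB.instance Definition _ := GRing.ComNzRing_hasMulInverse.Build padic_int
  padic_mulV padic_unitP padic_inv_out.

Fact padic_integral (x y : padic_int) :
  (x * y = 0)%R -> (x == 0%R) || (y == 0%R).
Proof.
have nz (z : padic_int) : z != 0%R -> exists n, ~~ (p ^ n %| residue z n).
  move=> z0; apply: contrapT => /forallNP zn.
  move/eqP: z0; apply; apply: residue_inj => n /=.
  by rewrite -residue_mod; have /negP := zn n; rewrite negbK => /eqP.
move=> xy0; apply/norP => -[/nz[m xm] /nz[n yn]].
have xmn : ~~ (p ^ m %| residue x (m + n)).
  by rewrite /dvdn (residue_le x (leq_addr n m)).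
have ymn : ~~ (p ^ n %| residue y (m + n)).
  by rewrite /dvdn (residue_le y (leq_addl m n)).
have x0 : 0 < residue x (m + n)
  by rewrite lt0n; apply: contraNneq xmn => ->; rewrite dvdn0.
have y0 : 0 < residue y (m + n)
  by rewrite lt0n; apply: contraNneq ymn => ->; rewrite dvdn0.
have /eqP := congr1 (fun z => residue z (m + n)) xy0.
rewrite /= -/(dvdn _ _) pfactor_dvdn ?muln_gt0 ?x0 // lognM //.
move: xmn ymn; rewrite !pfactor_dvdn // -!ltnNge => ltx lty.
by rewrite leqNgt -addSn leq_add // ltnW.
Qed.

HB.instance Definition _ :=
  GRing.ComUnitRing_isIntegral.Build padic_int padic_integral.

End PadicIntegers.


Notation "x %:F" := (@FracField.tofrac _ x) : ring_scope.
Notation padic_num pp := {fraction (padic_int pp)}.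

Definition padic_integer (p : nat) (pp : prime p) : set (padic_num pp) :=
  [set x | exists z : padic_int pp, x = z%:F].

(** The p-adic valuation of [x != 0]; the value at 0 is immaterial. *)
Definition padic_val (p : nat) (pp : prime p) (x : padic_num pp) : int :=
  xget 0 [set k : int | exists2 u : padic_int pp,
                          u \is a GRing.unit & x = p%:R ^ k * u%:F].

(** * Subgroups of GL_n *)
Section MatrixGroups.
Variables (K : fieldType) (n : nat).
Implicit Types H A : set 'M[K]_n.

Definition is_subgroup H : Prop :=
  [/\ H `<=` [set g | g \in unitmx], H 1,
      forall g h, H g -> H h -> H (g * h) & forall g, H g -> H (invmx g)].

Definition generated A : set 'M[K]_n := smallest is_subgroup A.

(** [A] has exactly [k] left cosets [g H], [g \in A]. *)
Definition has_index A H (k : nat) : Prop :=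
  ([set [set g * h | h in H] | g in A] #= `I_k)%card.

End MatrixGroups.

(** * The group SO_{2d+1}(Q_p) and its torus *)
Section SpecialOrthogonal.
Variables (p : nat) (pp : prime p) (d : nat).
Local Notation K := (padic_num pp).
Local Notation mat := 'M[K]_(d + d + 1).
Implicit Types (A g t : mat) (H : set mat).

Definition Smx : 'M[K]_(d + d) := block_mx 0 1%:M 1%:M 0.
Definition Stilde : mat := block_mx Smx 0 0 1%:M.

Definition SO : set mat :=
  [set A | \det A = 1 /\ A^T *m Stilde *m A = Stilde].

Definition integral_mx : set mat :=
  [set A | forall i j, padic_integer (A i j)].

Definition SLZp : set mat := [set A | \det A = 1 /\ integral_mx A].

Definition torus : set mat := [set t | SO t /\ is_diag_mx t].

Definition bounded_set H : Prop :=
  exists k : nat, forall A, H A -> integral_mx ((p%:R ^+ k : K) *: A).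

(** The maximal bounded subgroup of [torus], as the union of all of its
    bounded subgroups. *)
Definition torus0 : set mat := [set t | exists H,
  [/\ is_subgroup H, H `<=` torus, bounded_set H & H t]].

Definition congruent_mx (n : nat) A g : Prop :=
  exists2 X, integral_mx X & A - g = (p%:R ^+ n : K) *: X.

Definition padic_closed H : Prop :=
  forall A, (forall n, exists2 h, H h & congruent_mx n A h) -> H A.

(** For a closed subgroup of GL(Z_p): its finite images in the GL(Z/p^n),
    of which it is the inverse limit, are p-groups. *)
Definition pro_p H : Prop :=
  padic_closed H /\ forall h, H h ->
    forall n, exists k : nat, congruent_mx n (h ^+ (p ^ k)) 1.

(** The maximal pro-p subgroup of [torus0], as the union of all of its pro-p
    subgroups. *)
Definition torus0_pro_p : set mat := [set t | exists H,
  [/\ is_subgroup H, H `<=` torus0, pro_p H & H t]].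

(** * Roots, as elements of the character lattice Z^d with basis e_1, ..., e_d *)
Definition lattice := 'rV[int]_d.
Definition e_ (i : 'I_d) : lattice := delta_mx 0 i.

Definition roots : set lattice := [set a |
  (exists (i j : 'I_d) (s t : bool),
      i != j /\ a = (-1) ^+ s *: e_ i + (-1) ^+ t *: e_ j) \/
  (exists (i : 'I_d) (s : bool), a = (-1) ^+ s *: e_ i)].

Definition pos_roots : set lattice := [set a |
  (exists i j : 'I_d, (i < j)%N /\ (a = e_ i + e_ j \/ a = e_ i - e_ j)) \/
  (exists i : 'I_d, a = e_ i)].

(** The basis vectors are numbered from 0 here: x_1, ..., x_d are the diagonal
    entries of index 0, ..., d - 1. *)
Definition chi (a : lattice) t : K :=
  \prod_(i < d) t (lshift 1 (lshift d i)) (lshift 1 (lshift d i)) ^ a 0 i.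

(** * Root subgroups *)

(** The root space of [a] in the Lie algebra of SO_{2d+1}. *)
Definition root_space (a : lattice) : set mat := [set X |
  X^T *m Stilde + Stilde *m X = 0 /\
  forall t, torus t -> t *m X *m invmx t = chi a t *: X].

(** The exponential series, the elements of the root spaces having cube 0. *)
Definition exp_mx (X : mat) : mat := 1 + X + 2%:R^-1 *: X ^+ 2.

Definition root_group (a : lattice) : set mat := exp_mx @` root_space a.

Definition root_group0 (a : lattice) : set mat := root_group a `&` SLZp.

(** The subgroup (N_a^0)^(p^k) of N_a, for k in Z. *)
Definition root_filtration (a : lattice) (k : int) : set mat :=
  [set exp_mx ((p%:R ^ k : K) *: X) |
     X in root_space a `&` [set X | SLZp (exp_mx X)]].

(** N, the product of the N_a for a > 0 (taken in any order); this product set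
    is the subgroup generated by these N_a. *)
Definition unipotent : set mat :=
  generated (\bigcup_(a in pos_roots) root_group a).

Definition unipotent0 : set mat :=
  generated (\bigcup_(a in pos_roots) root_group0 a).

Definition pro_p_iwahori : set mat := generated
  (\bigcup_(a in pos_roots) root_group0 a `|`
   \bigcup_(a in [set a | pos_roots (- a)]) [set g ^+ p | g in root_group0 a] `|`
   torus0_pro_p).

(** * The standard apartment, its chambers and their Iwahori subgroups *)
Section Apartment.
Variable R : realType.

(** The cocharacter space X_*(T) (x) R; its origin is the special point at
    which the filtrations of the root subgroups are based, i.e. whose
    stabiliser contains all the N_a^0. For p = 2, where the form [Stilde] does
    not define a smooth group scheme over Z_2, the N_a^0 are still used as the
    steps of index 0 of the filtrations. *)
Definition apartment := 'rV[R]_d.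
Implicit Types (x y z : apartment) (D : set apartment).

Definition pairing (a : lattice) y : R := \sum_(i < d) (a 0 i)%:~R * y 0 i.

Definition wall (a : lattice) (k : int) : set apartment :=
  [set y | pairing a y + k%:~R = 0].

(** The points lying, for each wall, on the same side as [x] (or both on it). *)
Definition facet x : set apartment := [set y |
  forall a k, roots a ->
    Num.sg (pairing a y + k%:~R) = Num.sg (pairing a x + k%:~R)].

Definition is_chamber D : Prop := exists2 x,
  (forall a k, roots a -> ~ wall a k x) & D = facet x.

Definition in_panel z : Prop := exists a k, [/\ roots a, wall a k z &
  forall b l, roots b -> wall b l z -> wall b l = wall a k].

Definition adjacent D1 D2 : Prop :=
  [/\ is_chamber D1, is_chamber D2, D1 <> D2 &
      exists2 z, in_panel z & closure D1 z /\ closure D2 z].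

(** Bruhat-Tits: the Iwahori subgroup of the chamber [D] is generated by T_0
    and by the N_{a,k} for the affine roots a + k that are nonnegative on [D]. *)
Definition iwahori D : set mat := generated
  (torus0 `|` [set g | exists a k,
     [/\ roots a, forall y, D y -> 0 <= pairing a y + k%:~R &
         root_filtration a k g]]).

(** The j-th coordinate of a point of the apartment, seen in the cocharacter
    space of the diagonal torus of GL_{2d+1}, as (y, - y, 0). *)
Definition ext_coord y (j : 'I_(d + d + 1)) : R :=
  row_mx (row_mx y (- y)) (0 : 'rV[R]_1) 0 j.

(** The action of N(T) on the apartment: if the monomial matrix [w] sends the
    b-th basis vector to [c] times the i-th one, then the i-th coordinate of
    the image of [y] is the b-th coordinate of [y] minus the valuation of [c].
    In particular [t] in T acts as the translation by - val(t). *)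
Definition act (w : mat) y : apartment :=
  \row_(i < d) \sum_(b | w (lshift 1 (lshift d i)) b != 0)
    (ext_coord y b - (padic_val (w (lshift 1 (lshift d i)) b))%:~R).

(** * The elements s_i and phi, and the gallery C^(j) *)

(** The matrix sending the b-th basis vector to [c b] times the [s b]-th one. *)
Definition monomial_mx (s : nat -> nat) (c : nat -> K) : mat :=
  \matrix_(i, b) (if i == s b :> nat then c b else 0).

Definition swap (i j b : nat) : nat :=
  if b == i then j else if b == j then i else b.

Definition udot : mat := monomial_mx (swap 0 d) (fun b =>
  if b == 0%N then p%:R else if b == d then p%:R^-1
  else if b == (d + d)%N then -1 else 1).

(** For 1 <= i <= d - 1 (counting basis vectors from 0, as above). *)
Definition sdot_lt (i : nat) : mat :=
  monomial_mx (swap i.-1 i \o swap (d + i.-1) (d + i)) (fun=> 1).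

Definition sdot (i : nat) : mat :=
  if i == 0%N then udot * sdot_lt 1 * udot
  else if i == d then monomial_mx (swap d.-1 (d + d.-1))
                        (fun b => if b == (d + d)%N then -1 else 1)
  else sdot_lt i.

Definition beta (i : nat) : nat :=
  if (i <= d)%N then i
  else if (i <= d.*2 - 2)%N then (d.*2 - i)%N else 0%N.

Definition phi : mat := \prod_(1 <= i < d.*2) sdot (beta i).

(** With j = a (2d - 1) + b, 0 <= b < 2d - 1. *)
Definition gallery_elt (j : nat) : mat :=
  phi ^+ (j %/ d.*2.-1) * \prod_(1 <= i < (j %% d.*2.-1).+1) sdot (beta i).

Definition gallery (C : set apartment) (j : nat) : set apartment :=
  act (gallery_elt j) @` C.

Definition N0_ (C : set apartment) (j : nat) : set mat :=
  iwahori (gallery C j) `&` unipotent.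

(** The relation "delta is the root attached to the adjacent chambers D1, D2". *)
Definition crossing_root D1 D2 (delta : lattice) : Prop :=
  let inter D a := iwahori D `&` root_group a in
  [/\ adjacent D1 D2, roots delta,
      forall a, roots a -> a <> delta -> a <> - delta -> inter D1 a = inter D2 a,
      inter D1 (- delta) `<=` inter D2 (- delta) /\
        has_index (inter D2 (- delta)) (inter D1 (- delta)) p &
      inter D2 delta `<=` inter D1 delta /\
        has_index (inter D1 delta) (inter D2 delta) p].

End Apartment.

Definition tau (x : padic_int pp) : mat :=
  diag_mx (\row_b (if b == 0%N :> nat then x%:F
                   else if b == d :> nat then x%:F^-1 else 1)).

End SpecialOrthogonal.

Arguments SO {p} pp d _.
Arguments SLZp {p} pp d _.
Arguments torus {p} pp d _.
Arguments torus0 {p} pp d _.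
Arguments torus0_pro_p {p} pp d _.
Arguments root_space {p} pp {d} a _.
Arguments root_group {p} pp {d} a _.
Arguments root_group0 {p} pp {d} a _.
Arguments root_filtration {p} pp {d} a k _.
Arguments unipotent {p} pp d _.
Arguments unipotent0 {p} pp d _.
Arguments pro_p_iwahori {p} pp d _.
Arguments iwahori {p} pp {d R} D _.
Arguments N0_ {p} pp {d R} C j _.
Arguments gallery {p} pp {d R} C j _.
Arguments crossing_root {p} pp {d R} D1 D2 delta.
Arguments phi {p} pp d.
Arguments sdot {p} pp d i.
Arguments tau {p pp} d x.
Arguments chi {p pp d} a t.

(* Main.v *)
(* Basis vectors are indexed by b, c with weights w_b = e_i, - e_i or 0, and a
   root is a difference w_b - w_c.  For a point y of the apartment with weight
   coordinates Y_b, the matrices with entries of valuation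
     v(g_bc) >= Y_c - Y_b (+ 1 on the short root entries when p = 2)
   form an order containing the Iwahori subgroup of the facet of y, and which
   meets each root subgroup exactly in the Iwahori part.  Killing the entries of
   a unitriangular isometry row by row shows that the intersection of N with the
   Iwahori subgroup consists of the unitriangular isometries in this order; the
   entry (b, b^star), which is not attached to a root, is controlled by the
   isotropy of the row.  When y and y' are separated by the single wall of
   delta + k with delta = w_b - w_c and b the first basis vector, g |-> g_bc
   induces a morphism modulo p^(m + 1) whose kernel is the part of y', whence the
   index p.

   The elements s_i and phi are monomial and carry walls to walls.  Ordering the
   basis vectors by height, the inverse of s_(beta 1) ... s_(beta n) sends the first
   one to e_1, ..., e_d, - e_d, ..., - e_2, e_1, which is at each step
   the first weight of the wall crossed next; hence every root crossed is of the
   form w_b - w_c with w_b = e_1.  This gives positivity and (b). *)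
From HB Require Import structures.
From mathcomp Require Import all_boot all_order all_algebra.
From mathcomp Require Import all_classical all_reals topology.
From mathcomp Require Import cyclic zify ring lra.
Require Import Defs.
Set Implicit Arguments.
Unset Strict Implicit.
Unset Printing Implicit Defensive.
Import Order.TTheory GRing.Theory Num.Theory.
Import numFieldTopology.Exports.
Local Open Scope classical_set_scope.
Local Open Scope ring_scope.

(** * p-adic arithmetic *)

Section PadicArithmetic.
Variables (p : nat) (pp : prime p).
Local Notation Zp := (padic_int pp).
Local Notation K := (padic_num pp).
Implicit Types (x y z u : Zp).

(** [iwahori] is given by generators only, so upper bounds on it come from an explicit overgroup
    ([parahoric]), and lower bounds from factoring an element into root elements that are visibly
    generators. The extra 1 for p = 2 comes from the quadratic term t^2/2 of a short root element:
    it is integral only for t in 2 Z_2, so N_a^0 itself starts one step later. Bounds on valuations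
    are real numbers, as coordinates of points are, but only the integers above them matter; up to
    the shift, the integers k allowed at (b, c) are those with [rt b c] + k >= 0 at y. Hence two
    points separated by one wall impose the same conditions except at the positions of its root and
    of the opposite root. Minimality of b is what makes the entry (b, c) additive: the other terms
    of a product vanish by triangularity or already satisfy the bounds of y'. Each step of the
    gallery is the image, under a monomial matrix, of one simple reflection of the base alcove. Such
    a reflection is checked by comparing, for all pairs of heights, the least integer that makes an
    affine root positive before and after. *)

Lemma padic_expn_gt0 n : (0 < p ^ n)%N.
Proof. by rewrite expn_gt0 prime_gt0. Qed.

Lemma residue_natr m n : residue (m%:R : Zp) n = (m %% p ^ n)%N.
Proof.
elim: m => [|m IHm]; first by rewrite mod0n.
rewrite -natr1 /= IHm; by rewrite modnDml modnDmr addn1.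
Qed.

Lemma padic_natr_neq0 m : (0 < m)%N -> (m%:R : Zp) != 0.
Proof.
move=> m0; apply/eqP => /(congr1 (fun x => residue x m)).
rewrite residue_natr /= modn_small; first by move=> E; rewrite E in m0.
by rewrite ltn_expl // prime_gt1.
Qed.

(** These are the residues of x / p: division loses one digit, hence the shift of the index. *)
Fact div_residueP x (x0 : residue x 1 = 0%N) n :
  (residue x n.+1 %/ p = (residue x n.+2 %/ p) %% p ^ n)%N.
Proof.
rewrite (residueP x n.+1) expnS.
by rewrite [(p * p ^ n)%N]mulnC modn_divl.
Qed.

Lemma padic_dvdp x : residue x 1 = 0%N -> exists y, x = p%:R * y.
Proof.
move=> x0; exists (@PadicInt p pp _ (div_residueP x0)); apply: residue_inj => n /=.
rewrite residue_natr modnMml mulnC divnK; last first.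
  have := residue_le x (ltn0Sn n).
  by rewrite x0 mod0n expn1 => /eqP.
by rewrite -residueP.
Qed.

Lemma eqn_modMl_coprime (m a b c : nat) : coprime m a ->
  (a * b = a * c %[mod m])%N -> (b = c %[mod m])%N.
Proof.
move=> ma; wlog bc : b c / (c <= b)%N => [W E|].
  by case/orP: (leq_total b c) => bc; [symmetry|]; apply: W.
move/eqP; rewrite eqn_mod_dvd ?leq_mul // -mulnBr Gauss_dvdr // => mbc.
by apply/eqP; rewrite eqn_mod_dvd.
Qed.

Lemma coprime_residue x n : residue x 1 != 0%N -> coprime (residue x n.+1) p.
Proof.
move=> x0; rewrite coprime_sym prime_coprime //; apply: contra x0 => /eqP pk.
have := residue_mod x 1; have := residue_le x (ltn0Sn n).
by rewrite expn1 pk => <- <-.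
Qed.

(** By Euler's theorem the power of exponent [totient (p ^ n)] - 1 is the inverse modulo p^n;
    compatibility is tested after multiplication by the invertible residue. *)
Fact inv_residueP x (x0 : residue x 1 != 0%N) n :
  (residue x n ^ (totient (p ^ n)).-1 %% p ^ n =
   (residue x n.+1 ^ (totient (p ^ n.+1)).-1 %% p ^ n.+1) %% p ^ n)%N.
Proof.
case: n => [|n]; first by rewrite !modn1.
rewrite modn_dvdm ?dvdn_exp2l //.
set a := residue x n.+1; set b := residue x n.+2.
have ab : (a = b %[mod p ^ n.+1])%N by rewrite /a residueP modn_mod.
have copa : coprime (p ^ n.+1) a by rewrite coprimeXl // coprime_sym coprime_residue.
have tot k : (0 < totient (p ^ k))%N by rewrite totient_gt0 padic_expn_gt0.
apply: (eqn_modMl_coprime copa).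
rewrite -expnS prednK // Euler_exp_totient; last by rewrite coprime_sym.
rewrite -modnMml ab modnMml -expnS prednK //.
have copb : coprime b (p ^ n.+2) by rewrite coprimeXr ?coprime_residue.
have := Euler_exp_totient copb => /(congr1 (modn^~ (p ^ n.+1)%N)).
by rewrite /= !modn_dvdm ?dvdn_exp2l.
Qed.

Lemma padic_unitE x : residue x 1 != 0%N -> x \is a GRing.unit.
Proof.
move=> x0; apply/unitrPr; exists (@PadicInt p pp _ (inv_residueP x0)).
apply: residue_inj => n /=.
case: n => [|n]; first by rewrite !modn1.
rewrite modnMmr -expnS prednK ?totient_gt0 ?padic_expn_gt0 //.
by apply: Euler_exp_totient; rewrite coprimeXr // coprime_residue.
Qed.

Lemma residue1_unit x : x \is a GRing.unit -> residue x 1 != 0%N.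
Proof.
case/unitrPr => y /(congr1 (fun z => residue z 1)) /=.
apply: contra_eqN => /eqP ->.
by rewrite mul0n mod0n expn1 modn_small ?prime_gt1.
Qed.

Lemma residue1_Mp x : residue (p%:R * x) 1 = 0%N.
Proof. by rewrite /= residue_natr expn1 modnn mul0n mod0n. Qed.

(** Induction on an index at which the residue is nonzero: each division by p lowers it by one. *)
Lemma padic_decomp x : x != 0 -> exists k u, u \is a GRing.unit /\ x = p%:R ^+ k * u.
Proof.
move=> xn0.
have [n xn] : exists n, residue x n != 0%N.
  apply: contrapT => /forallNP xn; move/eqP: xn0; apply.
  by apply: residue_inj => n /=; have /negP := xn n; rewrite negbK => /eqP.
elim: n x xn {xn0} => [|n IHn] x xn.
  by have := residue_mod x 0; rewrite expn0 modn1 => E; rewrite -E in xn.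
have [x1|x1] := eqVneq (residue x 1) 0%N; last first.
  by exists 0%N, x; rewrite expr0 mul1r; split=> //; apply: padic_unitE.
have [y xE] := padic_dvdp x1.
have yn : residue y n != 0%N.
  apply: contraNneq xn => yn; rewrite xE /= residue_natr modnMml.
  rewrite expnS -muln_modr.
  by rewrite -(residueP y n) yn muln0.
have [k [u [uu yE]]] := IHn y yn.
by exists k.+1, u; split=> //; rewrite xE yE exprS mulrA.
Qed.

Lemma padicn_neq0 m : (0 < m)%N -> (m%:R : K) != 0.
Proof.
move=> m0; rewrite -(rmorph_nat (@FracField.tofrac Zp)) tofrac_eq0.
exact: padic_natr_neq0.
Qed.

Lemma padic_p_neq0 : (p%:R : K) != 0.
Proof. by rewrite padicn_neq0 ?prime_gt0. Qed.

Lemma padic_2_neq0 : (2 : K) != 0.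
Proof. exact: (@padicn_neq0 2). Qed.

Lemma tofrac_unit u : u \is a GRing.unit -> u%:F != 0 :> K.
Proof.
by move=> uu; rewrite tofrac_eq0; apply: contraTneq uu => ->; rewrite unitr0.
Qed.

Lemma tofrac_inv u : u \is a GRing.unit -> (u^-1)%:F = (u%:F)^-1 :> K.
Proof. by move=> uu; rewrite rmorphV. Qed.

Lemma padic_num_frac (t : K) : exists a b : Zp, b != 0 /\ t * b%:F = a%:F.
Proof.
elim/quotW: t => r; exists r.1, r.2; split; first exact: denom_ratioP.
unlock FracField.tofrac; rewrite -[LHS]FracField.pi_mul.
apply/eqmodP; rewrite /= FracField.equivfE /FracField.mulf.
rewrite !numden_Ratio ?mulr1 ?oner_eq0 ?denom_ratioP //.
by rewrite mulrC.
Qed.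

Lemma padic_num_decomp (t : K) : t != 0 ->
  exists k : int, exists2 u : Zp, u \is a GRing.unit & t = p%:R ^ k * u%:F.
Proof.
move=> t0; have [a [b [b0 tE]]] := padic_num_frac t.
have bF : (b%:F : K) != 0 by rewrite tofrac_eq0.
have a0 : a != 0 by rewrite -(tofrac_eq0 a) -tE mulf_neq0.
have [k [u [uu aE]]] := padic_decomp a0.
have [l [w [uw bE]]] := padic_decomp b0.
exists (k%:Z - l%:Z), (u * w^-1); first by rewrite unitrM uu unitrV.
apply: (mulIf bF); rewrite tE aE bE !tofracM tofrac_inv // !tofracXn.
have -> : (p%:R : Zp)%:F = p%:R :> K by rewrite rmorph_nat.
have pn0 := padic_p_neq0; have wn0 := tofrac_unit uw.
have -> : p%:R ^+ k = p%:R ^ (k%:Z - l%:Z) * p%:R ^+ l :> K.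
  by rewrite -[p%:R ^+ l]/(p%:R ^ l%:Z) -expfzDr // subrK.
by rewrite [RHS]mulrACA divfK.
Qed.
End PadicArithmetic.

Lemma padic_pexp_inj (p : nat) (pp : prime p) : injective (fun k : int => (p%:R : padic_num pp) ^ k).
Proof.
move=> m n; wlog mn : m n / m < n.
  by move=> W E; have [/W->|/W->|] := ltgtP m n.
move=> E; exfalso; have [k kE] : exists k : nat, n = m + Posz k.+1.
  by exists (absz (n - m - 1)%R); lia.
have : (p%:R : padic_num pp) ^+ k.+1 = 1.
  apply: (mulfI (expfz_neq0 m (padic_p_neq0 pp))).
  by rewrite mulr1 exprnP -expfzDr ?padic_p_neq0 // -kE.
rewrite -(rmorph_nat (@FracField.tofrac (padic_int pp))) -tofracXn -tofrac1 => /eqP.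
rewrite tofrac_eq exprS => /eqP /(congr1 (fun z => residue z 1)).
by rewrite residue1_Mp /= expn1 modn_small ?prime_gt1.
Qed.

(** * Valuations bounded below by real numbers *)

Section Valuation.
Variables (p : nat) (pp : prime p) (R : realType).
Local Notation Zp := (padic_int pp).
Local Notation K := (padic_num pp).
Implicit Types (x y : K) (r s : R).

(* "The valuation of [x] is at least [r]", true for [x = 0]. *)
Definition vge x r := exists k : int, exists2 z : Zp, x = p%:R ^ k * z%:F & r <= k%:~R.

Lemma vgeW r s x : s <= r -> vge x r -> vge x s.
Proof. by move=> sr [k [z xE rk]]; exists k, z => //; apply: le_trans rk. Qed.

Lemma vge0 r : vge 0 r.
Proof. by exists (Num.ceil r), 0; rewrite ?rmorph0 ?mulr0 // ceil_ge. Qed.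

Lemma padic_pexp_neq0 (k : int) : (p%:R : K) ^ k != 0.
Proof. by rewrite expfz_neq0 ?padic_p_neq0. Qed.

Lemma vgeD x y r : vge x r -> vge y r -> vge (x + y) r.
Proof.
move=> [k [a -> rk]] [l [b -> rl]].
wlog kl : k l a b rk rl / k <= l.
  by move=> W; case/orP: (le_total k l) => kl; [|rewrite addrC]; apply: W.
exists k, (a + p%:R ^+ absz (l - k)%R * b) => //.
rewrite !rmorphD rmorphM rmorphXn rmorph_nat mulrDr mulrA.
congr (_ + _ * _); rewrite -[p%:R ^+ _]/(p%:R ^ (Posz _)) -expfzDr ?padic_p_neq0 //.
by congr (_ ^ _); lia.
Qed.

Lemma vgeN x r : vge x r -> vge (- x) r.
Proof. by move=> [k [a -> rk]]; exists k, (- a); rewrite // rmorphN mulrN. Qed.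

Lemma vgeM x y r s : vge x r -> vge y s -> vge (x * y) (r + s).
Proof.
move=> [k [a -> rk]] [l [b -> rl]]; exists (k + l), (a * b).
  by rewrite rmorphM expfzDr ?padic_p_neq0 // mulrACA.
by rewrite rmorphD lerD.
Qed.

Lemma vge_sum (I : Type) (l : seq I) (P : pred I) (F : I -> K) r :
  (forall i, P i -> vge (F i) r) -> vge (\sum_(i <- l | P i) F i) r.
Proof. by move=> h; elim/big_rec: _ => [|i x Pi]; [apply: vge0|apply/vgeD/h]. Qed.

Lemma vge_unit (k : int) (u : Zp) r :
  u \is a GRing.unit -> vge (p%:R ^ k * u%:F) r <-> r <= k%:~R.
Proof.
move=> uu; split=> [[l [z E rl]]|]; last by exists k, u.
apply: le_trans rl _; rewrite ler_int leNgt; apply/negP => kl.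
have [n nE] : exists n : nat, l = k + Posz n.+1 by exists (absz (l - k - 1)%R); lia.
have /negP := residue1_unit uu; apply; apply/eqP.
suff -> : u = p%:R * (p%:R ^+ n * z) by exact: residue1_Mp.
apply/eqP; rewrite -tofrac_eq; apply/eqP.
apply: (mulfI (padic_pexp_neq0 k)); rewrite E nE expfzDr ?padic_p_neq0 //.
by rewrite mulrA -exprS rmorphM rmorphXn rmorph_nat mulrA.
Qed.

Lemma vge_val x : x != 0 -> exists k : int, forall r, vge x r <-> r <= k%:~R.
Proof. by move=> /padic_num_decomp[k [u uu ->]]; exists k => r; apply: vge_unit. Qed.

Lemma vge_pexp (k : int) r : vge (p%:R ^ k) r <-> r <= k%:~R.
Proof. by have := vge_unit k r (unitr1 Zp); rewrite rmorph1 mulr1. Qed.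

Lemma vge1 r : vge 1 r <-> r <= 0.
Proof. exact: (vge_pexp 0). Qed.

(** Valuations are integers, so a real bound counts only through the integers above it. This turns
    equalities of signs of affine roots into equalities of conditions on entries. *)
Lemma vge_eq x r s : (forall k : int, (r <= k%:~R) = (s <= k%:~R)) -> vge x r <-> vge x s.
Proof.
move=> rs; have [->|/vge_val[k kP]] := eqVneq x 0; first by split=> _; apply: vge0.
by rewrite !kP rs.
Qed.

Lemma padic_integerP x : padic_integer x <-> vge x 0.
Proof.
split=> [[z ->]|[k [z -> k0]]]; first by exists 0, z; rewrite ?expr0z ?mul1r.
case: k k0 => [k _|k]; last by rewrite ler0z.
by exists (p%:R ^+ k * z); rewrite rmorphM rmorphXn rmorph_nat.
Qed.

Lemma vgeMp (k : int) x r : vge (p%:R ^ k * x) (k%:~R + r) <-> vge x r.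
Proof.
split=> [h|]; last by move=> h; apply: vgeM => //; apply/vge_pexp.
have /vge_pexp := lexx ((- k)%:~R : R) => /vgeM/(_ h).
by rewrite mulrA -expfzDr ?padic_p_neq0 // addNr mul1r rmorphN addrA addNr add0r.
Qed.

Lemma vge_nat (n : nat) : vge n%:R 0.
Proof. by apply/padic_integerP; exists n%:R; rewrite rmorph_nat. Qed.

Lemma vge_half x r : vge x r -> vge (x / 2) (r - (p == 2%N)%:R).
Proof.
move=> h; apply: vgeM => //; case: eqVneq => p2.
  have /vge_pexp := lexx ((- 1)%:~R : R); rewrite -[X in X -> _]/(vge _ (- 1%:~R)).
  by rewrite (_ : (2 : K) = p%:R) ?exprN1 //; congr _%:R.
rewrite oppr0; apply/padic_integerP; exists (2%:R)^-1.
rewrite tofrac_inv ?rmorph_nat //; apply: padic_unitE.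
rewrite residue_natr expn1 -/(dvdn _ _) dvdn_prime2 //.
Qed.

(** For p = 2 the valuation k of x satisfies 2 k >= 1, hence k >= 1. This parity argument is the
    origin of [shift]. *)
Lemma vge_sqr x : vge (x ^+ 2 / 2) 0 -> vge x 0 -> vge x (p == 2%N)%:R.
Proof.
case: eqVneq => // p2 h.
have [->|/padic_num_decomp[k [u uu xE]]] := eqVneq x 0; first by move=> _; apply: vge0.
have p2K : (2 : K) = p%:R by congr _%:R.
rewrite xE p2K in h *; rewrite !vge_unit // (ler_int _ 0) (ler_int _ 1) => k0.
suff : vge (p%:R ^ (k + k) * (u ^+ 2)%:F) 1.
  by rewrite vge_unit ?unitrX // (ler_int _ 1); lia.
have /vge_pexp := lexx (1%:~R : R) => /vgeM/(_ h); rewrite addr0.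
congr vge; rewrite expfzDr ?padic_p_neq0 // rmorphXn expr1z.
rewrite mulrCA divff ?mulr1 ?padic_p_neq0 //; ring.
Qed.

(** The exponent n = k + 1 decides: k + (k + 1) l >= 0 forces the integer l to be nonnegative. *)
Lemma vge_bounded x (k : nat) : (forall n, vge (p%:R ^+ k * x ^+ n) 0) -> vge x 0.
Proof.
have [->|/padic_num_decomp[l [u uu ->]]] := eqVneq x 0; first by move=> _; apply: vge0.
move=> /(_ k.+1); rewrite exprMn -tofracXn mulrA [(p%:R ^ l) ^+ _]exprnP exprz_exp.
rewrite -[p%:R ^+ k]/(p%:R ^ k%:Z) -expfzDr ?padic_p_neq0 //.
by rewrite !vge_unit ?unitrX // !ler0z; nia.
Qed.

(** Together with [vge_digit_inj], this provides the p representatives of p^m Z_p modulo p^(m + 1)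
    Z_p from which every index p below is computed. *)
Lemma vge_digit (m : int) x : vge x m%:~R ->
  exists2 k : nat, (k < p)%N & vge (x - p%:R ^ m * k%:R) (m + 1)%:~R.
Proof.
move=> h; have [z zE] : padic_integer (p%:R ^ (- m) * x).
  by apply/padic_integerP/(vgeMp m); rewrite addr0 mulrA -expfzDr ?padic_p_neq0 // subrr mul1r.
exists (residue z 1).
  by rewrite -(residue_mod z 1) expn1 ltn_mod prime_gt0.
have [|y yE] := @padic_dvdp p pp (z - (residue z 1)%:R).
  rewrite /= residue_natr residue_mod modnDmr subnKC ?modnn //.
  by rewrite -(residue_mod z 1) ltnW // ltn_mod padic_expn_gt0.
have -> : x - p%:R ^ m * (residue z 1)%:R = p%:R ^ m * (p%:R * y%:F).
  have -> : x = p%:R ^ m * z%:F.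
    by rewrite -zE mulrA -expfzDr ?padic_p_neq0 // subrr mul1r.
  rewrite -mulrBr; congr (_ * _).
  have -> : p%:R * y%:F = (z - (residue z 1)%:R)%:F :> K by rewrite yE tofracM rmorph_nat.
  by rewrite tofracB rmorph_nat.
rewrite rmorphD; apply/vgeMp; exists 1, y; rewrite ?expr1z //.
Qed.

Lemma vge_digit_inj (m : int) (k l : nat) : (k < p)%N -> (l < p)%N ->
  vge (p%:R ^ m * k%:R - p%:R ^ m * l%:R) (m + 1)%:~R -> k = l.
Proof.
wlog kl : k l / (l <= k)%N.
  move=> W kp lp h; case/orP: (leq_total l k) => kl; first exact: W.
  by symmetry; apply: W => //; rewrite -opprB; apply: vgeN.
move=> kp lp; rewrite -mulrBr -natrB // rmorphD => /vgeMp h.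
apply/eqP; rewrite eqn_leq kl andbT -subn_eq0; apply: contraT => kl0.
have uu : ((k - l)%:R : Zp) \is a GRing.unit.
  apply: padic_unitE; rewrite residue_natr expn1 modn_small //.
  by rewrite (leq_ltn_trans (leq_subr _ _)).
have := vge_unit 0 1%:~R uu; rewrite expr0z mul1r rmorph_nat.
by move=> /proj1/(_ h); rewrite lerz0.
Qed.
End Valuation.

(** * Weights and roots *)

Ltac lif := repeat match goal with
  | |- context [if ?b then _ else _] =>
    lazymatch b with
    | context [if _ then _ else _] => fail
    | _ => let E := fresh "E" in destruct b eqn:E; try (exfalso; lia)
    end
  end; intros; lia.

Ltac plif := intros; lif.

Section Indices.
Variable d : nat.
Local Notation I := 'I_(d + d + 1).
Implicit Types b c i j : I.

Definition eI (i : 'I_d) : I := lshift 1 (lshift d i).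
Definition fI (i : 'I_d) : I := lshift 1 (rshift d i).
Definition zI : I := rshift (d + d) ord0.

Lemma zI_val : zI = (d + d)%N :> nat. Proof. by rewrite /= addn0. Qed.

Definition star_nat (n : nat) : nat :=
  if (n < d)%N then (n + d)%N else if (n < d + d)%N then (n - d)%N else n.

Fact star_subproof b : (star_nat b < d + d + 1)%N.
Proof. by have := ltn_ord b; rewrite /star_nat; lif. Qed.

(* The index of the basis vector dual to that of index [b]. *)
Definition star b : I := Ordinal (star_subproof b).

Lemma starK : involutive star.
Proof. by move=> b; apply: val_inj; have := ltn_ord b; rewrite /= /star_nat; lif. Qed.

Lemma star_eI (i : 'I_d) : star (eI i) = fI i.
Proof. by apply: val_inj; have := ltn_ord i; rewrite /= /star_nat /=; lif. Qed.
Lemma star_fI (i : 'I_d) : star (fI i) = eI i.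
Proof. by rewrite -star_eI starK. Qed.
Lemma star_zI : star zI = zI.
Proof. by apply: val_inj; rewrite /= /star_nat /=; lif. Qed.

Lemma star_fixed b : (star b == b) = (b == zI).
Proof. by rewrite -!val_eqE /= /star_nat; have := ltn_ord b; lif. Qed.

Variant index_spec : I -> Type :=
  | IndexE (i : 'I_d) : index_spec (eI i)
  | IndexF (i : 'I_d) : index_spec (fI i)
  | IndexZ : index_spec zI.

Lemma indexP b : index_spec b.
Proof.
case: (split_ordP b) => [i|i] ->; last by rewrite ord1; constructor.
by case: (split_ordP i) => j ->; constructor.
Qed.

Lemma sum_index (V : nmodType) (F : I -> V) :
  \sum_b F b = \sum_i F (eI i) + \sum_i F (fI i) + F zI.
Proof. by rewrite !big_split_ord big_ord1. Qed.

(* The ordering of the basis vectors for which [N] is upper triangular. *)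
Definition height b : nat :=
  if (b < d)%N then b : nat else if (b < d + d)%N then (d + d + d - b)%N else d.

Lemma height_inj : injective height.
Proof.
by move=> b c; rewrite /height => E; apply: val_inj => /=;
   move: E; have := ltn_ord b; have := ltn_ord c; lif.
Qed.

Lemma height_zI : height (zI) = d.
Proof. by rewrite /height zI_val; lif. Qed.

Lemma height_star b : height (star b) = (d + d - height b)%N.
Proof. by rewrite /height /= /star_nat; have := ltn_ord b; lif. Qed.

Lemma height_le b : (height b <= d + d)%N.
Proof. by rewrite /height; lif. Qed.

Lemma height_starW b c : (height (star b) < height (star c))%N = (height c < height b)%N.
Proof. by rewrite !height_star; have := height_le b; have := height_le c; lif. Qed.

Definition is_root b c := (b != c) && (c != star b).

Lemma is_root_star b c : is_root (star c) (star b) = is_root b c.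
Proof.
by rewrite /is_root (can_eq starK) starK eq_sym [star b == _]eq_sym.
Qed.

Lemma is_root_sym b c : is_root c b = is_root b c.
Proof.
by rewrite /is_root [c == b]eq_sym [b == star _]eq_sym (can2_eq starK starK).
Qed.

Lemma height_surj n : (n <= d + d)%N -> exists b : I, height b = n.
Proof.
move=> nd; pose m := if (n < d)%N then n else if n == d then (d + d)%N else (d + d + d - n)%N.
have md : (m < d + d + 1)%N by rewrite /m; lif.
by exists (Ordinal md); rewrite /height /= /m; lif.
Qed.

Lemma is_root_height (b c : I) :
  is_root b c = (height b != height c) && (height b + height c != d + d)%N.
Proof.
rewrite /is_root (inj_eq height_inj) -(inj_eq height_inj c) height_star.
by congr (_ && ~~ _); have := height_le b; have := height_le c; lia.
Qed.
Definition omega_nat (n k : nat) : int := (n == k)%:Z - (n == d + k)%:Z.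
Definition omega b : lattice d := \row_k omega_nat b k.
Definition rt b c : lattice d := omega b - omega c.

Lemma omega_eI (i : 'I_d) : omega (eI i) = e_ i.
Proof.
apply/rowP => k; rewrite !mxE /omega_nat eqxx /= eq_sym -val_eqE /=.
by have := ltn_ord i; have := ltn_ord k; lif.
Qed.

Lemma omega_star b : omega (star b) = - omega b.
Proof.
apply/rowP => k; rewrite !mxE /omega_nat /= /star_nat.
by have := ltn_ord b; have := ltn_ord k; lif.
Qed.

Lemma omega_fI (i : 'I_d) : omega (fI i) = - e_ i.
Proof. by rewrite -star_eI omega_star omega_eI. Qed.

Lemma omega_zI : omega zI = 0.
Proof.
by apply/rowP => k; rewrite !mxE /omega_nat zI_val; have := ltn_ord k; lif.
Qed.

Lemma rt_star b c : rt (star c) (star b) = rt b c.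
Proof. by rewrite /rt !omega_star opprK addrC. Qed.

Lemma rt_opp b c : rt c b = - rt b c.
Proof. by rewrite /rt opprB. Qed.

(** Up to the sign [s], a coordinate is a linear form that is 1 on the weight of c, -1 on that of c*
    and 0 on all others: it detects a single pair of indices. *)
Lemma omega_coef c : c != zI -> exists (k : 'I_d) (s : int), forall b,
  omega b 0 k * s = (b == c)%:Z - (b == star c)%:Z.
Proof.
case/indexP: c => [k|k|] //=; last by rewrite eqxx.
- exists k, 1 => b; rewrite star_eI mxE /omega_nat -!val_eqE /=; lia.
- exists k, (-1) => b; rewrite star_fI mxE /omega_nat -!val_eqE /=; lia.
Qed.

Lemma omega_inj : injective omega.
Proof.
suff main b c : c != zI -> omega b = omega c -> b = c.
  move=> b c E; have [cz|cz] := eqVneq c zI; last exact: main.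
  by have [-> //|bz] := eqVneq b zI; symmetry; apply: main.
move=> cz E; have [k [s H]] := omega_coef cz; apply/eqP.
have := H b; rewrite E H; move: cz (ltn_ord b) (ltn_ord c).
by rewrite -!val_eqE /= /star_nat; lif.
Qed.

(** The form of [omega_coef] attached to a nonzero weight w_x equals 1 on w_x - w_y, which forces i
    = x or j = x*; since b and c differ, b or c* may serve as x. The two presentations are the two
    matrix positions occupied by a root vector. *)
Lemma rt_inj b c i j : is_root b c -> rt i j = rt b c ->
  (i = b /\ j = c) \/ (i = star c /\ j = star b).
Proof.
suff main x y : x != zI -> is_root x y -> rt i j = rt x y -> i = x \/ j = star x.
  move=> bc E.
  have [ib|jb] : i = b \/ j = star b.
  - have [bz|bz] := eqVneq b zI; last exact: (main b c).
    have cz : star c != zI.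
      by rewrite -star_zI (can_eq starK) -bz eq_sym; case/andP: bc.
    have [||ic|] := main (star c) (star b) cz; rewrite ?is_root_star ?rt_star //.
    + right; apply: omega_inj; move: E; rewrite /rt ic bz !omega_star omega_zI.
      by rewrite sub0r -[X in _ = X -> _]addr0 => /addrI <-; rewrite opprK.
    + rewrite starK => jc; left; apply: omega_inj; move: E; rewrite /rt jc.
      by move/addIr.
  - left; split=> //; apply: omega_inj; move: E; rewrite /rt ib.
    by move/addrI/oppr_inj.
  - right; split=> //; apply: omega_inj; move: E; rewrite /rt jb !omega_star opprK.
    by rewrite addrC => /addrI.
move=> xz /andP[xy yx] E; have [k [s H]] := omega_coef xz.
have : (omega i 0 k - omega j 0 k) * s = (omega x 0 k - omega y 0 k) * s.
  by have /rowP/(_ k) := E; rewrite /rt !mxE => ->.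
rewrite !mulrBl !H eqxx (negbTE yx) [y == x]eq_sym (negbTE xy).
case: (eqVneq i x) => [|_]; first by left.
case: (eqVneq j (star x)) => [|_]; first by right.
move: xz; rewrite -star_fixed [star x == _]eq_sym => /negbTE ->.
by case: (i == star x); case: (j == x).
Qed.

Lemma roots_rt (a : lattice d) : roots a <-> exists b c, is_root b c /\ a = rt b c.
Proof.
pose sI (s : bool) (k : 'I_d) := if s then fI k else eI k.
have omega_sI s k : omega (sI s k) = (-1) ^+ s *: e_ k.
  by case: s; rewrite /= ?omega_eI ?omega_fI ?scaleN1r ?expr1 ?expr0 ?scale1r ?scaleN1r.
have sIP (s t : bool) (i j : 'I_d) : is_root (sI s i) (sI t j) = (i != j).
  by rewrite /is_root /sI -!val_eqE /= /star_nat; case: s; case: t => /=;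
     have := ltn_ord i; have := ltn_ord j; lif.
split=> [[[i [j [s [t [ij ->]]]]]|[i [s ->]]]|[b [c [bc ->]]]].
- exists (sI s i), (sI (~~ t) j); rewrite sIP ij; split=> //.
  by rewrite /rt !omega_sI signrN scaleNr opprK.
- exists (sI s i), zI; rewrite /rt omega_sI omega_zI subr0; split=> //.
  by rewrite /is_root /sI -!val_eqE /= /star_nat; case: s => /=;
     have := ltn_ord i; lif.
have sgn (s t : bool) (i j : 'I_d) : is_root (sI s i) (sI t j) -> roots (rt (sI s i) (sI t j)).
  rewrite sIP => ij; left; exists i, j, s, (~~ t).
  by rewrite /rt !omega_sI signrN scaleNr.
move: bc; case/indexP: b => [i|i|]; case/indexP: c => [j|j|].
- exact: (sgn false false).
- exact: (sgn false true).
- by right; exists i, false; rewrite /rt omega_zI subr0 (omega_sI false).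
- exact: (sgn true false).
- exact: (sgn true true).
- by right; exists i, true; rewrite /rt omega_zI subr0 (omega_sI true).
- by right; exists j, true; rewrite /rt omega_zI sub0r omega_eI expr1 scaleN1r.
- by right; exists j, false; rewrite /rt omega_zI sub0r omega_fI opprK expr0 scale1r.
- by rewrite /is_root eqxx.
Qed.

(** Positive roots are those above the diagonal in the height order; this is why N becomes
    unitriangular. *)
Lemma pos_roots_rt (a : lattice d) : pos_roots a <->
  exists b c, [/\ is_root b c, (height b < height c)%N & a = rt b c].
Proof.
split=> [[[i [j [ij aE]]]|[i ->]]|[b [c [bc hbc ->]]]].
- case: aE => ->; [exists (eI i), (fI j)|exists (eI i), (eI j)];
  by split; rewrite /rt ?omega_eI ?omega_fI ?opprK // /is_root /height -?val_eqE /= /star_nat;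
     move: ij; have := ltn_ord i; have := ltn_ord j; lif.
- exists (eI i), zI; split; rewrite /rt ?omega_eI ?omega_zI ?subr0 //;
  by rewrite /is_root /height -?val_eqE /= /star_nat; have := ltn_ord i; lif.
move: bc hbc; case/indexP: b => [i|i|]; case/indexP: c => [j|j|];
  rewrite /rt ?(omega_eI, omega_fI, omega_zI) ?opprK ?subr0 ?sub0r ?opprK;
  rewrite /is_root -!val_eqE /= /star_nat /height /=;
  have iP := fun k : 'I_d => ltn_ord k.
- move=> _ ij; left; exists i, j; split; last by right.
  by move: ij (iP i) (iP j); lif.
- move=> ij _; left; have [lij|lji|E] := ltngtP i j.
  + by exists i, j; split; last by left.
  + by exists j, i; split; last by left; rewrite addrC.
  + by move: ij (iP i) (iP j) E; lif.
- by move=> _ _; right; exists i.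
- by move=> _ h; exfalso; move: h (iP i) (iP j); lif.
- move=> _ ij; left; exists j, i; split; last by right; rewrite addrC.
  by move: ij (iP i) (iP j); lif.
- by move=> _ h; exfalso; move: h (iP i); lif.
- by move=> _ h; exfalso; move: h (iP j); lif.
- by move=> _ _; right; exists j; rewrite add0r.
- by move=> _ h; exfalso; move: h; lif.
Qed.
End Indices.
Arguments starK {d} x.
Arguments height_inj {d} [x1 x2].
Arguments omega_inj {d} [x1 x2].

(** * Isometries and root subgroups *)

Section Exp3.
Variables (F : fieldType) (n : nat) (X : 'M[F]_n).

Definition exp3 t : 'M[F]_n := 1%:M + t *: X + 2^-1 *: ((t *: X) *m (t *: X)).

Lemma exp3D t u : (2 : F) != 0 -> X *m X *m X = 0 -> exp3 t *m exp3 u = exp3 (t + u).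
Proof.
move=> F2 X3; rewrite /exp3.
have X3' : X *m (X *m X) = 0 by rewrite mulmxA.
have X4 : X *m X *m (X *m X) = 0 by rewrite mulmxA X3 mul0mx.
have sq (y : F) : (y *: X) *m (y *: X) = y ^+ 2 *: (X *m X).
  by rewrite -scalemxAl -scalemxAr scalerA -expr2.
rewrite !sq !(mulmxDl, mulmxDr) !mul1mx !mulmx1 -!(scalemxAl, scalemxAr).
rewrite X3 X3' X4 !scaler0 !addr0 !scalerA.
have -> : 2^-1 * (t + u) ^+ 2 = 2^-1 * t ^+ 2 + t * u + 2^-1 * u ^+ 2 by field.
rewrite !scalerDl; move: (X *m X) (t *: X) => Y Z.
by rewrite [LHS](AC (3*2*1) ((1*(4*2))*((6*5)*3))).
Qed.

Lemma exp3E t i j : exp3 t i j = (i == j)%:R + t * X i j - t ^+ 2 / 2 * (- (X *m X)) i j.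
Proof.
rewrite /exp3 -scalemxAl -scalemxAr scalerA; move: (X *m X) => Y; rewrite !mxE mulrN opprK.
by rewrite !mulrA; congr (_ + _); rewrite expr2 [t * t / 2]mulrC !mulrA.
Qed.
End Exp3.

Lemma exp3N (F : fieldType) (n : nat) (X : 'M[F]_n) t : exp3 (- X) t = exp3 X (- t).
Proof. by rewrite /exp3 scalerN scaleNr. Qed.

Lemma mul_div_mid (F : fieldType) (x y z : F) : y != 0 -> x * z = x / y * z * y.
Proof. by move=> y0; field. Qed.

Lemma mul_div_midV (F : fieldType) (x y z : F) : x != 0 -> y^-1 * z = x / y * z * x^-1.
Proof. by move=> x0; rewrite [RHS]mulrAC [x / y]mulrC mulfK. Qed.

Lemma splitf2 (F : fieldType) (x : F) : (2 : F) != 0 -> x = x / 2 + x / 2.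
Proof. by move=> F2; field. Qed.

Section Orthogonal.
Variables (p : nat) (pp : prime p) (d : nat).
Local Notation K := (padic_num pp).
Local Notation I := 'I_(d + d + 1).
Local Notation mat := 'M[K]_(d + d + 1).
Local Notation S := (Stilde pp d).
Implicit Types (g h X : mat) (t u : K) (b c i j k : I).

Lemma StildeE i j : S i j = (j == star i)%:R.
Proof.
rewrite /Stilde /Smx; case: i / (indexP i) => [i|i|]; case: j / (indexP j) => [j|j|];
  rewrite ?star_eI ?star_fI ?star_zI /eI /fI /zI;
  rewrite ?(block_mxEul, block_mxEur, block_mxEdl, block_mxEdr) ?mxE.
all: rewrite -?val_eqE /=; try have := ltn_ord i; try have := ltn_ord j; intros.
all: try by rewrite ?addn0 ?eqxx.
all: try by case: eqP => //; lia.
all: by congr (_%:R); rewrite -?val_eqE /=; lia.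
Qed.

(** This is S g^T S written entrywise ([adjE]). For an isometry it is the inverse, whose entries are
    therefore entries of g at reflected positions. *)
Definition adj g : mat := \matrix_(i, j) g (star j) (star i).

Lemma adjE g : adj g = S *m g^T *m S.
Proof.
apply/matrixP => i j; rewrite !mxE (bigD1 (star j)) //= big1 ?addr0; last first.
  by move=> k kj; rewrite StildeE eq_sym (can2_eq starK starK) (negbTE kj) mulr0.
rewrite StildeE starK eqxx mulr1 !mxE (bigD1 (star i)) //= big1 ?addr0; last first.
  by move=> k ki; rewrite StildeE (negbTE ki) mul0r.
by rewrite StildeE eqxx mul1r mxE.
Qed.

Lemma Stilde_sqr : S *m S = 1%:M.
Proof.
apply/matrixP => i j; rewrite !mxE (bigD1 (star i)) //= big1 ?addr0; last first.
  by move=> k ki; rewrite StildeE (negbTE ki) mul0r.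
by rewrite !StildeE starK eqxx mul1r eq_sym.
Qed.

Lemma adjK : involutive adj.
Proof. by move=> g; apply/matrixP => i j; rewrite !mxE !starK. Qed.

Lemma adjM g h : adj (g *m h) = adj h *m adj g.
Proof.
apply/matrixP => i j; rewrite !mxE (reindex_inj (inv_inj starK)) /=.
by apply: eq_bigr => k _; rewrite !mxE mulrC.
Qed.

Lemma adj1 : adj 1%:M = 1%:M.
Proof. by apply/matrixP => i j; rewrite !mxE (can_eq starK) eq_sym. Qed.

Lemma adjD g h : adj (g + h) = adj g + adj h.
Proof. by apply/matrixP => i j; rewrite !mxE. Qed.

Lemma adjZ t g : adj (t *: g) = t *: adj g.
Proof. by apply/matrixP => i j; rewrite !mxE. Qed.

(* The isometries of the form [Stilde], [adj] being the adjunction for it. *)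
Definition orth g := g *m adj g = 1%:M.

Lemma orthP g : orth g <-> g^T *m S *m g = S.
Proof.
split=> [/mulmx1C|E]; rewrite ?/orth.
  by rewrite adjE => /(congr1 (mulmx S)); rewrite !mulmxA Stilde_sqr mul1mx mulmx1.
by apply: mulmx1C; rewrite adjE -!mulmxA (mulmxA _ S) E Stilde_sqr.
Qed.

Lemma orth_unit g : orth g -> g \in unitmx.
Proof.
move=> og; have [ug _] := mulmx1_unit og; exact: ug.
Qed.

Lemma orth_inv g : orth g -> invmx g = adj g.
Proof.
by move=> og; rewrite -[RHS]mul1mx -(mulVmx (orth_unit og)) -mulmxA og mulmx1.
Qed.

Lemma orth1 : orth 1%:M. Proof. by rewrite /orth adj1 mul1mx. Qed.

Lemma orthM g h : orth g -> orth h -> orth (g *m h).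
Proof.
by rewrite /orth adjM => og oh; rewrite mulmxA -[g *m h *m _]mulmxA oh mulmx1.
Qed.

Lemma orth_adj g : orth g -> orth (adj g).
Proof. by rewrite /orth adjK => /mulmx1C. Qed.

Lemma orthV g : orth g -> orth (invmx g).
Proof. by move=> og; rewrite orth_inv //; apply: orth_adj. Qed.

Lemma SO_orth g : SO pp d g -> orth g.
Proof. by case=> _ /orthP. Qed.

Lemma det_orth_sqr g : orth g -> \det g ^+ 2 = 1.
Proof.
move=> og; have SS : \det S * \det S = 1 by rewrite -det_mulmx Stilde_sqr det1.
have := congr1 determinant og; rewrite det_mulmx adjE !det_mulmx det_tr det1 => <-.
by rewrite mulrAC SS mul1r expr2.
Qed.

Lemma orth_row g i j : orth g -> \sum_k g i k * g (star j) (star k) = (i == j)%:R.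
Proof.
by move=> /(congr1 (fun A : mat => A i j)); rewrite !mxE => <-; apply: eq_bigr => k _; rewrite mxE.
Qed.

Lemma torus_diag (t : mat) i j : torus pp d t -> i != j -> t i j = 0.
Proof. by case=> _ /is_diag_mxP; apply. Qed.

Lemma torus_mul_star (t : mat) i : torus pp d t -> t i i * t (star i) (star i) = 1.
Proof.
move=> tt; have [/SO_orth ot _] := tt; have := orth_row i i ot.
rewrite eqxx (bigD1 i) //= big1 ?addr0 // => k ki.
by rewrite (torus_diag tt) 1?eq_sym // mul0r.
Qed.

Lemma torus_neq0 (t : mat) i : torus pp d t -> t i i != 0.
Proof.
by move=> tt; apply: contra_eq_neq (torus_mul_star i tt) => ->; rewrite mul0r eq_sym oner_neq0.
Qed.

Lemma torus_star (t : mat) i : torus pp d t -> t (star i) (star i) = (t i i)^-1.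
Proof.
move=> tt; apply: (mulfI (torus_neq0 i tt)).
by rewrite torus_mul_star // divff ?torus_neq0.
Qed.

Lemma torus_zI (t : mat) : torus pp d t -> t (zI d) (zI d) = 1.
Proof.
move=> tt; have [[dt _] dg] := tt; rewrite -{}dt det_trig ?is_diag_mx_is_trig //.
rewrite !big_split_ord big_ord1 /= -big_split /= big1 ?mul1r // => i _.
by rewrite -[RHS](torus_mul_star (eI i) tt) star_eI.
Qed.

Lemma chiD (t : mat) (a1 a2 : lattice d) : torus pp d t ->
  chi (a1 + a2) t = chi a1 t * chi a2 t.
Proof.
move=> tt; rewrite /chi -big_split; apply: eq_bigr => i _.
by rewrite mxE expfzDr ?torus_neq0.
Qed.

Lemma chi0 (t : mat) : chi (0 : lattice d) t = 1.
Proof. by rewrite /chi big1 // => i _; rewrite mxE expr0z. Qed.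

Lemma chiN (t : mat) (a : lattice d) : torus pp d t -> chi (- a) t = (chi a t)^-1.
Proof.
move=> tt; have E : chi (- a) t * chi a t = 1 by rewrite -chiD // addNr chi0.
by rewrite -[RHS]mul1r -E mulfK //; apply: contra_eq_neq E => ->; rewrite mulr0 eq_sym oner_neq0.
Qed.

Lemma chi_omega (t : mat) b : torus pp d t -> chi (omega b) t = t b b.
Proof.
move=> tt; have chi_e (i : 'I_d) : chi (e_ i) t = t (eI i) (eI i).
  rewrite /chi (bigD1 i) //= big1 ?mulr1 => [|k ki]; rewrite mxE ?eqxx ?expr1z //.
  by rewrite (negbTE ki) andbF expr0z.
case: b / (indexP b) => [i|i|]; rewrite ?omega_eI ?chi_e //; last first.
  by rewrite omega_zI chi0 torus_zI.
by rewrite omega_fI chiN // chi_e -torus_star // star_eI.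
Qed.

Lemma chi_rt (t : mat) b c : torus pp d t -> chi (rt b c) t = t b b / t c c.
Proof. by move=> tt; rewrite /rt chiD // chiN // !chi_omega. Qed.

Definition root_vec b c : mat := delta_mx b c - delta_mx (star c) (star b).

Definition root_elt b c t : mat := exp_mx (t *: root_vec b c).

Lemma adj_delta b c : adj (delta_mx b c) = delta_mx (star c) (star b).
Proof.
apply/matrixP => i j; rewrite !mxE andbC.
by congr (_ && _)%:R; rewrite (can2_eq starK starK).
Qed.

Lemma adjN g : adj (- g) = - adj g.
Proof. by apply/matrixP => i j; rewrite !mxE. Qed.

Lemma adj_root_vec b c : adj (root_vec b c) = - root_vec b c.
Proof. by rewrite /root_vec adjD adjN !adj_delta !starK opprB. Qed.

Lemma lie_adjP X : X^T *m S + S *m X = 0 <-> adj X = - X.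
Proof.
split=> [E|E].
  have /eqP := E; rewrite addr_eq0 => /eqP E'.
  by rewrite adjE -mulmxA E' mulmxN mulmxA Stilde_sqr mul1mx.
apply/eqP; rewrite addr_eq0 -mulmxN -E adjE mulmxA mulmxA Stilde_sqr mul1mx.
exact/eqP.
Qed.

Lemma root_vecE b c i j : root_vec b c i j =
  ((i == b) && (j == c))%:R - ((i == star c) && (j == star b))%:R.
Proof. by rewrite !mxE. Qed.

Definition cochar (m : 'I_d) : mat := diag_mx (\row_i p%:R ^ (omega i 0 m)).

Lemma mulmx_torusl (t : mat) X i j : is_diag_mx t -> (t *m X) i j = t i i * X i j.
Proof.
move=> /is_diag_mxP dt; rewrite mxE (bigD1 i) //= big1 ?addr0 // => k ki.
by rewrite dt ?mul0r // eq_sym.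
Qed.

Lemma mulmx_torusr (t : mat) X i j : is_diag_mx t -> (X *m t) i j = X i j * t j j.
Proof.
move=> /is_diag_mxP dt; rewrite mxE (bigD1 j) //= big1 ?addr0 // => k ki.
by rewrite dt ?mulr0.
Qed.

Lemma cocharE (m : 'I_d) i : cochar m i i = p%:R ^ omega i 0 m.
Proof. by rewrite !mxE eqxx mulr1n. Qed.

Lemma orth_diag (v : 'rV[K]_(d + d + 1)) : (forall i, v 0 i * v 0 (star i) = 1) ->
  orth (diag_mx v).
Proof.
move=> H; apply/matrixP => i j; rewrite mulmx_torusl ?diag_mx_is_diag // !mxE eqxx mulr1n.
rewrite (can_eq starK) [j == i]eq_sym; case: eqP => [->|_]; rewrite ?mulr0n ?mulr0 //.
Qed.

Lemma orth_cochar (m : 'I_d) : orth (cochar m).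
Proof.
apply: orth_diag => i; rewrite !mxE -expfzDr ?padic_p_neq0 //.
rewrite -[RHS](expr0z p%:R); congr (_ ^ _).
have /rowP/(_ m) : omega i + omega (star i) = 0 by rewrite omega_star subrr.
by rewrite !mxE.
Qed.

(* Squaring makes the determinant 1. *)
Lemma torus_cochar_sqr (m : 'I_d) : torus pp d (cochar m *m cochar m).
Proof.
have oc := orth_cochar m; split.
  by split; [rewrite det_mulmx -expr2 det_orth_sqr|apply/orthP/orthM].
apply/is_diag_mxP => i j ij; rewrite mulmx_torusl ?diag_mx_is_diag //.
by rewrite !mxE -[i == j]val_eqE (negbTE ij) mulr0n mulr0.
Qed.

Lemma root_space_torus X (t : mat) i j (x : K) : t \in unitmx -> is_diag_mx t ->
  t *m X *m invmx t = x *: X -> t i i * X i j = x * X i j * t j j.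
Proof.
move=> ut dt /(congr1 (fun A : mat => (A *m t) i j)).
by rewrite mulmxKV // mulmx_torusl // mulmx_torusr // mxE.
Qed.

(** Conjugation by the square of [cochar m] multiplies the entry (i, j) by p to twice the m-th
    coordinate of [rt i j], and distinct powers of p are distinct. *)
Lemma root_space_support b c X i j : root_space pp (rt b c) X -> X i j != 0 ->
  rt i j = rt b c.
Proof.
move=> [_ H] Xn0; apply/rowP => m.
have tm := torus_cochar_sqr m; have ut : cochar m *m cochar m \in unitmx.
  by apply: orth_unit; apply: orthM; exact: orth_cochar.
have dg : is_diag_mx (cochar m *m cochar m) by case: tm.
have := root_space_torus i j ut dg (H _ tm).
rewrite chi_rt // -mulrA [X i j * _]mulrC mulrA => /(mulIf Xn0).
rewrite !mulmx_torusl ?diag_mx_is_diag // !cocharE -!expfzDr ?padic_p_neq0 //.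
rewrite invr_expz -!expfzDr ?padic_p_neq0 // => /padic_pexp_inj.
by rewrite /rt !mxE; lia.
Qed.

Lemma root_spaceP b c X : is_root b c ->
  root_space pp (rt b c) X <-> exists t, X = t *: root_vec b c.
Proof.
move=> bc; split=> [HX|[u ->]].
  have [/lie_adjP aX _] := HX; exists (X b c); apply/matrixP => i j.
  have bn : b != star c by move: bc; rewrite -is_root_sym => /andP[].
  rewrite mxE root_vecE; case: (eqVneq i b) => [->|ib].
    rewrite (negbTE bn) /= subr0; case: eqVneq => [->|jc]; rewrite ?mulr1 ?mulr0 //.
    apply/eqP; apply: contraNT jc => /(root_space_support HX) /(rt_inj bc).
    by move=> [[_ ->]|[bE _]] //; rewrite bE eqxx in bn.
  rewrite andFb sub0r; case: (eqVneq i (star c)) => [->|ic] /=.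
    case: eqVneq => [->|jb]; rewrite ?mulrN1 ?oppr0 ?mulr0.
      by have /matrixP/(_ b c) := aX; rewrite !mxE => <-.
    apply/eqP; apply: contraNT jb => /(root_space_support HX) /(rt_inj bc).
    by move=> [[bE _]|[_ ->]] //; rewrite bE eqxx in bn.
  rewrite oppr0 mulr0; apply/eqP; apply: contraNT ib.
  move=> /(root_space_support HX) /(rt_inj bc) [[-> //]|[iE _]].
  by rewrite iE eqxx in ic.
split=> [|t tt]; first by apply/lie_adjP; rewrite adjZ adj_root_vec scalerN.
have [tSO dg] := tt; have ut := orth_unit (SO_orth tSO).
apply: (can_inj (mulmxK ut)); rewrite mulmxKV //; apply/matrixP => i j.
have sE (y : K) (A : mat) : (y *: A) i j = y * A i j by rewrite mxE.
rewrite mulmx_torusl // mulmx_torusr // !sE chi_rt // root_vecE.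
have [cn0 bn0] := (torus_neq0 c tt, torus_neq0 b tt).
case: andP => [[/eqP -> /eqP ->]|_]; case: andP => [[/eqP iE /eqP jE]|_];
  rewrite ?subrr ?mulr0 ?mul0r ?subr0 ?sub0r //.
- exact: (mul_div_mid _ _ cn0).
- by rewrite iE jE !torus_star //; exact: (mul_div_midV _ _ bn0).
Qed.

Lemma root_vec_sqr b c : is_root b c -> root_vec b c *m root_vec b c =
  - (delta_mx b (star b) *+ (c == zI d)) - delta_mx (star c) c *+ (b == zI d).
Proof.
move=> bc; have bn : b != star c by move: bc; rewrite -is_root_sym => /andP[].
have [cb nb] := andP bc.
rewrite /root_vec mulmxBl !mulmxBr !mul_delta_mx_cond.
rewrite [c == b]eq_sym (negbTE cb) [star b == star c](can_eq starK) (negbTE cb).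
rewrite [c == star c]eq_sym !star_fixed !mulr0n sub0r.
by rewrite subr0.
Qed.

Lemma root_vec_cube b c : is_root b c ->
  root_vec b c *m root_vec b c *m root_vec b c = 0.
Proof.
move=> bc; have bn : b != star c by move: bc; rewrite -is_root_sym => /andP[].
have [cb nb] := andP bc.
rewrite root_vec_sqr // mulmxBl mulNmx; have [cz|cz] := eqVneq c (zI d).
  have [bz|bz] := eqVneq b (zI d); first by rewrite bz cz eqxx in cb.
  rewrite mulr0n mul0mx subr0 mulr1n /root_vec mulmxBr !mul_delta_mx_cond.
  by rewrite star_fixed (negbTE bz) (can_eq starK) (negbTE cb) !mulr0n subr0 oppr0.
rewrite mulr0n mul0mx oppr0 sub0r; have [bz|bz] := eqVneq b (zI d); last first.
  by rewrite mulr0n mul0mx oppr0.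
rewrite mulr1n /root_vec mulmxBr !mul_delta_mx_cond [c == b]eq_sym (negbTE cb).
by rewrite [c == _]eq_sym star_fixed (negbTE cz) !mulr0n subr0 oppr0.
Qed.

Lemma root_eltM b c t : root_elt b c t = exp3 (root_vec b c) t.
Proof.
by rewrite /root_elt /exp_mx /exp3 expr2 -[X in 2^-1 *: X]/(_ *m _).
Qed.

Lemma root_eltD b c t u : is_root b c ->
  root_elt b c t *m root_elt b c u = root_elt b c (t + u).
Proof.
move=> bc; rewrite !root_eltM; apply: exp3D; last exact: root_vec_cube.
exact: padic_2_neq0.
Qed.

Lemma root_elt0 b c : root_elt b c 0 = 1%:M.
Proof. by rewrite /root_elt /exp_mx scale0r expr0n scaler0 !addr0. Qed.

Lemma root_elt_orth b c t : is_root b c -> orth (root_elt b c t).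
Proof.
move=> bc; rewrite /orth.
suff -> : adj (root_elt b c t) = root_elt b c (- t).
  by rewrite root_eltD // subrr root_elt0.
rewrite !root_eltM -[exp3 _ (- t)]exp3N -adj_root_vec /exp3.
rewrite adjD adjD adj1.
rewrite adjZ.
rewrite [adj (2^-1 *: _)]adjZ.
rewrite adjM.
rewrite adjZ.
reflexivity.
Qed.

Lemma root_elt_inv b c t : is_root b c -> invmx (root_elt b c t) = root_elt b c (- t).
Proof.
move=> bc; have ut := orth_unit (root_elt_orth t bc).
by rewrite -[RHS]mul1mx -(mulVmx ut) -mulmxA root_eltD // subrr root_elt0 mulmx1.
Qed.

(** The element is the square of the isometry of parameter t/2, whose determinant squares to 1. *)
Lemma det_root_elt b c t : is_root b c -> \det (root_elt b c t) = 1.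
Proof.
move=> bc; rewrite -(det_orth_sqr (root_elt_orth (t / 2) bc)) expr2 -det_mulmx.
by rewrite (root_eltD _ _ bc) -(splitf2 t (padic_2_neq0 pp)).
Qed.

Lemma root_eltE b c t i j : is_root b c -> root_elt b c t i j =
  (i == j)%:R + t * (((i == b) && (j == c))%:R - ((i == star c) && (j == star b))%:R)
  - t ^+ 2 / 2 * ([&& c == zI d, i == b & j == star b]%:R +
                  [&& b == zI d, i == star c & j == c]%:R).
Proof.
move=> bc; rewrite root_eltM exp3E root_vec_sqr // root_vecE.
congr (_ + _ - _ * _).
rewrite opprD !opprK mxE.
by congr (_ + _); case: (_ == zI d); rewrite ?mulr1n ?mulr0n !mxE.
Qed.
End Orthogonal.

(** * Iwahori subgroups *)

Section Parahoric.
Variables (p : nat) (pp : prime p) (d : nat) (R : realType).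
Local Notation K := (padic_num pp).
Local Notation I := 'I_(d + d + 1).
Local Notation mat := 'M[K]_(d + d + 1).
Local Notation S := (Stilde pp d).
Implicit Types (g h X : mat) (t u : K) (b c i j : I) (y : apartment d R).

Lemma ext_coord_eI y (i : 'I_d) : ext_coord y (eI i) = y 0 i.
Proof. by rewrite /ext_coord !row_mxEl. Qed.
Lemma ext_coord_fI y (i : 'I_d) : ext_coord y (fI i) = - y 0 i.
Proof. by rewrite /ext_coord row_mxEl row_mxEr mxE. Qed.
Lemma ext_coord_zI y : ext_coord y (zI d) = 0.
Proof. by rewrite /ext_coord row_mxEr mxE. Qed.

Lemma ext_coord_star y b : ext_coord y (star b) = - ext_coord y b.
Proof.
case: b / (indexP b) => [i|i|].
- by rewrite star_eI ext_coord_fI ext_coord_eI.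
- by rewrite star_fI ext_coord_fI ext_coord_eI opprK.
- by rewrite star_zI ext_coord_zI oppr0.
Qed.

Lemma pairingB (a1 a2 : lattice d) y : pairing (a1 - a2) y = pairing a1 y - pairing a2 y.
Proof.
by rewrite /pairing -sumrB; apply: eq_bigr => i _; rewrite !mxE rmorphB mulrBl.
Qed.

Lemma pairing_omega b y : pairing (omega b) y = ext_coord y b.
Proof.
have pe (i : 'I_d) : pairing (e_ i) y = y 0 i.
  rewrite /pairing (bigD1 i) //= big1 ?addr0 => [|k ki]; rewrite mxE ?eqxx ?mul1r //.
  by rewrite (negbTE ki) andbF mul0r.
have p0 : pairing 0 y = 0 by rewrite /pairing big1 // => i _; rewrite mxE mul0r.
case: b / (indexP b) => [i|i|].
- by rewrite omega_eI pe ext_coord_eI.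
- by rewrite omega_fI -sub0r pairingB p0 pe ext_coord_fI sub0r.
- by rewrite omega_zI p0 ext_coord_zI.
Qed.

Lemma pairing_rt b c y : pairing (rt b c) y = ext_coord y b - ext_coord y c.
Proof. by rewrite /rt pairingB !pairing_omega. Qed.

(* For [p = 2] the short root subgroups meet [SL(Z_2)] in the parameters of
   valuation at least 1. *)
Definition shift b c : nat := (p == 2%N) && ((b == zI d) (+) (c == zI d)).

Lemma shift_triangle b c i : (shift b c <= shift b i + shift i c)%N.
Proof.
by rewrite /shift; case: (p == _); case: (b == _); case: (c == _); case: (i == _).
Qed.

Lemma shift_star b c : shift (star c) (star b) = shift b c.
Proof.
have sz i : (star i == zI d) = (i == zI d) by rewrite (can2_eq starK starK) star_zI.
by rewrite /shift !sz addbC.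
Qed.

Lemma shift_diag b : shift b b = 0%N.
Proof. by rewrite /shift addbb andbF. Qed.

Definition bound y b c : R := ext_coord y c - ext_coord y b + (shift b c)%:R.

(** The coordinate differences telescope, and [shift] is a distance between the class of [zI] and
    that of the other indices. Stability of [in_order] under products rests on this. *)
Lemma bound_triangle y b c i : bound y b c <= bound y b i + bound y i c.
Proof.
have : ((shift b c)%:R : R) <= (shift b i)%:R + (shift i c)%:R.
  by rewrite -natrD ler_nat shift_triangle.
by rewrite /bound; lra.
Qed.

Lemma bound_star y b c : bound y (star c) (star b) = bound y b c.
Proof. by rewrite /bound shift_star !ext_coord_star; lra. Qed.

Lemma bound_diag y b : bound y b b = 0.
Proof. by rewrite /bound shift_diag subrr addr0. Qed.

Definition in_order y g := forall i j, vge (g i j) (bound y i j).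

Lemma in_order1 y : in_order y 1%:M.
Proof.
move=> i j; rewrite !mxE; case: eqP => [->|_]; rewrite ?mulr1n ?mulr0n; last exact: vge0.
by rewrite bound_diag; apply/vge1.
Qed.

Lemma in_orderM y g h : in_order y g -> in_order y h -> in_order y (g *m h).
Proof.
move=> og oh i j; rewrite mxE; apply: vge_sum => k _.
by apply: (vgeW (bound_triangle y i j k)); apply: vgeM.
Qed.

Lemma in_order_adj y g : in_order y g -> in_order y (adj g).
Proof. by move=> og i j; rewrite !mxE -bound_star. Qed.

Definition parahoric y : set mat := [set g | orth g /\ in_order y g].

Lemma parahoric_subgroup y : is_subgroup (parahoric y).
Proof.
split=> [g [/orth_unit //]||g h [og yg] [oh yh]|g [og yg]].
- by split; [exact: orth1|exact: in_order1].
- by split; [exact: orthM|exact: in_orderM].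
- by split; [exact: orthV|rewrite orth_inv //; exact: in_order_adj].
Qed.

Lemma in_order_root_elt y b c t : is_root b c ->
  in_order y (root_elt b c t) <-> vge t (bound y b c).
Proof.
move=> bc; have bn : b != star c by move: bc; rewrite -is_root_sym => /andP[].
have [cb nb] := andP bc; split=> [/(_ b c)|ht i j].
  rewrite root_eltE // (negbTE cb) !eqxx (negbTE bn) /= add0r subr0 mulr1.
  by rewrite eq_sym in nb; rewrite [c == star b]eq_sym (negbTE nb) !andbF addr0 mulr0 subr0.
rewrite root_eltE //; apply: vgeD; first apply: vgeD.
- by have := in_order1 y i j; rewrite mxE.
- case: andP => [[/eqP -> /eqP ->]|_]; case: andP => [[/eqP -> /eqP ->]|_];
    rewrite ?subrr ?subr0 ?sub0r ?mulr0 ?mulr1 ?mulrN1 //; try exact: vge0.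
  by rewrite bound_star; apply: vgeN.
(* For a short root and p = 2, twice the bound exceeds the bound at the quadratic position by 2,
   which pays for the division by 2. *)
- apply: vgeN; have half : vge (t ^+ 2 / 2) (bound y b c + bound y b c - (p == 2%N)%:R).
    by apply: vge_half; rewrite expr2; apply: vgeM.
  rewrite mulrDr; apply: vgeD; case: and3P => [[/eqP cz /eqP -> /eqP ->]|_];
    rewrite ?mulr1 ?mulr0; try exact: vge0.
    apply: vgeW half; rewrite /bound cz ext_coord_zI ext_coord_star /shift eqxx.
    rewrite (can2_eq starK starK) star_zI; have := cb; rewrite cz => /negbTE ->.
    by rewrite andbF; case: (p == _) => /=; lra.
  apply: vgeW half; rewrite /bound cz ext_coord_zI ext_coord_star /shift eqxx.
  rewrite (can2_eq starK starK) star_zI; have := cb; rewrite cz eq_sym => /negbTE ->.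
  by rewrite andbF; case: (p == _) => /=; lra.
Qed.

Lemma root_groupP b c g : is_root b c ->
  root_group pp (rt b c) g <-> exists t, g = root_elt b c t.
Proof.
move=> bc; split=> [[X /(root_spaceP _ bc)[t ->] <-]|[t ->]]; first by exists t.
by exists (t *: root_vec pp b c) => //; apply/root_spaceP => //; exists t.
Qed.

(** At the origin the bounds reduce to the shifts. Conversely the entries t and, for a short root,
    t^2/2 must be integral, and [vge_sqr] applies to the second. *)
Lemma SLZp_root_elt b c t : is_root b c ->
  SLZp pp d (root_elt b c t) <-> vge t ((shift b c)%:R : R).
Proof.
move=> bc; have b0 i j : bound 0 i j = (shift i j)%:R.
  rewrite /bound -!pairing_omega /pairing !big1 ?subrr ?add0r // => k _;
  by rewrite [X in _ * X]mxE mulr0.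
rewrite -b0; split=> [[_ int]|ht]; last first.
  split=> [|i j]; first exact: det_root_elt.
  apply/(padic_integerP R); have /(_ i j) := (in_order_root_elt 0 t bc).2 ht.
  by rewrite b0; apply: vgeW.
have bn : b != star c by move: bc; rewrite -is_root_sym => /andP[].
have [cb nb] := andP bc.
have ht : vge t (0 : R).
  have /(padic_integerP R) := int b c.
  rewrite root_eltE // (negbTE cb) !eqxx (negbTE bn) /= add0r subr0 mulr1.
  by rewrite eq_sym in nb; rewrite [c == star b]eq_sym (negbTE nb) !andbF addr0 mulr0 subr0.
have sq : (b == zI d) (+) (c == zI d) -> vge (t ^+ 2 / 2) (0 : R).
  have [bz|bz] := eqVneq b (zI d); have [cz|cz] := eqVneq c (zI d) => // _.
  - have /(padic_integerP R)/vgeN := int (star c) c; congr vge; rewrite root_eltE //.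
    rewrite star_fixed (negbTE cz) [star c == b]eq_sym (negbTE bn) (negbTE nb) andbF.
    by rewrite bz !eqxx /= !mulr0n subrr mulr0 !add0r mulr1 opprK.
  - have /(padic_integerP R)/vgeN := int b (star b); congr vge; rewrite root_eltE //.
    rewrite [b == star b]eq_sym star_fixed (negbTE bz) [star b == c]eq_sym (negbTE nb) (negbTE bn).
    by rewrite cz !eqxx andbF /= !mulr0n subrr mulr0 !add0r addr0 mulr1 opprK.
rewrite b0 /shift; case: (addb _ _) sq => sq; rewrite ?andbT ?andbF //.
by apply: vge_sqr => //; apply: sq.
Qed.

Lemma root_filtrationP b c (k : int) g : is_root b c ->
  root_filtration pp (rt b c) k g <->
  exists2 t, vge t (k%:~R + (shift b c)%:R : R) & g = root_elt b c t.
Proof.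
move=> bc; split=> [[X [/(root_spaceP _ bc)[t ->] /(SLZp_root_elt _ bc) ht] <-]|[t ht ->]].
  by exists (p%:R ^ k * t); [apply/vgeMp|rewrite scalerA].
have pk : p%:R ^ k * (p%:R ^ (- k) * t) = t.
  by rewrite mulrA -expfzDr ?padic_p_neq0 // subrr mul1r.
exists ((p%:R ^ (- k) * t) *: root_vec pp b c); last by rewrite scalerA pk.
split; first by apply/root_spaceP => //; exists (p%:R ^ (- k) * t).
by apply/(SLZp_root_elt _ bc)/(vgeMp k); rewrite pk.
Qed.
End Parahoric.

Lemma half_sum_eq (F : fieldType) (x y : F) : (2 : F) != 0 -> x + x + y = 0 -> x = - (y / 2).
Proof. by move=> F2 /eqP; rewrite addr_eq0 => /eqP E; rewrite -[y]opprK -E; field. Qed.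

Section Generated.
Variables (F : fieldType) (n : nat).
Implicit Types (A H : set 'M[F]_n) (g h : 'M[F]_n).

Lemma generated_sub A H : is_subgroup H -> A `<=` H -> generated A `<=` H.
Proof. exact: smallest_sub. Qed.

Lemma sub_generated A : A `<=` generated A.
Proof. exact: sub_gen_smallest. Qed.

Lemma generatedM A g h : generated A g -> generated A h -> generated A (g * h).
Proof. by move=> Ag Ah H [sH AH]; have [_ _ mH _] := sH; apply: mH; [apply: Ag|apply: Ah]. Qed.

Lemma generated1 A : generated A 1.
Proof. by move=> H [[]]. Qed.

Lemma subgroupX H g (m : nat) : is_subgroup H -> H g -> H (g ^+ m).
Proof.
by case=> _ H1 HM _ Hg; elim: m => [|m IHm]; rewrite ?expr0 // exprS; apply: HM.
Qed.

Lemma subgroupI H H' : is_subgroup H -> is_subgroup H' -> is_subgroup (H `&` H').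
Proof.
move=> [a1 a2 a3 a4] [b1 b2 b3 b4]; split=> [g [/a1] //||g h [? ?] [? ?]|g [? ?]].
- by split.
- by split; [apply: a3|apply: b3].
- by split; [apply: a4|apply: b4].
Qed.
End Generated.

Section Iwahori.
Variables (p : nat) (pp : prime p) (d : nat) (R : realType).
Local Notation K := (padic_num pp).
Local Notation I := 'I_(d + d + 1).
Local Notation mat := 'M[K]_(d + d + 1).
Implicit Types (g h X : mat) (t u : K) (b c i j : I) (y : apartment d R).

(** All powers of t stay in one bounded group, so the powers of a diagonal entry have a common
    denominator and the entry is integral. *)
Lemma torus0_parahoric y : torus0 pp d `<=` parahoric y.
Proof.
move=> t [H [sH HT [k bH] Ht]]; have tt := HT _ Ht; have [tSO dt] := tt.
split=> [|i j]; first exact: SO_orth.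
have [<-|ij] := eqVneq i j; last by rewrite (torus_diag tt) //; apply: vge0.
rewrite bound_diag; apply: (@vge_bounded _ _ _ _ k) => n.
have -> : t i i ^+ n = (t ^+ n) i i.
  elim: n => [|n IHn]; first by rewrite !expr0 mxE eqxx.
  by rewrite !exprS IHn -[t * _]/(t *m _) mulmx_torusl.
have /(_ i i) := bH _ (subgroupX n sH Ht); rewrite mxE => h.
exact/padic_integerP.
Qed.

Lemma iwahori_sub y : iwahori pp (facet y) `<=` parahoric y.
Proof.
apply: generated_sub; first exact: parahoric_subgroup.
move=> g [/torus0_parahoric //|[a [k [/roots_rt[b [c [bc ->]]] ky]]]].
move=> /(root_filtrationP R _ _ bc)[t ht ->]; split; first exact: root_elt_orth.
apply/in_order_root_elt => //; apply: vgeW ht.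
have /(_ y) := ky; rewrite pairing_rt /bound => /(_ (fun _ _ _ => erefl)).
by lra.
Qed.

Lemma iwahori_root_elt y b c t : is_root b c ->
  iwahori pp (facet y) (root_elt b c t) <-> vge t (bound p y b c).
Proof.
move=> bc; split=> [/iwahori_sub[_ /(in_order_root_elt _ _ bc)] //|[m [z tE hm]]].
(* The filtration counts from N_a^0, whose parameters have valuation at least the shift; valuation m
   is thus level m - shift. *)
apply: sub_generated; right; exists (rt b c), (m - (shift p b c)%:Z); split.
- by apply/roots_rt; exists b, c.
- move=> y' /(_ (rt b c) (m - (shift p b c)%:Z)); rewrite -[0 <= _]sgr_ge0 => ->.
    rewrite sgr_ge0 pairing_rt rmorphB /= -pmulrn; move: hm; rewrite /bound; lra.
  by apply/roots_rt; exists b, c.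
- apply/(root_filtrationP R) => //; exists t => //; exists m, z => //.
  by rewrite rmorphB /= -pmulrn subrK.
Qed.

Definition root_part y b c : set mat := [set root_elt b c t | t in [set t | vge t (bound p y b c)]].

Lemma iwahori_root_group y b c : is_root b c ->
  iwahori pp (facet y) `&` root_group pp (rt b c) = root_part y b c.
Proof.
move=> bc; apply/seteqP; split=> [g [gI /(root_groupP _ bc)[t gE]]|g [t ht <-]].
  by exists t => //; apply/(iwahori_root_elt _ _ bc); rewrite -gE.
by split; [apply/iwahori_root_elt|apply/root_groupP => //; exists t].
Qed.

Lemma root_part_subgroup y b c : is_root b c -> is_subgroup (root_part y b c).
Proof.
move=> bc; split=> [g [t _ <-]||g h [t ht <-] [u hu <-]|g [t ht <-]].
- exact/orth_unit/root_elt_orth.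
- by exists 0; [apply: vge0|rewrite root_elt0].
- by exists (t + u); [apply: vgeD|rewrite -root_eltD].
- by exists (- t); [apply: vgeN|rewrite root_elt_inv].
Qed.

Definition unitriangular : set mat := [set g | [/\ orth g,
  forall i j, (height j < height i)%N -> g i j = 0 & forall i, g i i = 1]].

Lemma unitriangular_subgroup : is_subgroup unitriangular.
Proof.
split=> [g [/orth_unit //]||g h [og tg dg] [oh th dh]|g [og tg dg]].
- split=> [|i j ij|i]; rewrite ?mxE ?eqxx //; first exact: orth1.
  by case: eqP => // E; rewrite E ltnn in ij.
- split=> [|i j ij|i]; first exact: orthM.
    rewrite mxE big1 // => k _; have [ki|ik] := ltnP (height k) (height i).
      by rewrite tg // mul0r.
    by rewrite th ?mulr0 // (leq_trans ij).
  rewrite mxE (bigD1 i) //= big1 => [|k ki]; first by rewrite dg dh mulr1 addr0.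
  have [ik|ik|/height_inj E] := ltngtP (height k) (height i).
  + by rewrite tg // mul0r.
  + by rewrite th // mulr0.
  + by rewrite E eqxx in ki.
- rewrite orth_inv //; split=> [|i j ij|i]; rewrite ?mxE ?dg //; first exact: orth_adj.
  by apply: tg; rewrite height_starW.
Qed.

Lemma root_elt_unitriangular b c t : is_root b c -> (height b < height c)%N ->
  unitriangular (root_elt b c t).
Proof.
move=> bc hbc; have hs := @height_star d; have hl := @height_le d.
have hz : height (zI d) = d by rewrite /height zI_val; lif.
have main i j : (height j <= height i)%N -> root_elt b c t i j = (i == j)%:R.
  move=> ji; rewrite root_eltE // -[RHS]addr0 -[RHS]addr0 -addrA -addrA; congr (_ + _).
  rewrite (_ : (i == b) && (j == c) = false); last first.
    by apply: contraTF ji => /andP[/eqP -> /eqP ->]; rewrite -ltnNge.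
  rewrite (_ : (i == star c) && (j == star b) = false); last first.
    by apply: contraTF ji => /andP[/eqP -> /eqP ->]; rewrite -ltnNge height_starW.
  rewrite (_ : [&& _, i == b & _] = false); last first.
    apply: contraTF ji => /and3P[/eqP cz /eqP -> /eqP ->]; rewrite -ltnNge.
    by move: hbc; rewrite cz hz hs; have := hl b; lia.
  rewrite (_ : [&& _, i == star c & _] = false); last first.
    apply: contraTF ji => /and3P[/eqP bz /eqP -> /eqP ->]; rewrite -ltnNge.
    by move: hbc; rewrite bz hz hs; have := hl c; lia.
  by rewrite !mulr0n addr0 subr0 !mulr0 oppr0 addr0.
split=> [|i j ij|i]; first exact: root_elt_orth.
  by rewrite main ?(ltnW ij) //; case: eqP => // E; rewrite E ltnn in ij.
by rewrite main // eqxx.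
Qed.

Lemma unipotent_unitriangular : unipotent pp d `<=` unitriangular.
Proof.
apply: generated_sub; first exact: unitriangular_subgroup.
move=> g [a /pos_roots_rt[b [c [bc hbc ->]]]] /(root_groupP _ bc)[t ->].
exact: root_elt_unitriangular.
Qed.

(** Since b differs from b*, row b is isotropic: the terms k and k* of its pairing with itself
    agree, so half of the relation expresses g_bb*, as g_bb = 1, through g_bz^2 / 2 and the products
    g_bi g_bi* of the remaining pairs. *)
Lemma isotropic_row g b (r : R) : orth g -> g b b = 1 -> b != zI d ->
  vge (g b (zI d) ^+ 2 / 2) r ->
  (forall i, i != b -> i != star b -> i != zI d -> vge (g b i * g b (star i)) r) ->
  vge (g b (star b)) r.
Proof.
move=> og gb bz hz H; pose F k := g b k * g b (star k).
have FS k : F (star k) = F k by rewrite /F starK mulrC.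
have [m bm] : exists m : 'I_d, b = eI m \/ b = fI m.
  by case: b / (indexP b) bz {gb hz H F FS} => [m|m|]; [exists m; left|exists m; right|rewrite eqxx].
have sum0 : \sum_i F (eI i) = - (g b (zI d) ^+ 2 / 2).
  have := orth_row b (star b) og; rewrite starK [b == _]eq_sym star_fixed (negbTE bz).
  rewrite -[LHS]/(\sum_k F k) sum_index /= mulr0n.
  have -> : \sum_i F (fI i) = \sum_i F (eI i).
    by apply: eq_bigr => i _; rewrite -star_eI FS.
  rewrite /F star_zI -expr2; apply: half_sum_eq; exact: padic_2_neq0.
have Fm : F (eI m) = g b (star b).
  have -> : F (eI m) = F b by case: bm => ->; rewrite // -star_fI FS.
  by rewrite /F gb mul1r.
rewrite -Fm; move: sum0; rewrite (bigD1 m) //= => /(canRL (addrK _)) ->.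
apply: vgeD; first exact: vgeN.
apply/vgeN/vge_sum => i im; apply: H.
- by case: bm => ->; rewrite -val_eqE /=; move: im; rewrite -val_eqE /=;
     have := ltn_ord i; lia.
- by case: bm => ->; rewrite -val_eqE /= /star_nat /=; move: im; rewrite -val_eqE /=;
     have := ltn_ord i; have := ltn_ord m; lif.
- by rewrite -val_eqE /=; have := ltn_ord i; lia.
Qed.
End Iwahori.

(** * Factorization of unitriangular isometries into root elements *)

Section Factorization.
Variables (p : nat) (pp : prime p) (d : nat) (R : realType).
Local Notation K := (padic_num pp).
Local Notation I := 'I_(d + d + 1).
Local Notation mat := 'M[K]_(d + d + 1).
Implicit Types (g h X : mat) (t u : K) (b c i j : I) (y : apartment d R).

Lemma bound_star_row y b : b != zI d -> bound p y b (star b) = - (ext_coord y b *+ 2).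
Proof.
move=> bz; rewrite /bound ext_coord_star /shift (can2_eq starK starK) star_zI.
by rewrite addbb andbF addr0 mulr2n opprD.
Qed.

Lemma in_order_star y g b : unitriangular g -> (height b < height (star b))%N ->
  vge (g b (zI d)) (bound p y b (zI d)) ->
  (forall i, i != b -> i != star b -> i != zI d ->
     vge (g b i * g b (star i)) (bound p y b i + bound p y b (star i))) ->
  vge (g b (star b)) (bound p y b (star b)).
Proof.
move=> [og tg dg] hb gz H; have bz : b != zI d.
  by apply: contraTneq hb => ->; rewrite star_zI ltnn.
rewrite bound_star_row //; apply: isotropic_row => // [|i ib isb iz].
  have := vge_half (vgeM gz gz); rewrite -expr2; apply: vgeW.
  rewrite /bound ext_coord_zI /shift eqxx (negbTE bz) andbT.
  by case: (p == 2%N) => /=; lra.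
apply: vgeW (H i ib isb iz); rewrite /bound ext_coord_star /shift (can2_eq starK starK).
by rewrite star_zI (negbTE bz) (negbTE iz) andbF /=; lra.
Qed.

Lemma in_order_roots y g : unitriangular g ->
  (forall b c, is_root b c -> (height b < height c)%N -> vge (g b c) (bound p y b c)) ->
  in_order y g.
Proof.
move=> Ug H; have [og tg dg] := Ug.
have main b c : c != star b -> vge (g b c) (bound p y b c).
  move=> cb; have [hbc|hbc|/height_inj ->] := ltngtP (height b) (height c).
  - by apply: H => //; rewrite /is_root cb andbT; apply: contraTneq hbc => ->; rewrite ltnn.
  - by rewrite tg //; apply: vge0.
  - by rewrite dg bound_diag; apply/vge1.
move=> b c; have [->|] := eqVneq c (star b); last exact: main.
have [hb|hb|/height_inj E] := ltngtP (height b) (height (star b)).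
- apply: in_order_star => // [|i ib isb iz]; last apply: vgeM; apply: main => //.
    by rewrite eq_sym (can2_eq starK starK) star_zI; apply: contraTneq hb => ->; rewrite star_zI ltnn.
  by rewrite (can_eq starK).
- by rewrite tg //; apply: vge0.
- by rewrite -E dg bound_diag; apply/vge1.
Qed.

(** Pairing a trivial row i with the other rows leaves a single term, so column i* is trivial as
    well. This is why clearing d rows is enough in [rows_all]. *)
Lemma orth_row_delta g i : orth g -> (forall j, g i j = (i == j)%:R) ->
  forall j, g j (star i) = (j == star i)%:R.
Proof.
move=> og gi j; have := orth_row i (star j) og; rewrite starK (bigD1 i) //= big1 ?addr0.
  by rewrite gi eqxx mul1r => ->; rewrite eq_sym (can2_eq starK starK).
by move=> k ki; rewrite gi eq_sym (negbTE ki) mul0r.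
Qed.

Lemma vge_eq0 (x : K) : (forall r : R, vge x r) -> x = 0.
Proof.
move=> H; apply/eqP; apply: contraT => /(vge_val R)[k kP].
by have /kP := H (k%:~R + 1); rewrite gerDl ler10.
Qed.

Section Factor.
Variables (y : apartment d R) (G : set mat).
Hypothesis G1 : G 1%:M.
Hypothesis GM : forall g h, G g -> G h -> G (g *m h).
Hypothesis Groot : forall b c t, is_root b c -> (height b < height c)%N ->
  vge t (bound p y b c) -> G (root_elt b c t).

Let U g := unitriangular g /\ in_order y g.
Let rows (m : nat) g := forall i j, (i < m)%N -> g i j = (i == j)%:R.

Lemma rows_all g : U g -> rows d g -> g = 1%:M.
Proof.
move=> [[og tg dg] _] rg; apply/matrixP => i j; rewrite [RHS]mxE.
have lower b c : (height c < height b)%N -> g b c = (b == c)%:R.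
  by move=> bc; rewrite tg //; case: eqP => // E; rewrite E ltnn in bc.
have [/rg //|di] := ltnP i d.
case: j / (indexP j) => [j|j|].
- by apply: lower; rewrite /height /=; have := ltn_ord i; have := ltn_ord j; lif.
- rewrite -star_eI; apply: orth_row_delta => // k; apply: rg; exact: (ltn_ord j).
- have [->|iz] := eqVneq i (zI d); first by rewrite dg.
  rewrite tg //; rewrite height_zI /height; move: iz; rewrite -val_eqE /=.
  by have := ltn_ord i; lif.
Qed.

(** Columns are cleared by increasing index, [n] of them being left. Right multiplication by a root
    element of first index m and parameter - g_mc kills g_mc and, in row m, otherwise affects only
    column m*, which is never cleared by hand. *)
Lemma factor_row (m : 'I_d) (n : nat) g : U g -> rows m g ->
  (forall j, (j < d + d + 1 - n)%N -> j != eI m -> j != fI m -> g (eI m) j = 0) ->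
  (forall h, U h -> rows m.+1 h -> G h) -> G g.
Proof.
move=> + + + IH; elim: n g => [|n IHn] g Ug rg zg.
  have [Ug' _] := Ug; have [og tg dg] := Ug'; apply: IH => // i j im.
  have [iE|im'] := eqVneq i (eI m); last first.
    by apply: rg; move: im im'; rewrite -val_eqE /=; lia.
  rewrite iE; have [->|jm] := eqVneq j (eI m); first by rewrite dg.
  have [jf|jf] := eqVneq j (fI m); last by apply: zg => //; rewrite subn0.
  (* All the other pairs of the row vanish by now, so isotropy bounds the valuation of the last
     entry by every r and the entry is 0. *)
  rewrite jf -star_eI; apply: vge_eq0 => r; apply: isotropic_row => //.
  - by rewrite -val_eqE /=; have := ltn_ord m; lia.
  - rewrite zg ?expr0n ?mul0r ?subn0 //; first exact: vge0.
    + by rewrite -val_eqE /=; have := ltn_ord m; lia.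
    + by rewrite -val_eqE /=; have := ltn_ord m; lia.
  - move=> k k1 k2 _; rewrite zg ?mul0r ?subn0 -?star_eI //; exact: vge0.
have [dn|nd] := leqP (d + d + 1) n.
  by apply: IHn => // j; rewrite (eqP dn).
have ltc : (d + d - n < d + d + 1)%N by lia.
pose c : I := Ordinal ltc.
have [skip|] := boolP [|| c == eI m, c == fI m | g (eI m) c == 0].
  apply: IHn => // j jn j1 j2; have [jc|jc] := eqVneq j c.
    by move: skip; rewrite -jc (negbTE j1) (negbTE j2) => /eqP.
  by apply: zg => //; move: jc jn; rewrite -val_eqE /=; lia.
rewrite !negb_or => /and3P[c1 c2 gc0].
have [[og tg dg] yg] := Ug.
have hmc : (height (eI m) < height c)%N.
  have [//|h|/height_inj E] := ltngtP (height (eI m)) (height c).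
    by rewrite tg ?eqxx in gc0.
  by rewrite -E eqxx in c1.
have mc : is_root (eI m) c by rewrite /is_root eq_sym c1 star_eI.
pose t := g (eI m) c; have ht : vge (- t) (bound p y (eI m) c) by apply: vgeN; apply: yg.
have xU : unitriangular (root_elt (eI m) c (- t)) by apply: root_elt_unitriangular.
have [_ _ UM _] := unitriangular_subgroup pp d.
pose g' := g *m root_elt (eI m) c (- t).
suff Gg' : G g'.
  have -> : g = g' *m root_elt (eI m) c t.
    by rewrite /g' -mulmxA root_eltD // addNr root_elt0 mulmx1.
  by apply: GM => //; apply: Groot => //; rewrite -[t]opprK; apply: vgeN.
apply: IHn.
- split; first exact: (UM g _ Ug.1 xU).
  by apply: in_orderM => //; apply/in_order_root_elt.
- move=> i j im; rewrite mxE (bigD1 i) //= big1 ?addr0 => [|k ki]; last first.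
    by rewrite rg // eq_sym (negbTE ki) mul0r.
  rewrite rg // eqxx mul1r root_eltE //.
  have -> : i == eI m = false by rewrite -val_eqE /=; move: im; lia.
  (* If i were c*, column c would already be trivial by [orth_row_delta], whereas the entry being
     cleared is nonzero. *)
  have -> : i == star c = false.
    apply: contraNF gc0 => /eqP ic; rewrite -[c]starK -ic.
    rewrite (orth_row_delta og (rg i ^~ im)) ic starK [_ == c]eq_sym (negbTE c1).
    by [].
  by rewrite /= !andbF subrr !mulr0 !addr0 mulr0 subr0.
move=> j jn j1 j2; rewrite mxE.
under eq_bigr => k _ do rewrite root_eltE // star_eI (negbTE j2) !andbF /=.
have -> : eI m == zI d = false by rewrite -val_eqE /=; have := ltn_ord m; lia.
under eq_bigr => k _ do rewrite /= !addr0 mulr0 !subr0 mulrDr.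
rewrite big_split /= (bigD1 j) //= big1 ?addr0 => [|k kj]; last first.
  by rewrite (negbTE kj) mulr0.
rewrite (bigD1 (eI m)) //= big1 ?addr0 => [|k km]; last first.
  by rewrite (negbTE km) !mulr0.
rewrite !eqxx dg mul1r mulr1 /=; have [jc|jc] := eqVneq j c.
  by rewrite jc mulr1 subrr.
rewrite mulr0 addr0; apply: zg => //; move: jc jn; rewrite -val_eqE /=; lia.
Qed.

(** [G] is left abstract so that one factorization serves for the Iwahori subgroup, for N and for
    N_0. *)
Lemma unitriangular_factor g : U g -> G g.
Proof.
suff main k m : (m + k = d)%N -> forall h, U h -> rows m h -> G h.
  by move=> Ug; apply: (main d 0%N).
elim: k m => [|k IHk] m md h Uh rh.
  by rewrite addn0 in md; rewrite md in rh; rewrite (rows_all Uh rh).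
have mlt : (m < d)%N by lia.
apply: (@factor_row (Ordinal mlt) (d + d + 1) h) => // [j|h' Uh' rh'].
  by rewrite subnn.
by apply: (IHk m.+1); rewrite ?addSnnS.
Qed.
End Factor.

Lemma iwahori_unipotent y : iwahori pp (facet y) `&` unipotent pp d =
  [set g | unitriangular g /\ in_order y g].
Proof.
apply/seteqP; split=> [g [/iwahori_sub[_ yg] /unipotent_unitriangular //]|g Ug].
split; apply: (unitriangular_factor _ _ _ Ug).
- exact: generated1.
- exact: generatedM.
- by move=> b c t bc hbc ht; apply/iwahori_root_elt.
- exact: generated1.
- exact: generatedM.
- move=> b c t bc hbc ht; apply: sub_generated; exists (rt b c).
    by apply/pos_roots_rt; exists b, c.
  by apply/root_groupP => //; exists t.
Qed.
End Factorization.

Section Index.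
Variables (F : fieldType) (n : nat).
Implicit Types (A H : set 'M[F]_n) (g h : 'M[F]_n).

Lemma has_index_reps A H (m : nat) (r : nat -> 'M[F]_n) : is_subgroup H ->
  (forall k, (k < m)%N -> A (r k)) ->
  (forall k, (k < m)%N -> r k \in unitmx) ->
  (forall g, A g -> exists2 k, (k < m)%N & H (invmx (r k) * g)) ->
  (forall k l, (k < m)%N -> (l < m)%N -> H (invmx (r k) * r l) -> k = l) ->
  has_index A H m.
Proof.
move=> [HU H1 HM HV] rA rU cover rinj.
have cosetE g k : (k < m)%N -> H (invmx (r k) * g) ->
    [set g * h | h in H] = [set r k * h | h in H].
  move=> km kg; have gE : g = r k * (invmx (r k) * g) := esym (mulKVmx (rU k km) g).
  move: kg gE; move: (invmx (r k) * g) => q qH gE.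
  have qV : q * invmx q = 1 := mulmxV (HU _ qH).
  apply/seteqP; split=> [_ [h hH <-]|_ [h hH <-]].
    by exists (q * h); [exact: HM|rewrite gE mulrA].
  exists (invmx q * h); first by apply: HM => //; apply: HV.
  by rewrite gE -mulrA [q * _]mulrA qV mul1r.
rewrite /has_index.
have -> : [set [set g * h | h in H] | g in A] = (fun k => [set r k * h | h in H]) @` `I_m.
  apply/seteqP; split=> [_ [g gA <-]|_ [k km <-]].
    by have [k km kg] := cover g gA; exists k => //; rewrite (cosetE g k).
  by exists (r k) => //; apply: rA.
apply: inj_card_eq => k l /set_mem km /set_mem lm E; apply: rinj => //.
have : [set r k * h | h in H] (r l) by rewrite E; exists 1; rewrite ?mulr1.
by move=> [h hH <-]; have -> : invmx (r k) * (r k * h) = h := mulKmx (rU k km) h.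
Qed.

(** Used for the uniqueness of the crossing root: at a wrong root the two groups would coincide and
    have index 1 instead of p. *)
Lemma has_index_self A (m : nat) : is_subgroup A -> has_index A A m -> m = 1%N.
Proof.
move=> [AU A1 AM AV]; rewrite /has_index.
have -> : [set [set g * h | h in A] | g in A] = [set A].
  apply/seteqP; split=> [_ [g gA <-]|_ ->] /=; last first.
    by exists 1 => //; apply/seteqP; split=> [_ [h hA <-]|h hA]; [rewrite mul1r|exists h; rewrite ?mul1r].
  apply/seteqP; split=> [_ [h hA <-]|h hA]; first exact: AM.
  exists (invmx g * h); first by apply: AM => //; apply: AV.
  exact: mulKVmx (AU _ gA) h.
by move=> A1m; apply/esym/card_eq_II; apply: card_eq_trans A1m; rewrite card_eq_sym card_set1.
Qed.
End Index.

(** * Crossing a wall *)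

Section Separation.
Variables (p : nat) (pp : prime p) (d : nat) (R : realType).
Local Notation K := (padic_num pp).
Local Notation I := 'I_(d + d + 1).
Local Notation mat := 'M[K]_(d + d + 1).
Implicit Types (g h : mat) (x t u : K) (b c i j : I) (y : apartment d R) (a : lattice d).

Lemma pairingN a y : pairing (- a) y = - pairing a y.
Proof. by rewrite -[- a]sub0r pairingB /pairing big1 ?sub0r // => i _; rewrite mxE mul0r. Qed.

(* The wall of [a + k] is the only one between [y] and [y']. *)
Definition separated y y' a (k : int) : Prop := [/\ roots a,
  0 < pairing a y + k%:~R, pairing a y' + k%:~R < 0 &
  forall a' (l : int), roots a' -> (a' = a -> l <> k) -> (a' = - a -> l <> - k) ->
    Num.sg (pairing a' y + l%:~R) = Num.sg (pairing a' y' + l%:~R)].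

Lemma roots_opp a : roots a -> roots (- a).
Proof.
move=> /roots_rt[b [c [bc ->]]]; apply/roots_rt; exists c, b.
by rewrite is_root_sym -rt_opp.
Qed.

Lemma separated_sym y y' a k : separated y y' a k -> separated y' y (- a) (- k).
Proof.
move=> [ra ya y'a H]; split; first exact: roots_opp.
- by rewrite pairingN rmorphN; lra.
- by rewrite pairingN rmorphN; lra.
- move=> a' l ra' h1 h2; symmetry; apply: H => // E.
  by rewrite -[k]opprK; apply: h2; rewrite opprK.
Qed.

Lemma boundE y b c (m : int) :
  (bound p y b c <= m%:~R) = (0 <= pairing (rt b c) y + (m - (shift p b c)%:Z)%:~R).
Proof. by rewrite pairing_rt /bound rmorphB /= -pmulrn; apply/idP/idP; lra. Qed.

Lemma bound_separated y y' a k b c x : separated y y' a k -> is_root b c ->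
  rt b c <> a -> rt b c <> - a -> vge x (bound p y b c) <-> vge x (bound p y' b c).
Proof.
move=> [_ _ _ H] bc n1 n2; apply: vge_eq => m.
rewrite !boundE -sgr_ge0 H ?sgr_ge0 //; apply/roots_rt; exists b, c; split => //.
Qed.

Lemma separated_level y y' a k (l : int) : separated y y' a k ->
  (0 <= pairing a y + l%:~R) = (k <= l) /\ (0 <= pairing a y' + l%:~R) = (k + 1 <= l).
Proof.
move=> [ra ya y'a H]; have [kl|lk|<-] := ltgtP k l; last first.
- by split; [apply: ltW|rewrite leNgt y'a; lia].
- have h : (l%:~R : R) <= k%:~R by rewrite ler_int ltW.
  have y'l : pairing a y' + l%:~R < 0 by lra.
  rewrite -sgr_ge0 H //; first by rewrite sgr_ge0 !leNgt y'l; split=> //; lia.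
    by lia.
  by move=> E; exfalso; have := pairingN a y; have := pairingN a y'; rewrite -E; lra.
- have h : (k%:~R : R) <= l%:~R by rewrite ler_int ltW.
  have yl : 0 < pairing a y + l%:~R by lra.
  rewrite -[in X in _ /\ X]sgr_ge0 -H //; first by rewrite sgr_ge0 !(ltW yl); split=> //; lia.
    by lia.
  by move=> E; exfalso; have := pairingN a y; have := pairingN a y'; rewrite -E; lra.
Qed.

Lemma bound_separated_pos y y' b c k x : separated y y' (rt b c) k ->
  vge x (bound p y b c) <-> vge x ((k + (shift p b c)%:Z)%:~R : R).
Proof.
move=> sep; apply: vge_eq => m; rewrite boundE ler_int (separated_level _ sep).1; lia.
Qed.

Lemma bound_separated_neg y y' b c k x : separated y y' (rt b c) k ->
  vge x (bound p y' b c) <-> vge x ((k + (shift p b c)%:Z + 1)%:~R : R).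
Proof.
move=> sep; apply: vge_eq => m; rewrite boundE ler_int (separated_level _ sep).2; lia.
Qed.

Lemma root_elt_entry b c t : is_root b c -> root_elt b c t b c = t.
Proof.
move=> bc; have bn : b != star c by move: bc; rewrite -is_root_sym => /andP[].
have [cb nb] := andP bc; rewrite root_eltE // (negbTE cb) !eqxx (negbTE bn) /=.
rewrite eq_sym in nb; rewrite [c == star b]eq_sym (negbTE nb) !andbF.
by rewrite add0r subr0 mulr1 addr0 mulr0 subr0.
Qed.

(** A coset is recognised by the leading digit of its entry (b, c), and the root elements of
    parameters p^m n, n < p, represent the cosets. Additivity is asked only modulo p^(m + 1), so
    that the criterion covers both a single root subgroup and the whole unipotent part. *)
Lemma has_index_entry (A H : set mat) b c (m : int) : is_root b c ->
  is_subgroup A -> is_subgroup H ->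
  (forall g, H g <-> A g /\ vge (g b c) ((m + 1)%:~R : R)) ->
  (forall g, A g -> vge (g b c) (m%:~R : R)) ->
  (forall g h, A g -> A h -> vge ((g *m h) b c - (g b c + h b c)) ((m + 1)%:~R : R)) ->
  (forall t, vge t (m%:~R : R) -> A (root_elt b c t)) -> has_index A H p.
Proof.
move=> bc sA sH HE Am Aadd Ax; have [_ _ AM AV] := sA.
have xA (n : nat) : A (root_elt b c (p%:R ^ m * n%:R)).
  by apply: Ax; rewrite -[m%:~R]addr0; apply/vgeMp; exact: vge_nat.
have entry n g : A g -> vge ((invmx (root_elt b c (p%:R ^ m * n%:R)) * g) b c
    - (g b c - p%:R ^ m * n%:R)) ((m + 1)%:~R : R).
  move=> Ag; have := Aadd _ _ (AV _ (xA n)) Ag.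
  by rewrite root_elt_inv // root_elt_entry // [- _ + _]addrC.
apply: (has_index_reps sH (r := fun n => root_elt b c (p%:R ^ m * n%:R))) => //.
- by move=> k _; apply/orth_unit/root_elt_orth.
- move=> g Ag; have [k kp hk] := vge_digit (Am g Ag).
  exists k => //; apply/HE; split; first by apply: AM => //; apply: AV.
  by have := vgeD (entry k g Ag) hk; rewrite subrK.
- move=> k l kp lp /HE[_ hkl].
  have := vgeD (vgeN (entry k _ (xA l))) hkl.
  rewrite root_elt_entry // opprB subrK => /(vge_digit_inj lp kp); exact: esym.
Qed.

Lemma root_part_index y y' b c k : is_root b c -> separated y y' (rt b c) k ->
  root_part y' b c `<=` (root_part y b c : set mat) /\
  has_index (root_part y b c : set mat) (root_part y' b c) p.
Proof.
move=> bc sep; have P := bound_separated_pos _ sep; have N := bound_separated_neg _ sep.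
have le1 : ((k + (shift p b c)%:Z)%:~R : R) <= (k + (shift p b c)%:Z + 1)%:~R.
  by rewrite ler_int lerDl.
have sub : root_part y' b c `<=` (root_part y b c : set mat).
  by move=> _ [t ht <-]; exists t => //; apply/P; apply: vgeW le1 _; apply/N.
split=> //; apply: (has_index_entry (m := k + (shift p b c)%:Z) bc).
- exact: root_part_subgroup.
- exact: root_part_subgroup.
- move=> g; split=> [gH|[[t ht <-]]].
    split; first exact: sub.
    by have [t ht <-] := gH; rewrite root_elt_entry //; apply/N.
  by rewrite root_elt_entry // => h; exists t => //; apply/N.
- by move=> _ [t ht <-]; rewrite root_elt_entry //; apply/P.
- move=> _ _ [t ht <-] [u hu <-]; rewrite (root_eltD _ _ bc).
  have gen (x1 x2 x3 : K) r : x1 = t + u -> x2 = t -> x3 = u -> vge (x1 - (x2 + x3)) (r : R).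
    by move=> -> -> ->; rewrite (subrr (t + u)); apply: vge0.
  by apply: gen; apply: root_elt_entry.
- by move=> t ht; exists t => //; apply/P.
Qed.

Definition unip_part y : set mat := [set g | unitriangular g /\ in_order y g].

Lemma unip_part_subgroup y : is_subgroup (unip_part y).
Proof.
have E : unip_part y = @unitriangular p pp d `&` parahoric y.
  by apply/seteqP; split=> [g [Ug yg]|g [Ug [_ yg]]]; split=> //; split=> //; case: Ug.
by rewrite E; apply: subgroupI; [exact: unitriangular_subgroup|exact: parahoric_subgroup].
Qed.

Section FirstRow.
Variables (b c : I) (y y' : apartment d R) (k : int).
Hypotheses (d0 : (0 < d)%N) (bc : is_root b c) (hb : height b = 0%N).
Hypothesis sep : separated y y' (rt b c) k.

Let m : int := k + (shift p b c)%:Z.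

Let hsb : height (star b) = (d + d)%N.
Proof. by rewrite height_star hb subn0. Qed.

Let bound_eq i j x : is_root i j -> ~ [/\ i = b & j = c] -> ~ [/\ i = star c & j = star b] ->
  ~ [/\ i = c & j = b] -> ~ [/\ i = star b & j = star c] ->
  vge x (bound p y i j) <-> vge x (bound p y' i j).
Proof.
move=> ij n1 n2 n3 n4; apply: (bound_separated x sep ij).
- by move=> /(rt_inj bc)[[]|[]] *; [apply: n1|apply: n2].
- rewrite -rt_opp => E; have cb : is_root c b by rewrite is_root_sym.
  by have [[]|[]] := rt_inj cb E => *; [apply: n3|apply: n4].
Qed.

Let bound_imp i j x : vge x (bound p y i j) -> is_root i j ->
  ~ [/\ i = b & j = c] -> ~ [/\ i = star c & j = star b] ->
  ~ [/\ i = c & j = b] -> ~ [/\ i = star b & j = star c] -> vge x (bound p y' i j).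
Proof. by move=> h ij *; apply/bound_eq. Qed.

Let bn : b != star c.
Proof. by move: bc; rewrite -is_root_sym => /andP[]. Qed.

Let bz : b != zI d.
Proof. by apply: contraTneq d0 => bz; move: hb; rewrite bz height_zI => ->. Qed.

Let bsb : b != star b.
Proof. by rewrite eq_sym star_fixed. Qed.

Let minb i : i != b -> (height b < height i)%N.
Proof. by move=> ib; rewrite hb lt0n -hb; apply: contraNneq ib => /height_inj ->. Qed.

Let maxb i : i != star b -> (height i < height (star b))%N.
Proof.
move=> ib; rewrite hsb ltn_neqAle height_le andbT -hsb.
by apply: contraNneq ib => /height_inj ->.
Qed.

(** The position (c*, c) belongs to no root, so the comparison of affine roots says nothing about
    it. Isotropy of row c* reduces it to entries not affected by the wall; the products involving
    column b vanish, b having the least height. *)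
Lemma unip_part_star g : unip_part y g -> c != zI d -> vge (g (star c) c) (bound p y' (star c) c).
Proof.
move=> [Ug yg] cz; have [og tg dg] := Ug; have [cb csb] := andP bc.
have [h|h] := ltnP (height (star c)) (height c); last first.
  move: h; rewrite leq_eqVlt => /orP[/eqP/height_inj E|h].
    by move: cz; rewrite -star_fixed -E eqxx.
  by rewrite tg //; apply: vge0.
have scz : star c != zI d by rewrite (can2_eq starK starK) star_zI.
have := @in_order_star p pp d R y' g (star c) Ug; rewrite starK; apply=> //.
  apply: (bound_imp (yg _ _)).
  - by rewrite /is_root starK scz /= eq_sym.
  - by case=> E _; move: bn; rewrite -E eqxx.
  - by case=> _ /esym/(canRL starK) E; move: bz; rewrite E star_zI eqxx.
  - by case=> _ E; move: bz; rewrite -E eqxx.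
  - by case=> _ E; rewrite -star_zI in E; move/(can_inj starK): E cz => ->; rewrite eqxx.
move=> i isc ic iz.
have [->|ib] := eqVneq i b; first by rewrite tg ?mul0r ?minb 1?eq_sym //; apply: vge0.
have [->|isb] := eqVneq i (star b).
  by rewrite starK [X in _ * X]tg ?mulr0 ?minb 1?eq_sym //; apply: vge0.
have key j : j != star c -> j != c -> j != b -> j != star b ->
    vge (g (star c) j) (bound p y' (star c) j).
  move=> j1 j2 j3 j4; apply: (bound_imp (yg _ _)).
  - by rewrite /is_root starK eq_sym j1.
  - by case=> _ E; rewrite E eqxx in j2.
  - by case=> _ E; rewrite E eqxx in j4.
  - by case=> _ E; rewrite E eqxx in j3.
  - by case=> _ E; rewrite E eqxx in j1.
apply: vgeM; apply: key => //.
- by rewrite (can_eq starK).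
- by rewrite (can2_eq starK starK).
- by rewrite (can2_eq starK starK).
- by rewrite (can_eq starK).
Qed.

(** The bound of y' at (b, c) is m + 1. In the sum for (gh)_bc, the indices b and c give the two
    entries, the index b* gives 0 because it has the greatest height, and for any other index both
    factors satisfy the bounds of y', the case of c* being [unip_part_star]. *)
Lemma unip_part_entryM g h : unip_part y g -> unip_part y h ->
  vge ((g *m h) b c - (g b c + h b c)) ((m + 1)%:~R : R).
Proof.
move=> Ag Ah; have [[og tg dg] yg] := Ag; have [[oh th dh] yh] := Ah.
have [cb csb] := andP bc.
rewrite mxE (bigD1 b) //= (bigD1 c) 1?eq_sym //= dg dh mul1r mulr1.
rewrite addrA [h b c + _]addrC addrAC subrr add0r.
apply: vge_sum => i /andP[ib ic]; apply/(bound_separated_neg _ sep).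
have [->|isb] := eqVneq i (star b).
  by rewrite th ?mulr0 ?maxb //; apply: vge0.
apply: vgeW (bound_triangle p y' b c i) _; apply: vgeM.
  apply: (bound_imp (yg _ _)).
  - by rewrite /is_root eq_sym ib.
  - by case=> _ E; rewrite E eqxx in ic.
  - by case=> E _; move: bn; rewrite -E eqxx.
  - by case=> E _; rewrite E eqxx in cb.
  - by case=> E _; move: bsb; rewrite -E eqxx.
have [isc|isc] := eqVneq i (star c).
  rewrite isc; apply: unip_part_star => //; apply: contraNneq ic => cz.
  by rewrite isc cz star_zI.
apply: (bound_imp (yh _ _)).
- by rewrite /is_root ic /= eq_sym (can2_eq starK starK).
- by case=> E _; rewrite E eqxx in ib.
- by case=> _ E; rewrite E eqxx in csb.
- by case=> E _; rewrite E eqxx in ic.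
- by case=> E _; rewrite E eqxx in isb.
Qed.

Lemma unip_part_index :
  unip_part y' `<=` unip_part y /\ has_index (unip_part y) (unip_part y') p.
Proof.
have P := bound_separated_pos _ sep; have N := bound_separated_neg _ sep.
have le1 : (m%:~R : R) <= (m + 1)%:~R by rewrite ler_int lerDl.
have sA := unip_part_subgroup; have hbc : (height b < height c)%N.
  by apply: minb; rewrite eq_sym; case/andP: bc.
have HE g : unip_part y' g <-> unip_part y g /\ vge (g b c) ((m + 1)%:~R : R).
  have posE i j : is_root i j -> (height i < height j)%N ->
      (i = b /\ j = c) \/ (i = star c /\ j = star b) \/
      (forall x, vge x (bound p y i j) <-> vge x (bound p y' i j)).
    move=> ij hij; have [/andP[/eqP -> /eqP ->]|n1] := boolP ((i == b) && (j == c)); first by left.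
    right; have [/andP[/eqP -> /eqP ->]|n2] := boolP ((i == star c) && (j == star b)); first by left.
    right=> x; apply: bound_eq => //.
    - by case=> E E'; rewrite E E' !eqxx in n1.
    - by case=> E E'; rewrite E E' !eqxx in n2.
    - by case=> E E'; move: hij; rewrite E E' hb.
    - by case=> E E'; move: hij; rewrite E E' height_starW hb.
  split=> [[Ug yg]|[Ag gbc]].
    split; last exact/N.
    split=> //; apply: in_order_roots => // i j ij hij.
    have [[-> ->]|[[-> ->]|E]] := posE i j ij hij; last exact/E.
    - by apply/P; apply: vgeW le1 _; apply/N.
    - by rewrite bound_star; apply/P; apply: vgeW le1 _; apply/N; rewrite -bound_star.
  have [Ug yg] := Ag; split=> //; apply: in_order_roots => // i j ij hij.
  have [[-> ->]|[[-> ->]|E]] := posE i j ij hij; [exact/N| |exact/E].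
  rewrite bound_star; apply/N; have [_ _ _ AV] := sA y; have [og _ _] := Ug.
  (* Applied to g and its inverse, additivity gives g_bc + g_c*b* = 0 modulo p^(m + 1), because the
     inverse is the adjoint; the second position of the root is thereby controlled by the first. *)
  have := unip_part_entryM Ag (AV _ Ag).
  rewrite mulmxV ?orth_unit // orth_inv // !mxE.
  have [cb _] := andP bc; rewrite (negbTE cb) sub0r => /vgeN; rewrite opprK => h.
  by have := vgeD h (vgeN gbc); rewrite addrAC subrr add0r.
split=> [g /HE[] //|]; apply: (has_index_entry (m := m) bc) => //.
- by move=> g [_ yg]; apply/P.
- exact: unip_part_entryM.
- by move=> t ht; split; [apply: root_elt_unitriangular|apply/in_order_root_elt => //; apply/P].
Qed.
End FirstRow.
End Separation.

(** * The panel between two separated points *)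

Section Segment.
Variables (p : nat) (pp : prime p) (d : nat) (R : realType).
Implicit Types (y z : apartment d R) (a : lattice d).

Definition generic y := forall a k, roots a -> ~ wall a k y.

Definition segment y y' (s : R) : apartment d R := y + s *: (y' - y).

Lemma pairing_segment a y y' s k :
  pairing a (segment y y' s) + k = (1 - s) * (pairing a y + k) + s * (pairing a y' + k).
Proof.
have -> : pairing a (segment y y' s) = (1 - s) * pairing a y + s * pairing a y'.
  rewrite /pairing !mulr_sumr -big_split; apply: eq_bigr => i _ /=; rewrite !mxE; ring.
ring.
Qed.

Lemma sgr_convex (u v s : R) : 0 <= s <= 1 -> u != 0 -> Num.sg u = Num.sg v ->
  Num.sg ((1 - s) * u + s * v) = Num.sg u.
Proof.
move=> /andP[s0 s1] u0 uv; case: (ltgtP u 0) u0 => // hu _.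
  have hv : v < 0 by rewrite -sgr_lt0 -uv sgr_lt0.
  by rewrite [RHS]ltr0_sg // ltr0_sg //; nra.
have hv : 0 < v by rewrite -sgr_gt0 -uv sgr_gt0.
by rewrite [RHS]gtr0_sg // gtr0_sg //; nra.
Qed.

Section Crossing.
Variables (y y' : apartment d R) (a : lattice d) (k : int).
Hypotheses (gy : generic y) (sep : separated y y' a k).

Let u := pairing a y + k%:~R.
Let v := pairing a y' + k%:~R.
Let u0 : 0 < u. Proof. by case: sep. Qed.
Let v0 : v < 0. Proof. by case: sep. Qed.

(* The parameter at which the segment from [y] to [y'] meets the wall. *)
Definition crossing : R := u / (u - v).

Let uv : 0 < u - v.
Proof. by rewrite subr_gt0 (lt_trans v0 u0). Qed.

Let c01 : 0 < crossing < 1.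
Proof.
by rewrite /crossing divr_gt0 //= ltr_pdivrMr // mul1r ltrDl oppr_gt0.
Qed.

Let crossingE : (1 - crossing) * u + crossing * v = 0.
Proof. by rewrite /crossing; field; rewrite gt_eqF. Qed.

Lemma generic_neq0 a' (l : int) : roots a' -> pairing a' y + l%:~R != 0.
Proof. by move=> ra'; apply/eqP => E; apply: (gy ra' E). Qed.

Lemma wall_segment a' l (s : R) : 0 <= s <= 1 -> roots a' ->
  (a' = a -> l <> k) -> (a' = - a -> l <> - k) ->
  Num.sg (pairing a' (segment y y' s) + l%:~R) = Num.sg (pairing a' y + l%:~R).
Proof.
move=> s01 ra' h1 h2; rewrite pairing_segment; apply: sgr_convex => //.
  exact: generic_neq0.
by case: sep => _ _ _; apply.
Qed.

Lemma segment_facet (s : R) : 0 <= s -> s < crossing -> facet y (segment y y' s).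
Proof.
move=> s0 sc a' l ra'; have /andP[c0 c1] := c01.
have s01 : 0 <= s <= 1 by rewrite s0; lra.
have pos : 0 < pairing a (segment y y' s) + k%:~R.
  rewrite pairing_segment -/u -/v -crossingE -subr_gt0.
  have -> : (1 - s) * u + s * v - ((1 - crossing) * u + crossing * v) = (crossing - s) * (u - v).
    by ring.
  by apply: mulr_gt0 => //; rewrite subr_gt0.
have [/andP[/eqP -> /eqP ->]|n1] := boolP ((a' == a) && (l == k)).
  by rewrite !gtr0_sg.
have [/andP[/eqP -> /eqP ->]|n2] := boolP ((a' == - a) && (l == - k)).
  by rewrite !pairingN !rmorphN -!opprD !sgrN !gtr0_sg.
apply: wall_segment => // [E E'|E E'].
  by rewrite E E' !eqxx in n1.
by rewrite E E' !eqxx in n2.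
Qed.

Lemma crossing_panel : in_panel (segment y y' crossing).
Proof.
have [ra _ _ _] := sep; have /andP[c0 c1] := c01.
exists a, k; split=> // [|b l rb wb].
  by rewrite /wall /= pairing_segment -/u -/v crossingE.
have [/andP[/eqP -> /eqP ->]//|n1] := boolP ((b == a) && (l == k)).
have [/andP[/eqP -> /eqP ->]|n2] := boolP ((b == - a) && (l == - k)).
  apply/seteqP; rewrite /wall /=; split=> z /=; rewrite pairingN rmorphN /=; lra.
exfalso; have /eqP := wb; rewrite -sgr_eq0 wall_segment ?sgr_eq0 //.
- by rewrite (negbTE (generic_neq0 _ rb)).
- by rewrite !ltW.
- by move=> E E'; rewrite E E' !eqxx in n1.
- by move=> E E'; rewrite E E' !eqxx in n2.
Qed.

Lemma crossing_closure : closure (facet y) (segment y y' crossing).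
Proof.
have /andP[c0 c1] := c01.
move=> B /nbhs_ballP[e /= e0 He].
(* [M] dominates the coordinates of y' - y, the added 1 keeping it positive; stepping back by t with
   t M < e, the factor 2 giving strictness, stays in the ball. *)
pose M := \sum_i `|(y' - y) 0 i| + 1.
have M0 : 0 < M by rewrite ltr_wpDl // sumr_ge0.
pose t := Num.min crossing (e / M / 2).
have t0 : 0 < t by rewrite lt_min c0 !divr_gt0.
have tc : t <= crossing by rewrite ge_min lexx.
have te : t * M < e.
  have : t <= e / M / 2 by rewrite ge_min lexx orbT.
  by rewrite -(ler_pM2r M0) => h; apply: le_lt_trans h _; rewrite mulrAC divfK ?gt_eqF //; lra.
exists (segment y y' (crossing - t)); split; first by apply: segment_facet; lra.
apply: He; split=> // i j; rewrite /ball /= ord1 /segment !mxE.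
have -> : y 0 j + crossing * (y' 0 j - y 0 j) - (y 0 j + (crossing - t) * (y' 0 j - y 0 j))
   = t * (y' 0 j - y 0 j) by ring.
rewrite normrM gtr0_norm //; apply: le_lt_trans te.
rewrite ler_pM2l // /M (bigD1 j) //= !mxE -addrA lerDl addr_ge0 // sumr_ge0 //.
Qed.
End Crossing.

Lemma segment_sym y y' s : segment y y' s = segment y' y (1 - s).
Proof. by apply/rowP => i; rewrite !mxE; ring. Qed.

(** Traversing the segment backwards meets the wall at the same point, so that [crossing_closure]
    also yields the closure of the second chamber. *)
Lemma crossing_sym y y' a k : separated y y' a k ->
  crossing y' y (- a) (- k) = 1 - crossing y y' a k.
Proof.
move=> [_ h1 h2 _]; rewrite /crossing !pairingN rmorphN /=.
have uv : (pairing a y + k%:~R) - (pairing a y' + k%:~R) != 0 by rewrite gt_eqF //; lra.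
rewrite -!opprD; move: (pairing a y + _) (pairing a y' + _) uv => u v uv.
by rewrite opprB -(divff uv) -mulrBl; congr (_ / _); ring.
Qed.

Lemma separated_adjacent y y' a k : generic y -> generic y' -> separated y y' a k ->
  adjacent (facet y) (facet y').
Proof.
move=> gy gy' sep; split; [by exists y|by exists y'| |].
  move=> E; have : facet y y' by rewrite E.
  have [ra h1 h2 _] := sep => /(_ a k ra); rewrite (gtr0_sg h1) (ltr0_sg h2) => /eqP.
  by rewrite eqr_oppLR -subr_eq0 => /eqP; lra.
exists (segment y y' (crossing y y' a k)); first exact: crossing_panel.
split; first exact: crossing_closure.
rewrite segment_sym -(crossing_sym sep); apply: crossing_closure => //.
exact: separated_sym.
Qed.

Lemma separated_crossing_root y y' a k : generic y -> generic y' -> separated y y' a k ->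
  crossing_root pp (facet y) (facet y') a /\
  forall delta, crossing_root pp (facet y) (facet y') delta -> delta = a.
Proof.
move=> gy gy' sep; have [ra _ _ _] := sep.
have [b [c [bc aE]]] := (roots_rt a).1 ra.
have opp : - a = rt c b by rewrite rt_opp aE.
have cb : is_root c b by rewrite is_root_sym.
have sep' := separated_sym sep; rewrite opp in sep'.
rewrite aE in sep; have [sub ind] := root_part_index pp bc sep.
have [sub' ind'] := root_part_index pp cb sep'.
have rel a' : roots a' -> a' <> a -> a' <> - a ->
    iwahori pp (facet y) `&` root_group pp a' = iwahori pp (facet y') `&` root_group pp a'.
  move=> /roots_rt[i [j [ij ->]]] n1 n2; rewrite !iwahori_root_group //.
  rewrite aE in n1 n2.
  by apply/seteqP; split=> _ [t ht <-]; exists t => //; apply/(bound_separated _ sep).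
have main : crossing_root pp (facet y) (facet y') a.
  split=> //; first by apply: (separated_adjacent gy gy' sep); rewrite -?aE.
    rewrite opp !(iwahori_root_group _ _ cb); exact: (conj sub' ind').
  rewrite aE !(iwahori_root_group _ _ bc); exact: (conj sub ind).
split=> // delta [_ rd _ [_ i2] [s1 i1]]; apply: contrapT => nd.
have p1 := prime_gt1 pp.
have [dE|nd'] := pselect (delta = - a); last first.
  have [i [j [ij dE]]] := (roots_rt delta).1 rd.
  rewrite (rel _ rd nd nd') dE (iwahori_root_group _ _ ij) in i1.
  by have := has_index_self (root_part_subgroup pp y' ij) i1 => E; rewrite E in p1.
(* For - a the required inclusion is the reverse of [sub']: both parts are then equal, which
   contradicts the index p. *)
rewrite dE opp !(iwahori_root_group _ _ cb) in s1 i1.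
have E : (root_part y c b : set 'M[padic_num pp]_(d + d + 1)) = root_part y' c b.
  by apply/seteqP.
rewrite E in i1.
by have := has_index_self (root_part_subgroup pp y' cb) i1 => E'; rewrite E' in p1.
Qed.
End Segment.

(** * Monomial isometries and the gallery *)

(* A monomial isometry, described by its rows: row [i] has its nonzero entry,
   equal up to sign to [p ^ expo i], in column [col i]. *)
Record monomial (d : nat) := Monomial {
  col : 'I_(d + d + 1) -> 'I_(d + d + 1);
  expo : 'I_(d + d + 1) -> int;
  neg : 'I_(d + d + 1) -> bool;
  col_star : forall i, col (star i) = star (col i);
  expo_star : forall i, expo (star i) = - expo i;
  neg_star : forall i, neg (star i) = neg i;
  col_inj : injective col }.

Section Monomial.
Variables (p : nat) (pp : prime p) (d : nat) (R : realType).
Local Notation K := (padic_num pp).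
Local Notation I := 'I_(d + d + 1).
Local Notation mat := 'M[K]_(d + d + 1).
Implicit Types (i j b c : I) (w : monomial d) (y z : apartment d R).

Definition monomial_matrix w : mat :=
  \matrix_(i, j) if j == col w i then (-1) ^+ neg w i * p%:R ^ expo w i else 0.

Definition monomial_one : monomial d.
Proof. by refine (@Monomial d id (fun=> 0) (fun=> false) _ _ _ _) => // i j. Defined.

(** Rows are followed from left to right, so columns compose in the order opposite to that of the
    usual notation: a new right factor of the gallery acts last on the image of a fixed row. *)
Definition monomial_mul w1 w2 : monomial d.
Proof.
refine (@Monomial d (col w2 \o col w1) (fun i => expo w1 i + expo w2 (col w1 i))
  (fun i => neg w1 i (+) neg w2 (col w1 i)) _ _ _ _).
- by move=> i; rewrite /= !col_star.
- by move=> i; rewrite !expo_star col_star expo_star opprD.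
- by move=> i; rewrite neg_star col_star neg_star.
- by apply: inj_comp; exact: col_inj.
Defined.

Lemma monomial_matrix1 : monomial_matrix monomial_one = 1.
Proof.
by apply/matrixP => i j; rewrite !mxE /= expr0z mul1r eq_sym; case: (i == j).
Qed.

Lemma monomial_matrixM w1 w2 :
  monomial_matrix w1 * monomial_matrix w2 = monomial_matrix (monomial_mul w1 w2).
Proof.
apply/matrixP => i j; rewrite mxE (bigD1 (col w1 i)) //= big1 ?addr0 => [|k ki].
  rewrite !mxE eqxx /=; case: eqP => _; rewrite ?mulr0 //.
  by rewrite signr_addb expfzDr ?padic_p_neq0 // mulrACA.
by rewrite mxE (negbTE ki) mul0r.
Qed.

Lemma orth_monomial w : orth (monomial_matrix w).
Proof.
apply/matrixP => i j; rewrite mxE (bigD1 (col w i)) //= big1 ?addr0 => [|k ki]; last first.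
  by rewrite [X in X * _]mxE (negbTE ki) mul0r.
rewrite !mxE eqxx col_star (can_eq starK) (inj_eq (@col_inj _ w)).
case: eqP => [->|_]; rewrite ?mulr0 //.
rewrite neg_star expo_star mulrACA -expr2 sqrr_sign mul1r -expfzDr ?padic_p_neq0 //.
by rewrite subrr expr0z.
Qed.

Lemma padic_val_unit (k : int) (u : padic_int pp) : u \is a GRing.unit ->
  padic_val (p%:R ^ k * u%:F) = k.
Proof.
move=> uu; pose P l := exists2 v : padic_int pp,
  v \is a GRing.unit & p%:R ^ k * u%:F = p%:R ^ l * v%:F.
have [v uv E] : P (xget 0 P) by apply: xgetPex; exists k, u.
rewrite /padic_val -/P; move: (xget 0 P) E => l E.
have := vge_unit k (k%:~R : R) uu; rewrite E vge_unit // lexx ler_int => -[_ /(_ isT) kl].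
have := vge_unit l (l%:~R : R) uv; rewrite -E vge_unit // lexx ler_int => -[_ /(_ isT) lk].
by apply/eqP; rewrite eq_le lk kl.
Qed.

Lemma padic_val_sign (b : bool) (k : int) : padic_val ((-1) ^+ b * p%:R ^ k : K) = k.
Proof.
have -> : (-1) ^+ b * p%:R ^ k = p%:R ^ k * ((-1) ^+ b : padic_int pp)%:F :> K.
  by rewrite tofracXn tofracN tofrac1 mulrC.
by apply: padic_val_unit; rewrite unitrX // unitrN unitr1.
Qed.

Lemma monomial_entry_neq0 w i : (-1) ^+ neg w i * p%:R ^ expo w i != 0 :> K.
Proof. by rewrite mulf_neq0 ?signr_eq0 ?expfz_neq0 ?padic_p_neq0. Qed.

Lemma ext_coord_ext (F : I -> R) : (forall i, F (star i) = - F i) ->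
  forall b, ext_coord (\row_(i < d) F (eI i)) b = F b.
Proof.
move=> FS b; case: b / (indexP b) => [i|i|].
- by rewrite ext_coord_eI mxE.
- by rewrite ext_coord_fI mxE -FS star_eI.
- rewrite ext_coord_zI; have := FS (zI d); rewrite star_zI => E.
  by apply/eqP; rewrite eq_sym; apply/eqP; lra.
Qed.

Lemma ext_coord_inj y z : ext_coord y =1 ext_coord z -> y = z.
Proof. by move=> E; apply/rowP => i; rewrite -!ext_coord_eI E. Qed.

Lemma ext_coord_act w y b :
  ext_coord (act (monomial_matrix w) y) b = ext_coord y (col w b) - (expo w b)%:~R.
Proof.
have -> : act (monomial_matrix w) y =
    \row_(i < d) (ext_coord y (col w (eI i)) - (expo w (eI i))%:~R).
  apply/rowP => i; rewrite !mxE (big_pred1 (col w (eI i))) => [|b'].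
    by rewrite mxE eqxx padic_val_sign.
  rewrite mxE -/(eI i) /=; have [_|_] := eqVneq b' (col w (eI i)); rewrite ?eqxx //.
  exact: monomial_entry_neq0.
apply: (@ext_coord_ext (fun i => ext_coord y (col w i) - (expo w i)%:~R)) => i.
by rewrite col_star ext_coord_star expo_star rmorphN opprB opprK addrC.
Qed.

Lemma act_mul w1 w2 y : act (monomial_matrix (monomial_mul w1 w2)) y =
  act (monomial_matrix w1) (act (monomial_matrix w2) y).
Proof.
apply: ext_coord_inj => b; rewrite !ext_coord_act /= rmorphD; ring.
Qed.

Lemma is_root_col w b c : is_root (col w b) (col w c) = is_root b c.
Proof. by rewrite /is_root -col_star !(inj_eq (@col_inj _ w)). Qed.

Lemma pairing_act w y b c (k : int) :
  pairing (rt b c) (act (monomial_matrix w) y) + k%:~R =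
  pairing (rt (col w b) (col w c)) y + (k - expo w b + expo w c)%:~R.
Proof. by rewrite !pairing_rt !ext_coord_act rmorphD rmorphB; ring. Qed.

Lemma generic_act w y : generic y -> generic (act (monomial_matrix w) y).
Proof.
move=> gy a k /roots_rt[b [c [bc ->]]]; rewrite /wall /= pairing_act => E.
by apply: (gy _ _ _ E); apply/roots_rt; exists (col w b), (col w c); rewrite is_root_col.
Qed.

Lemma act_surj w y : exists z, act (monomial_matrix w) z = y.
Proof.
pose g := invF (@col_inj _ w); have gK := f_invF (@col_inj _ w).
have gS i : g (star i) = star (g i).
  by apply: (@col_inj _ w); rewrite col_star !gK.
pose F i : R := ext_coord y (g i) + (expo w (g i))%:~R.
have FS i : F (star i) = - F i.
  by rewrite /F gS ext_coord_star expo_star rmorphN opprD.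
exists (\row_(i < d) F (eI i)); apply: ext_coord_inj => b.
by rewrite ext_coord_act ext_coord_ext // /F /g invF_f addrK.
Qed.

Lemma facet_act w y : act (monomial_matrix w) @` facet y = facet (act (monomial_matrix w) y).
Proof.
apply/seteqP; split=> [_ [z yz <-] a k /roots_rt[b [c [bc ->]]]|z yz].
  by rewrite !pairing_act; apply: yz; apply/roots_rt; exists (col w b), (col w c); rewrite is_root_col.
have [z' zE] := act_surj w z; exists z' => // a k /roots_rt[b [c [bc ->]]].
have [b' bE] : exists b', b = col w b' by exists (invF (@col_inj _ w) b); rewrite f_invF.
have [c' cE] : exists c', c = col w c' by exists (invF (@col_inj _ w) c); rewrite f_invF.
rewrite bE cE is_root_col in bc *.
have := yz (rt b' c') (k + expo w b' - expo w c'); rewrite -zE !pairing_act.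
rewrite (_ : k + expo w b' - expo w c' - expo w b' + expo w c' = k); last by ring.
by apply; apply/roots_rt; exists b', c'.
Qed.

Lemma separated_act w y z b c k : is_root b c ->
  separated y z (rt (col w b) (col w c)) k ->
  separated (act (monomial_matrix w) y) (act (monomial_matrix w) z) (rt b c)
    (k + expo w b - expo w c).
Proof.
move=> bc [_ h1 h2 H].
have kE : k + expo w b - expo w c - expo w b + expo w c = k by ring.
split; rewrite ?pairing_act ?kE //; first by apply/roots_rt; exists b, c.
move=> _ l /roots_rt[i [j [ij ->]]] n1 n2; rewrite !pairing_act; apply: H.
- by apply/roots_rt; exists (col w i), (col w j); rewrite is_root_col.
- have cbc : is_root (col w b) (col w c) by rewrite is_root_col.
  move=> /(rt_inj cbc); rewrite -!col_star.
  case=> [[/col_inj iE /col_inj jE]|[/col_inj iE /col_inj jE]].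
    by have := n1 (congr2 _ iE jE); rewrite iE jE; lia.
  by have := n1; rewrite iE jE rt_star !expo_star => /(_ erefl); lia.
- have cbc : is_root (col w c) (col w b) by rewrite is_root_col is_root_sym.
  rewrite -rt_opp => /(rt_inj cbc); rewrite -!col_star.
  case=> [[/col_inj iE /col_inj jE]|[/col_inj iE /col_inj jE]].
    by have := n2; rewrite iE jE rt_opp => /(_ erefl); lia.
  by have := n2; rewrite iE jE rt_star rt_opp !expo_star => /(_ erefl); lia.
Qed.
End Monomial.

Section NatMonomial.
Variables (p : nat) (pp : prime p) (d : nat).
Local Notation K := (padic_num pp).
Local Notation I := 'I_(d + d + 1).
Variables (s : nat -> nat) (v : nat -> int) (e : nat -> bool).
Hypothesis s_lt : forall n, (n < d + d + 1)%N -> (s n < d + d + 1)%N.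
Hypothesis sK : involutive s.
Hypothesis s_star : forall n, (n < d + d + 1)%N -> s (star_nat d n) = star_nat d (s n).
Hypothesis v_star : forall n, (n < d + d + 1)%N -> v (star_nat d n) = - v n.
Hypothesis e_star : forall n, (n < d + d + 1)%N -> e (star_nat d n) = e n.

Definition nat_monomial : monomial d.
Proof.
refine (@Monomial d (fun i : I => Ordinal (s_lt (ltn_ord i))) (fun i : I => v i)
  (fun i : I => e i) _ _ _ _).
- by move=> i; apply: val_inj; exact: (s_star (ltn_ord i)).
- by move=> i; exact: (v_star (ltn_ord i)).
- by move=> i; exact: (e_star (ltn_ord i)).
- by move=> i j /(congr1 val) /= /(can_inj sK) ij; apply: val_inj.
Defined.

(** [monomial_mx] describes columns and [monomial_matrix] rows; as s is an involution, row n has its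
    entry in column s n, with the coefficient of that column. *)
Lemma nat_monomialE (c : nat -> K) :
  (forall n, (n < d + d + 1)%N -> c (s n) = (-1) ^+ e n * p%:R ^ v n) ->
  monomial_mx d s c = monomial_matrix pp nat_monomial.
Proof.
move=> cE; apply/matrixP => i j; rewrite !mxE -val_eqE /= -cE ?ltn_ord //.
rewrite -(inj_eq (can_inj sK) j) sK eq_sym.
by case: eqP => // <-; rewrite sK.
Qed.
End NatMonomial.

(** * The reflections as permutations of heights *)

Section Generators.
Variables (p : nat) (pp : prime p) (d : nat).
Hypothesis hd : (3 <= d)%N.
Local Notation K := (padic_num pp).
Local Notation I := 'I_(d + d + 1).

(* The effect of the rows of [sdot i] on heights, and their exponents. *)
Definition sigma (i h : nat) : nat :=
  if i == 0%N then
    if h == 0%N then (d + d - 1)%N else if h == (d + d - 1)%N then 0%N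
    else if h == 1%N then (d + d)%N else if h == (d + d)%N then 1%N else h
  else if i == d then
    if h == (d - 1)%N then (d + 1)%N else if h == (d + 1)%N then (d - 1)%N else h
  else
    if h == (i - 1)%N then i else if h == i then (i - 1)%N
    else if h == (d + d - i)%N then (d + d - i + 1)%N
    else if h == (d + d - i + 1)%N then (d + d - i)%N else h.

Definition expo_height (i h : nat) : int :=
  if i == 0%N then
    if (h <= 1)%N then -1 else if (d + d - 1 <= h)%N then 1 else 0
  else 0.

Lemma swapK i j : involutive (swap i j).
Proof. by move=> n; rewrite /swap; lif. Qed.

(** The column itself is recorded besides its height because [sdot 0] composes this permutation with
    [udot], which is given on indices. *)
Lemma swap_lt_monomial i : (0 < i < d)%N -> exists w : monomial d,
  [/\ sdot_lt pp d i = monomial_matrix pp w,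
      forall j, height (col w j) = sigma i (height j),
      forall j, col w j = swap i.-1 i (swap (d + i.-1) (d + i) j) :> nat &
      forall j, expo w j = 0].
Proof.
move=> id; pose s := swap i.-1 i \o swap (d + i.-1)%N (d + i)%N.
have s1 n : (n < d + d + 1)%N -> (s n < d + d + 1)%N.
  by move: id; rewrite /s /= /swap; lif.
have s2 : involutive s by move=> n; rewrite /s /= /swap; move: id; lif.
have s3 n : (n < d + d + 1)%N -> s (star_nat d n) = star_nat d (s n).
  by move: id; rewrite /s /star_nat /= /swap; plif.
exists (nat_monomial s1 s2 s3 (v := fun=> 0) (e := fun=> false) (fun _ _ => erefl) (fun _ _ => erefl)).
split=> //; first by apply: nat_monomialE => n _; rewrite expr0z mulr1.
move=> j; rewrite /height /sigma /= /s /= /swap; have := ltn_ord j; move: id; plif.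
Qed.

Lemma sdot_monomial i : (i <= d)%N -> exists w : monomial d,
  [/\ sdot pp d i = monomial_matrix pp w,
      forall j, height (col w j) = sigma i (height j) &
      forall j, expo w j = expo_height i (height j)].
Proof.
move=> id; rewrite /sdot; have [i0|i0] := eqVneq i 0%N; last have [iE|iE] := eqVneq i d.
- pose s := swap 0 d.
  (* Exponents are read by rows: the coefficient p^-1 of column d lies in row 0, and the coefficient
     p of column 0 in row d. *)
  pose v n : int := if n == 0%N then -1 else if n == d then 1 else 0.
  pose e n := n == (d + d)%N.
  have s1 n : (n < d + d + 1)%N -> (s n < d + d + 1)%N by rewrite /s /swap; lif.
  have s2 : involutive s := @swapK 0 d.
  have s3 n : (n < d + d + 1)%N -> s (star_nat d n) = star_nat d (s n).
    by rewrite /s /star_nat /swap; lif.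
  have v1 n : (n < d + d + 1)%N -> v (star_nat d n) = - v n.
    by rewrite /v /star_nat; lif.
  have e1 n : (n < d + d + 1)%N -> e (star_nat d n) = e n.
    by rewrite /e /star_nat; lif.
  have uE : udot pp d = monomial_matrix pp (nat_monomial s1 s2 s3 v1 e1).
    apply: nat_monomialE => n _; rewrite /s /v /e /swap.
    have [->|n0] := eqVneq n 0%N; rewrite ?eqxx.
      by rewrite (_ : d == 0%N = false) 1?(_ : 0%N == (d + d)%N = false) ?mul1r ?exprN1 //; lia.
    have [->|nd] := eqVneq n d.
      by rewrite (_ : d == (d + d)%N = false) ?mul1r ?expr1z //; lia.
    by rewrite (negbTE n0) (negbTE nd) expr0z mulr1; case: eqP.
  have [w [wE _ wc we]] : exists w : monomial d, [/\ sdot_lt pp d 1 = monomial_matrix pp w,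
      forall j, height (col w j) = sigma 1 (height j),
      forall j, col w j = swap 0 1 (swap (d + 0) (d + 1) j) :> nat & forall j, expo w j = 0].
    by apply: swap_lt_monomial; lia.
  rewrite uE wE !monomial_matrixM; set u := nat_monomial s1 s2 s3 v1 e1.
  exists (monomial_mul (monomial_mul u w) u); split=> // j.
    rewrite /height /sigma i0 /= /s !wc /= /s /swap; have := ltn_ord j; plif.
  rewrite /= wc we /v /= /s /expo_height i0 /height /swap; have := ltn_ord j; plif.
- pose s := swap d.-1 (d + d.-1)%N; pose e n := n == (d + d)%N.
  have s1 n : (n < d + d + 1)%N -> (s n < d + d + 1)%N by rewrite /s /swap; lif.
  have s2 : involutive s := @swapK _ _.
  have s3 n : (n < d + d + 1)%N -> s (star_nat d n) = star_nat d (s n).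
    by rewrite /s /star_nat /swap; lif.
  have e1 n : (n < d + d + 1)%N -> e (star_nat d n) = e n.
    by rewrite /e /star_nat; lif.
  exists (nat_monomial s1 s2 s3 (v := fun=> 0) (fun _ _ => erefl) e1); split=> [|j|j].
  + apply: nat_monomialE => n nd; rewrite expr0z mulr1 /e /s.
    rewrite (_ : swap _ _ n == (d + d)%N = (n == (d + d)%N)); first by case: eqP.
    by rewrite /swap; lif.
  + rewrite /height /sigma (negbTE i0) iE eqxx /= /s /swap; have := ltn_ord j; lif.
  + by rewrite /expo_height (negbTE i0).
- have [w [wE wh _ we]] : exists w : monomial d, [/\ sdot_lt pp d i = monomial_matrix pp w,
      forall j, height (col w j) = sigma i (height j),
      forall j, col w j = swap i.-1 i (swap (d + i.-1) (d + i) j) :> nat & forall j, expo w j = 0].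
    by apply: swap_lt_monomial; lia.
  by exists w; split=> // j; rewrite we /expo_height (negbTE i0).
Qed.

End Generators.

(** * The base alcove and its simple reflections *)

Section Alcove.
Variables (p : nat) (pp : prime p) (d : nat) (R : realType).
Hypothesis hd : (3 <= d)%N.
Local Notation I := 'I_(d + d + 1).
Implicit Types (i j b c : I) (w : monomial d) (y : apartment d R).

(** These inequalities determine the sign of every affine root, which is all that is used of the
    position of the base point. *)
Definition alcove y := forall b c, is_root b c -> (height b < height c)%N ->
  0 < ext_coord y b - ext_coord y c < 1.

(* Whether [rt b c + l] is positive on the alcove, in terms of heights. *)
Definition positive (hb hc : nat) (l : int) : bool :=
  if (hb < hc)%N then 0 <= l else 1 <= l.

Lemma alcove_sgr y b c (l : int) : alcove y -> is_root b c ->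
  Num.sg (pairing (rt b c) y + l%:~R) = if positive (height b) (height c) l then 1 else -1.
Proof.
move=> ay bc; rewrite pairing_rt /positive.
have [hbc|hcb] := ltnP (height b) (height c).
  have /andP[h0 h1] := ay b c bc hbc; case: (lerP 0 l) => l0.
    have : (0 : R) <= l%:~R by rewrite ler0z.
    by move=> ?; rewrite gtr0_sg //; lra.
  have : (l%:~R : R) <= (- 1)%:~R by rewrite ler_int; lia.
  by rewrite rmorphN /= => ?; rewrite ltr0_sg //; lra.
have {}hcb : (height c < height b)%N.
  rewrite ltn_neqAle hcb andbT; apply: contraTneq bc => /height_inj ->.
  by rewrite /is_root eqxx.
have cb : is_root c b by rewrite is_root_sym.
have /andP[h0 h1] := ay c b cb hcb; case: (lerP 1 l) => l0.
  have : (1%:~R : R) <= l%:~R by rewrite ler_int.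
  by move=> ?; rewrite gtr0_sg //; lra.
have : (l%:~R : R) <= 0%:~R by rewrite ler_int; lia.
by move=> ?; rewrite ltr0_sg //; lra.
Qed.

(** Signs at the image point are those of the affine roots pulled back along w, again evaluated on
    the alcove, so separation becomes a statement on heights. The four exclusions are the two
    presentations of a + k and the two of its opposite. *)
Lemma alcove_separated y w b c (k : int) : alcove y -> is_root b c ->
  positive (height b) (height c) k ->
  ~~ positive (height (col w b)) (height (col w c)) (k - expo w b + expo w c) ->
  (forall i j l, is_root i j ->
    (height i = height b -> height j = height c -> l <> k) ->
    (height i = (d + d - height c)%N -> height j = (d + d - height b)%N -> l <> k) ->
    (height i = height c -> height j = height b -> l <> - k) ->
    (height i = (d + d - height b)%N -> height j = (d + d - height c)%N -> l <> - k) ->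
    positive (height i) (height j) l =
    positive (height (col w i)) (height (col w j)) (l - expo w i + expo w j)) ->
  separated y (act (monomial_matrix pp w) y) (rt b c) k.
Proof.
move=> ay bc pos npos H; split.
- by apply/roots_rt; exists b, c.
- by rewrite -sgr_gt0 alcove_sgr // pos.
- by rewrite pairing_act -sgr_lt0 alcove_sgr ?is_root_col // (negbTE npos) ltrN10.
move=> _ l /roots_rt[i [j [ij ->]]] n1 n2.
rewrite pairing_act !alcove_sgr ?is_root_col // H // => /eqP hi /eqP hj.
- move: hi hj; rewrite !(inj_eq height_inj) => /eqP iE /eqP jE.
  by apply: n1; rewrite iE jE.
- move: hi hj; rewrite -!height_star !(inj_eq height_inj) => /eqP iE /eqP jE.
  by apply: n1; rewrite iE jE rt_star.
- move: hi hj; rewrite !(inj_eq height_inj) => /eqP iE /eqP jE.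
  by apply: n2; rewrite iE jE rt_opp.
- move: hi hj; rewrite -!height_star !(inj_eq height_inj) => /eqP iE /eqP jE.
  by apply: n2; rewrite iE jE rt_star rt_opp.
Qed.

(* The least [l] such that [rt b c + l] is positive on the alcove. *)
Definition threshold (hb hc : nat) : int := if (hb < hc)%N then 0 else 1.

Lemma positiveE hb hc l : positive hb hc l = (threshold hb hc <= l).
Proof. by rewrite /positive /threshold; case: ifP. Qed.

(* The pairs of heights giving the root of the pair [(m, n)]. *)
Definition same_root (m n a b : nat) : bool :=
  ((a == m) && (b == n)) || ((a == d + d - n)%N && (b == d + d - m)%N).

Lemma same_root_star (m n a b : nat) : (m <= d + d)%N -> (n <= d + d)%N ->
  same_root (d + d - n) (d + d - m) a b = same_root m n a b.
Proof. by move=> md nd; rewrite /same_root !subKn // orbC. Qed.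

Lemma same_root_sym (m n a b : nat) : (m <= d + d)%N -> (n <= d + d)%N ->
  m != n -> (m + n)%N != (d + d)%N -> ~~ (same_root m n a b && same_root n m a b).
Proof. by clear; rewrite /same_root; lia. Qed.

Lemma threshold_star (m n : nat) : (m <= d + d)%N -> (n <= d + d)%N ->
  threshold (d + d - n) (d + d - m) = threshold m n.
Proof. by move=> md nd; rewrite /threshold (_ : (d + d - n < d + d - m)%N = (m < n)%N) //; lia. Qed.

(** The left side is the threshold seen from the reflected alcove. Crossing one wall raises it by 1
    for the root (m, n), lowers it by 1 for the opposite root and changes nothing else. *)
Definition threshold_step (i m n : nat) := forall a b : nat,
  (a <= d + d)%N -> (b <= d + d)%N -> a != b -> (a + b)%N != (d + d)%N ->
  threshold (sigma d i a) (sigma d i b) + expo_height d i a - expo_height d i b =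
  threshold a b + (same_root m n a b)%:Z - (same_root n m a b)%:Z.

Lemma threshold_lt (i : nat) : (0 < i < d)%N -> threshold_step i (i - 1) i.
Proof.
move=> /andP[i0 id] a b ad bd ab abd; rewrite /expo_height /sigma.
rewrite (_ : i == 0%N = false) 1?(_ : i == d = false) ?subr0 ?addr0; try lia.
rewrite /threshold /same_root; plif.
Qed.

Lemma threshold_last : threshold_step d (d - 1) d.
Proof.
move=> a b ad bd ab abd; rewrite /expo_height /sigma eqxx.
rewrite (_ : d == 0%N = false) ?subr0 ?addr0; last by lia.
rewrite /threshold /same_root; plif.
Qed.

Lemma threshold_affine : threshold_step 0 (d + d - 1) 0.
Proof.
move=> a b ad bd ab abd; rewrite /expo_height /sigma eqxx.
rewrite /threshold /same_root; plif.
Qed.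

(* The height of the first index of the wall crossed at step [n]. *)
Definition step_height (n : nat) : nat := if (n < d)%N then n else n.+1.

Lemma beta_threshold n : (n < d + d - 1)%N ->
  exists2 m : nat, [&& (m <= d + d)%N, step_height n != m & (step_height n + m != d + d)%N] &
    threshold_step (beta d n.+1) (step_height n) m.
Proof.
move=> nd; have [n1|n1] := ltnP n.+1 d; last have [n2|n2] := ltnP n d;
  last have [n3|n3] := ltnP n (d + d - 2)%N.
- have -> : beta d n.+1 = n.+1 by rewrite /beta; lif.
  have -> : step_height n = (n.+1 - 1)%N by rewrite /step_height; lif.
  by exists n.+1; [lia|apply: threshold_lt].
- have -> : beta d n.+1 = d by rewrite /beta; lif.
  have -> : step_height n = (d - 1)%N by rewrite /step_height; lif.
  by exists d; [lia|apply: threshold_last].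
(* On the way back the reflection [sdot i] occurs again, but its root is now presented by the dual
   pair (2d - i, 2d - i + 1), so that it starts at the prescribed height. *)
- pose i := (d + d - n.+1)%N.
  have -> : beta d n.+1 = i by rewrite /beta /i; lif.
  have -> : step_height n = (d + d - i)%N by rewrite /step_height /i; lif.
  exists (d + d - (i - 1))%N; first by rewrite /i; lia.
  move=> a b ad bd ab abd; rewrite threshold_lt //; last by rewrite /i; lia.
  by rewrite !same_root_star // /i; lia.
- have -> : beta d n.+1 = 0%N by rewrite /beta; lif.
  have -> : step_height n = (d + d - 1)%N by rewrite /step_height; lif.
  by exists 0%N; [lia|apply: threshold_affine].
Qed.

Lemma simple_separated y n : alcove y -> (n < d + d - 1)%N ->
  exists b c k, [/\ height b = step_height n, is_root b c &
    separated y (act (sdot pp d (beta d n.+1)) y) (rt b c) k].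
Proof.
move=> ay nd; have bd : (beta d n.+1 <= d)%N by rewrite /beta; lif.
have [w [-> wh we]] := sdot_monomial pp hd bd.
have [m /and3P[md mn mnd] H] := beta_threshold nd.
have [b hb] : exists b : I, height b = step_height n.
  by apply: height_surj; rewrite /step_height; lif.
have [c hc] := height_surj md.
have bc : is_root b c by rewrite is_root_height hb hc mn.
have HE i j : is_root i j -> threshold (height (col w i)) (height (col w j)) =
    threshold (height i) (height j) - expo w i + expo w j +
    (same_root (height b) (height c) (height i) (height j))%:Z -
    (same_root (height c) (height b) (height i) (height j))%:Z.
  rewrite is_root_height => /andP[h1 h2]; rewrite hb hc !wh !we.
  by have := H _ _ (height_le i) (height_le j) h1 h2; lia.
exists b, c, (threshold (height b) (height c)); split=> //; apply: alcove_separated => //.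
- by rewrite positiveE.
- rewrite positiveE HE // /same_root !eqxx /=.
  have : ~~ ((height b == height c) && (height c == height b)) by rewrite hb hc negb_and mn.
  have := height_le b; have := height_le c; rewrite hb hc; move: mnd; lia.
move=> i j l ij e1 e2 e3 e4; rewrite !positiveE HE //.
set k := threshold (height b) (height c) in e1 e2 e3 e4 *.
(* Thresholds of opposite roots sum to 1, so - a - k lies just below the threshold of - a, as a + k
   lies at that of a. *)
have tN : threshold (height c) (height b) = 1 - k.
  by rewrite /k /threshold hb hc; case: ltngtP mn.
have hP : same_root (height b) (height c) (height i) (height j) ->
    threshold (height i) (height j) = k /\ l <> k.
  case/orP=> /andP[/eqP h1 /eqP h2]; [split; last exact: e1|split; last exact: e2].
    by rewrite h1 h2.
  by rewrite h1 h2 threshold_star ?height_le.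
have hQ : same_root (height c) (height b) (height i) (height j) ->
    threshold (height i) (height j) = 1 - k /\ l <> - k.
  case/orP=> /andP[/eqP h1 /eqP h2]; [split; last exact: e3|split; last exact: e4].
    by rewrite h1 h2 tN.
  by rewrite h1 h2 threshold_star ?height_le.
have PQ : ~~ (same_root (height b) (height c) (height i) (height j) &&
              same_root (height c) (height b) (height i) (height j)).
  by apply: same_root_sym; rewrite ?height_le // hb hc.
move: hP hQ PQ; case: (same_root _ _ _ _); case: (same_root _ _ _ _) => //= hP hQ _.
- by have [-> lk] := hP isT; lia.
- by have [-> lk] := hQ isT; lia.
- lia.
Qed.
End Alcove.

(** * The gallery, its roots, and the matrix of phi *)

Section Gallery.
Variables (p : nat) (pp : prime p) (d : nat) (R : realType).
Hypothesis hd : (3 <= d)%N.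
Local Notation K := (padic_num pp).
Local Notation I := 'I_(d + d + 1).
Local Notation mat := 'M[K]_(d + d + 1).
Implicit Types (g h : mat) (i j b c : I) (w : monomial d) (y : apartment d R).

Lemma gallery_eltS n : gallery_elt pp d n.+1 =
  gallery_elt pp d n * sdot pp d (beta d (n %% d.*2.-1).+1).
Proof.
have m0 : (0 < d.*2.-1)%N by lia.
rewrite /gallery_elt; set m := d.*2.-1 in m0 *; set r := (n %% m)%N; set q := (n %/ m)%N.
have nE : n = (q * m + r)%N := divn_eq n m.
have rm : (r < m)%N by rewrite ltn_mod.
have [rm1|rm1] := ltnP r.+1 m.
  have -> : (n.+1 %/ m)%N = q by rewrite nE -addnS divnMDl // divn_small // addn0.
  have -> : (n.+1 %% m)%N = r.+1 by rewrite nE -addnS modnMDl modn_small.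
  by rewrite [in LHS]big_nat_recr //= mulrA.
have rE : r.+1 = m by apply/eqP; rewrite eqn_leq rm1 rm.
have -> : (n.+1 %/ m)%N = q.+1 by rewrite nE -addnS rE -mulSnr mulnK.
have -> : (n.+1 %% m)%N = 0%N by rewrite nE -addnS rE -mulSnr modnMl.
rewrite [in LHS]big_geq // mulr1 exprSr -mulrA; congr (_ * _).
rewrite /phi (_ : d.*2 = r.+2); last by move: rE; rewrite /m; lia.
by rewrite big_nat_recr.
Qed.

Lemma gallery_elt0 : gallery_elt pp d 0 = 1.
Proof. by rewrite /gallery_elt div0n mod0n expr0 big_geq ?mulr1. Qed.

(** The last reflection of a period brings the tracked index back to height 0; this periodicity
    reduces all steps to those of one factor [phi]. *)
Lemma sigma_step n : (n < d + d - 1)%N -> sigma d (beta d n.+1) (step_height d n) =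
  step_height d (if n.+1 == (d + d - 1)%N then 0%N else n.+1).
Proof. by rewrite /sigma /beta /step_height; plif. Qed.

Lemma gallery_monomial n : exists w : monomial d,
  gallery_elt pp d n = monomial_matrix pp w /\
  forall b, height b = 0%N -> height (col w b) = step_height d (n %% d.*2.-1).
Proof.
have m0 : (0 < d.*2.-1)%N by lia.
elim: n => [|n [w [wE hw]]].
  exists (monomial_one d); rewrite gallery_elt0 monomial_matrix1; split=> // b hb.
  by rewrite mod0n /= hb /step_height; lif.
have rm : (n %% d.*2.-1 < d + d - 1)%N.
  by have := ltn_pmod n m0; lia.
have bd : (beta d (n %% d.*2.-1).+1 <= d)%N by rewrite /beta; lif.
have [s [sE hs _]] := sdot_monomial pp hd bd.
exists (monomial_mul w s); rewrite gallery_eltS wE sE monomial_matrixM; split=> // b hb.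
rewrite /= hs hw // sigma_step //; congr step_height.
have : (n.+1 %% d.*2.-1 = (n %% d.*2.-1).+1 %% d.*2.-1)%N by rewrite -addn1 -modnDml addn1.
move=> ->; move: rm; move: (n %% _)%N => r rm.
case: eqP => rE; first by rewrite (_ : r.+1 = d.*2.-1) ?modnn //; lia.
by rewrite modn_small //; lia.
Qed.

Let b0 : I := eI (Ordinal (leq_trans (isT : 0 < 3)%N hd)).

Lemma height_b0 : height b0 = 0%N.
Proof. by rewrite /height /=; lif. Qed.

Lemma col_surj w b : exists b', col w b' = b.
Proof. by exists (invF (@col_inj _ w) b); rewrite f_invF. Qed.

(** The two chambers are the images under one monomial matrix of the base chamber and of its
    reflection. By [gallery_monomial] the first index of the reflecting wall is the image of [b0],
    so pulling back gives a root that starts at [b0]. *)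
Lemma gallery_step y n w w' : alcove y ->
  gallery_elt pp d n = monomial_matrix pp w ->
  gallery_elt pp d n.+1 = monomial_matrix pp w' ->
  exists c k, is_root b0 c /\
    separated (act (monomial_matrix pp w) y) (act (monomial_matrix pp w') y) (rt b0 c) k.
Proof.
move=> ay wE wE'; have m0 : (0 < d.*2.-1)%N by lia.
have rm : (n %% d.*2.-1 < d + d - 1)%N.
  by have := ltn_pmod n m0; lia.
have bd : (beta d (n %% d.*2.-1).+1 <= d)%N by rewrite /beta; lif.
have [s [sE hs _]] := sdot_monomial pp hd bd.
have [b [c [k [hb bc sep]]]] := simple_separated pp hd ay rm.
have [w1 [w1E hw1]] := gallery_monomial n.
have bE : b = col w1 b0 by apply: height_inj; rewrite hb hw1 // height_b0.
have [c' cE] := col_surj w1 c.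
exists c', (k + expo w1 b0 - expo w1 c').
have bc' : is_root b0 c' by rewrite -(is_root_col w1) -bE cE.
split=> //; rewrite -wE -wE' gallery_eltS w1E sE monomial_matrixM act_mul.
by apply: separated_act => //; rewrite -bE cE -sE.
Qed.

Lemma pos_roots_b0 c : is_root b0 c -> pos_roots (rt b0 c).
Proof.
move=> bc; apply/pos_roots_rt; exists b0, c; split=> //.
have [cb _] := andP bc; rewrite height_b0 lt0n -height_b0.
by apply: contraNneq cb => /height_inj ->.
Qed.

(** The weight of c is different from e_1 and - e_1, so the root has first coordinate 1, the only
    coordinate seen by [tau]. *)
Lemma chi_tau c x : is_root b0 c -> chi (rt b0 c) (tau d x : mat) = x%:F.
Proof.
move=> /andP[c1 c2]; rewrite /chi (bigD1 (Ordinal (leq_trans (isT : 0 < 3)%N hd))) //= big1 ?mulr1.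
  rewrite !mxE eqxx /= mulr1n /omega_nat.
  move: c1 c2; rewrite -!val_eqE /= /star_nat => c1 c2.
  rewrite (_ : _ - _ = 1) ?expr1z //; move: c1 c2; lif.
move=> i i0; rewrite !mxE eqxx mulr1n /=.
rewrite (_ : (i == 0 :> nat) = false) 1?(_ : (i == d :> nat) = false) ?exp1rz //.
  by have := ltn_ord i; lia.
by move: i0; rewrite -val_eqE /=; lia.
Qed.

(* The effect on heights of the partial product of the first [n] factors of [phi]. *)
Definition prefix_low (n h : nat) : nat :=
  if (n < d)%N then
    if h == 0%N then n else if (h <= n)%N then (h - 1)%N else h
  else
    if h == 0%N then n.+1 else if (d + d <= h + n)%N then h else (h - 1)%N.

(** The heights above d are obtained from those below by the duality h -> 2d - h. *)
Definition prefix (n h : nat) : nat :=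
  if (h < d)%N then prefix_low n h
  else if h == d then d else (d + d - prefix_low n (d + d - h))%N.

Lemma sigma_prefix (n h : nat) : (n < d + d - 2)%N -> (h <= d + d)%N ->
  sigma d (beta d n.+1) (prefix n h) = prefix n.+1 h.
Proof. by rewrite /sigma /beta /prefix /prefix_low; plif. Qed.

Lemma prefix_monomial n : (n <= d + d - 2)%N -> exists w : monomial d,
  [/\ \prod_(1 <= i < n.+1) sdot pp d (beta d i) = monomial_matrix pp w,
      forall j, height (col w j) = prefix n (height j) & forall j, expo w j = 0].
Proof.
elim: n => [|n IHn] nd.
  exists (monomial_one d); rewrite big_geq // monomial_matrix1; split=> // j /=.
  by rewrite /prefix /prefix_low; have := height_le j; plif.
have [w [wE hw we]] := IHn (ltnW nd).
have bd : (beta d n.+1 <= d)%N by rewrite /beta; lif.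
have bn : (beta d n.+1 != 0)%N by rewrite /beta; lif.
have [s [sE hs se]] := sdot_monomial pp hd bd.
exists (monomial_mul w s); rewrite big_nat_recr //= wE sE monomial_matrixM; split=> // j /=.
  by rewrite hs hw sigma_prefix ?height_le.
by rewrite we se /expo_height (negbTE bn).
Qed.

(** Up to signs and powers of p, [phi] fixes the lines of weight e_1 and - e_1 and exchanges those
    of e_2 and - e_2. Hence its square is diagonal and it commutes with [tau], which lives on the
    first two lines. *)
Lemma phi_monomial : exists w : monomial d, phi pp d = monomial_matrix pp w /\
  forall j, height (col w j) = (if height j == 1%N then (d + d - 1)%N
     else if height j == (d + d - 1)%N then 1%N else height j) /\
   expo w j = (if height j == 0%N then 1 else if height j == 1%N then -1
     else if height j == (d + d - 1)%N then 1 else if height j == (d + d)%N then -1 else 0).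
Proof.
have [w [wE hw we]] := prefix_monomial (leqnn _).
have [s [sE hs se]] := sdot_monomial pp hd (leq0n d).
exists (monomial_mul w s); split.
  rewrite -monomial_matrixM -wE -sE /phi (_ : d.*2 = (d + d - 2).+2); last by lia.
  rewrite big_nat_recr //=; congr (_ * sdot _ _ _); rewrite /beta; lif.
move=> j; rewrite /= we add0r hs se hw; have := height_le j; move: (height j) => h.
by split; rewrite /sigma /expo_height /prefix /prefix_low; plif.
Qed.
End Gallery.

Lemma mul_natS (A : pzRingType) (n : nat) (x : A) : n.+1%:R * x = x + n%:R * x.
Proof. by rewrite -nat1r mulrDl mul1r. Qed.

(** * The base chamber, N_0 and conjugation by the square of phi *)

Section BaseChamber.
Variables (p : nat) (pp : prime p) (d : nat) (R : realType).
Hypothesis hd : (3 <= d)%N.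
Local Notation K := (padic_num pp).
Local Notation I := 'I_(d + d + 1).
Local Notation mat := 'M[K]_(d + d + 1).
Implicit Types (g h : mat) (t : K) (i j b c : I) (w : monomial d) (y : apartment d R).

Lemma root_eltX b c t (n : nat) : is_root b c ->
  root_elt b c t ^+ n = root_elt b c (n%:R * t).
Proof.
move=> bc; elim: n => [|n IHn]; first by rewrite expr0 mul0r root_elt0.
rewrite exprS IHn; apply: etrans (root_eltD _ _ bc) _.
by congr (root_elt b c _); exact: esym (mul_natS n t).
Qed.

Lemma root_group0P b c g : is_root b c ->
  root_group0 pp (rt b c) g <-> exists2 t, vge t ((shift p b c)%:R : R) & g = root_elt b c t.
Proof.
move=> bc; split=> [[/(root_groupP _ bc)[t ->] h]|[t ht ->]].
  by exists t => //; apply/(SLZp_root_elt R _ bc).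
by split; [apply/root_groupP => //; exists t|apply/(SLZp_root_elt R)].
Qed.

(** For a positive root a, the generators N_a^0 in I force a >= 0 at y, and the p-th powers of
    N_(-a)^0 force a <= 1; genericity makes both strict. The tests use the parameter p^shift, of
    least valuation in these groups, and its p-th power. *)
Lemma pro_p_iwahori_alcove y : generic y -> pro_p_iwahori pp d `<=` iwahori pp (facet y) ->
  alcove y.
Proof.
move=> gy I0 b c bc hbc; have cb : is_root c b by rewrite is_root_sym.
have sE : shift p c b = shift p b c by rewrite /shift addbC.
have pn : p%:R * p%:R ^ (shift p b c)%:Z = p%:R ^ (shift p b c).+1%:Z :> K.
  by rewrite -exprS.
have [h1 h2] : 0 <= ext_coord y b - ext_coord y c /\ ext_coord y b - ext_coord y c <= 1.
  split.
    have /I0/iwahori_sub[_ /(in_order_root_elt _ _ bc)] :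
        pro_p_iwahori pp d (root_elt b c (p%:R ^ (shift p b c)%:Z)).
      apply: sub_generated; left; left; exists (rt b c).
        by apply/pos_roots_rt; exists b, c.
      by apply/root_group0P => //; exists (p%:R ^ (shift p b c)%:Z) => //; apply/vge_pexp; rewrite -pmulrn.
    by move/vge_pexp; rewrite /bound -pmulrn; lra.
  have /I0/iwahori_sub[_ /(in_order_root_elt _ _ cb)] :
      pro_p_iwahori pp d (root_elt c b (p%:R ^ (shift p b c).+1%:Z)).
    apply: sub_generated; left; right; exists (rt c b).
      by rewrite /= -rt_opp; apply/pos_roots_rt; exists b, c.
    exists (root_elt c b (p%:R ^ (shift p b c)%:Z)); last exact: etrans (root_eltX _ _ cb) (congr1 _ pn).
    by apply/root_group0P => //; exists (p%:R ^ (shift p b c)%:Z) => //; apply/vge_pexp; rewrite sE -pmulrn.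
  by move/vge_pexp; rewrite /bound sE -pmulrn -natr1; lra.
have rb : roots (rt b c) by apply/roots_rt; exists b, c.
have n0 := gy _ 0 rb; have n1 := gy _ (-1) rb.
rewrite /wall /= pairing_rt in n0 n1; rewrite !lt_neqAle h1 h2 !andbT.
apply/andP; split; apply/eqP => E; [apply: n0|apply: n1].
  by rewrite -E addr0.
by rewrite E rmorphN /= subrr.
Qed.

(** The bound is shift - a with 0 < a < 1, and an integer above it is at least the shift. *)
Lemma bound_alcove y b c x : alcove y -> is_root b c -> (height b < height c)%N ->
  vge x (bound p y b c) <-> vge (x : K) ((shift p b c)%:R : R).
Proof.
move=> ay bc hbc; have /andP[h0 h1] := ay b c bc hbc; apply: vge_eq => m.
have [sm|ms] := lerP (shift p b c)%:Z m.
  have : (((shift p b c)%:Z)%:~R : R) <= m%:~R by rewrite ler_int.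
  rewrite -pmulrn => sm'; rewrite sm' /bound; lra.
have : (m%:~R : R) <= ((shift p b c)%:Z - 1)%:~R by rewrite ler_int; lia.
rewrite rmorphB /= -pmulrn => ms'; transitivity false; [|symmetry]; apply/negP => h.
  by move: h; rewrite /bound; lra.
by lra.
Qed.

Lemma unipotent0E y : alcove y -> unipotent0 pp d = unip_part y.
Proof.
move=> ay; apply/seteqP; split; last first.
  move=> g [Ug yg]; apply: (@unitriangular_factor p pp d R y (unipotent0 pp d)) => //.
  - exact: generated1.
  - exact: generatedM.
  move=> b c t bc hbc ht; apply: sub_generated; exists (rt b c).
    by apply/pos_roots_rt; exists b, c.
  by apply/root_group0P => //; exists t => //; apply/(bound_alcove _ ay bc hbc).
apply: generated_sub; first exact: unip_part_subgroup.
move=> g [a /pos_roots_rt[b [c [bc hbc ->]]]] /(root_group0P _ bc)[t ht ->].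
split; first exact: root_elt_unitriangular.
by apply/in_order_root_elt => //; apply/(bound_alcove _ ay bc hbc).
Qed.

Lemma phi_sqr : exists w : monomial d, [/\ phi pp d ^+ 2 = monomial_matrix pp w,
  forall j, col w j = j & forall i j, (height i < height j)%N -> expo w j <= expo w i].
Proof.
have [w [wE hw]] := phi_monomial pp hd.
exists (monomial_mul w w); rewrite expr2 wE monomial_matrixM; split=> // [j|i j].
  apply: height_inj; rewrite /= !(hw _).1; have := height_le j.
  by move: (height j) => h; plif.
rewrite /= !(hw _).2 !(hw _).1.
have := height_le i; have := height_le j; move: (height i) (height j) => h1 h2.
by plif.
Qed.

Lemma phi_sqr_torus : torus pp d (phi pp d ^+ 2).
Proof.
have [w [wE _]] := phi_monomial pp hd; have ow := orth_monomial pp w.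
have [w2 [w2E cw _]] := phi_sqr.
split.
  split; last by rewrite w2E; apply/orthP/orth_monomial.
  by rewrite expr2 det_mulmx -expr2 wE det_orth_sqr.
rewrite w2E; apply/is_diag_mxP => i j; rewrite mxE cw => ij.
by rewrite -val_eqE eq_sym (negbTE ij).
Qed.

(** Conjugation multiplies the entry (b, c) by p to the power [expo w b - expo w c], up to sign. By
    [phi_sqr] exponents do not increase with height, so entries above the diagonal only gain
    valuation. *)
Lemma phi_sqr_conj y g : unip_part y g ->
  unip_part y (phi pp d ^+ 2 * g * invmx (phi pp d ^+ 2)).
Proof.
move=> [[og tg dg] yg]; have [w [wE cw ew]] := phi_sqr.
have tt := phi_sqr_torus; rewrite wE in tt *; have [_ dt] := tt.
have ow := orth_monomial pp w; set D := monomial_matrix pp w in tt dt ow *.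
have DE i : D i i = (-1) ^+ neg w i * p%:R ^ expo w i by rewrite /D mxE cw eqxx.
have aD : is_diag_mx (adj D).
  by apply/is_diag_mxP => i j ij; rewrite mxE (torus_diag tt) // (can_eq starK) eq_sym.
have E i j : (D * g * invmx D) i j = D i i * g i j * D (star j) (star j).
  have -> : D * g * invmx D = D *m g *m adj D := congr1 (mulmx (D *m g)) (orth_inv ow).
  rewrite (mulmx_torusr _ _ _ aD) (mulmx_torusl _ _ _ dt).
  by congr (_ * _); rewrite mxE.
have U : unitriangular (D * g * invmx D).
  split=> [|i j ij|i].
  - by apply: orthM; [apply: orthM|apply: orthV].
  - by rewrite E tg // mulr0 mul0r.
  - by rewrite E dg mulr1 (torus_mul_star _ tt).
split=> //; apply: in_order_roots => // b c bc hbc; rewrite E.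
have vD i : vge (D i i) ((expo w i)%:~R : R).
  rewrite DE mulrC; have -> : (-1) ^+ neg w i = ((-1) ^+ neg w i : padic_int pp)%:F :> K.
    by rewrite tofracXn tofracN tofrac1.
  by apply/vge_unit => //; rewrite unitrX // unitrN unitr1.
have := vgeM (vgeM (vD b) (yg b c)) (vD (star c)); apply: vgeW.
have : ((expo w c)%:~R : R) <= (expo w b)%:~R by rewrite ler_int ew.
rewrite expo_star rmorphN /=; lra.
Qed.

Lemma tau_phi (a : padic_int pp) : tau d a * phi pp d = phi pp d * tau d a.
Proof.
have [w [-> hw]] := phi_monomial pp hd.
apply/matrixP => i j; rewrite mulmx_torusl ?diag_mx_is_diag // mulmx_torusr ?diag_mx_is_diag //.
rewrite [monomial_matrix pp w i j]mxE; case: eqP => [->|_]; last by rewrite mulr0 mul0r.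
rewrite mulrC; congr (_ * _); rewrite !mxE !eqxx !mulr1n.
have h0 (k : I) : (k == 0 :> nat) = (height k == 0%N).
  by rewrite /height; have := ltn_ord k; plif.
have h1 (k : I) : (k == d :> nat) = (height k == (d + d)%N).
  by rewrite /height; have := ltn_ord k; plif.
rewrite !h0 !h1 (hw i).1.
rewrite (_ : (if _ then _ else _) == 0%N = (height i == 0%N)); last by lif.
by rewrite (_ : (if _ then _ else _) == (d + d)%N = (height i == (d + d)%N)); last by lif.
Qed.
End BaseChamber.

(* C is the chamber fixed by the Iwahori subgroup containing the pro-p-Iwahori
   subgroup I_0. *)
Theorem lemma4p7 (p : nat) (pp : prime p) (d : nat) (hd : (3 <= d)%N)
    (R : realType) (C : set (apartment d R)) (chamberC : is_chamber C)
    (I0_sub_I : pro_p_iwahori pp d `<=` iwahori pp C) :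
  (* (a) *)
  [/\ torus pp d (phi pp d ^+ 2),
      [set phi pp d ^+ 2 * g * invmx (phi pp d ^+ 2) | g in unipotent0 pp d]
        `<=` unipotent0 pp d,
      unipotent0 pp d = N0_ pp C 0,
      (forall i : nat, N0_ pp C i.+1 `<=` N0_ pp C i /\
         has_index (N0_ pp C i) (N0_ pp C i.+1) p) &
      (forall j : nat,
         (exists! delta, crossing_root pp (gallery pp C j) (gallery pp C j.+1) delta) /\
         (forall delta, crossing_root pp (gallery pp C j) (gallery pp C j.+1) delta ->
            pos_roots delta))] /\
  (* (b) *)
  (forall (j : nat) (delta : lattice d),
     crossing_root pp (gallery pp C j) (gallery pp C j.+1) delta ->
     forall x : padic_int pp, x \is a GRing.unit ->
       chi delta (tau d x) = x%:F) /\
  (* (c) *)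
  (forall a : padic_int pp, a \is a GRing.unit ->
     tau d a * phi pp d = phi pp d * tau d a).
Proof.
have d0 : (0 < d)%N by apply: leq_trans hd.
have [x gx CE] := chamberC; rewrite CE in I0_sub_I *.
have ax : alcove x by apply: pro_p_iwahori_alcove I0_sub_I.
have galE n w : gallery_elt pp d n = monomial_matrix pp w ->
    gallery pp (facet x) n = facet (act (monomial_matrix pp w) x).
  by move=> E; rewrite /gallery E facet_act.
have NE n w : gallery_elt pp d n = monomial_matrix pp w ->
    N0_ pp (facet x) n = unip_part (act (monomial_matrix pp w) x).
  by move=> E; rewrite /N0_ (galE _ _ E) iwahori_unipotent.
have step n : exists b c, [/\
    (N0_ pp (facet x) n.+1 `<=` N0_ pp (facet x) n /\
     has_index (N0_ pp (facet x) n) (N0_ pp (facet x) n.+1) p),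
    crossing_root pp (gallery pp (facet x) n) (gallery pp (facet x) n.+1) (rt b c),
    pos_roots (rt b c) & (forall z : padic_int pp, chi (rt b c) (tau d z) = z%:F)] /\
    forall delta, crossing_root pp (gallery pp (facet x) n) (gallery pp (facet x) n.+1) delta ->
      delta = rt b c.
  have [w [wE _]] := gallery_monomial pp hd n.
  have [w' [wE' _]] := gallery_monomial pp hd n.+1.
  have [c [k [bc sep]]] := gallery_step hd ax wE wE'.
  have gw v : generic (act (monomial_matrix pp v) x) by apply: generic_act.
  have [cr uniq] := separated_crossing_root pp (gw w) (gw w') sep.
  (* The first index is left to unification: it is the index of e_1 imposed by [gallery_step], the
     same for every n. *)
  eexists; exists c; rewrite (galE _ _ wE) (galE _ _ wE') (NE _ _ wE) (NE _ _ wE').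
  split; last exact: uniq.
  split=> //.
  - exact: (unip_part_index pp d0 bc (height_b0 pp hd) sep).
  - exact: (pos_roots_b0 pp bc).
  - by move=> z; apply: chi_tau.
have gal0 : gallery_elt pp d 0 = monomial_matrix pp (monomial_one d).
  by rewrite gallery_elt0 monomial_matrix1.
have act1 : act (monomial_matrix pp (monomial_one d)) x = x.
  by apply: ext_coord_inj => b; rewrite ext_coord_act /= subr0.
have N0E : unipotent0 pp d = N0_ pp (facet x) 0.
  by rewrite (NE _ _ gal0) act1 (unipotent0E pp hd ax).
split; [split|split].
- exact: phi_sqr_torus.
- rewrite (unipotent0E pp hd ax) => _ [g gU <-]; exact: phi_sqr_conj.
- exact: N0E.
- by move=> n; have [b [c [[h _ _ _] _]]] := step n.
- move=> n; have [b [c [[_ cr pr _] uniq]]] := step n; split.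
    by exists (rt b c); split=> // delta /uniq.
  by move=> delta /uniq ->.
- move=> n delta; have [b [c [[_ _ _ ch] uniq]]] := step n.
  by move=> /uniq -> z _; apply: ch.
- by move=> a _; apply: tau_phi.
Qed.
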